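(* Let $K$ be a difference field of characteristic $0$ with $C_K=D_K$, let $A\in\mathrm{GL}_n(K)$, let $R=K[Y,\det(Y)^{-1}]$ where $Y=(Y_{i,j})$ is an $n\times n$ matrix of indeterminates and $\sigma(Y)=AY$, let $L$ be the field of fractions of $R$, and let $R'$ be a Picard-Vessiot ring for $\sigma(X)=AX$ over $K$. Then $KC_L[R]$ is a Picard-Vessiot ring for $\sigma(X)=AX$ over $KC_L$, $$\mathrm{Kr.dim}(R')=\mathrm{tr.deg}(L/KC_L),\qquad\text{and}\qquad [D_L:C_L]=m(R').$$
   Context: A difference ring (field) is a commutative ring with $1$ (a field) with a distinguished automorphism $\sigma$. For a difference ring $S$: $C_S=\{a\in S:\sigma(a)=a\}$, $D_S=\{a\in S:\sigma^m(a)=a\text{ for some }m\neq0\}$. $KC_L$ is the subfield of $L$ generated by $K$ and $C_L$, and $KC_L[R]$ the subring of $L$ generated by $KC_L$ and $R$. $\mathrm{Kr.dim}$ denotes Krull dimension. A Picard-Vessiot ring for $\sigma(X)=AX$ over a difference field $F$ (with $A\in\mathrm{GL}_n(F)$) is a difference ring extension $S=F[y,\det(y)^{-1}]$ of $F$, with $y\in\mathrm{GL}_n(S)$, $\sigma(y)=Ay$, having no $\sigma$-invariant ideals other than $(0)$ and $S$. Invariants of a Picard-Vessiot ring $R'$ over $K$: there are a unique integer $\ell=\ell(R')\ge1$ (the number of primitive idempotents of $R'$) and a decomposition $R'=\bigoplus_{i=0}^{\ell-1}R_i$, $R_i=e_iR'$, where the $e_i=\sigma^i(e_0)$ are the primitive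 idempotents and each $R_i$ is a domain stable under $\sigma^\ell$. $K$ is identified with its image $e_0K$ in $R_0$. Let $R_0^*$ be the field of fractions of $R_0$, regarded as a $\sigma^\ell$-difference field, so that $C_{R_0^*}$ is the subfield of elements fixed by $\sigma^\ell$ and $D_{R_0^*}$ the subfield of elements fixed by some nonzero power of $\sigma^\ell$. The $m$-invariant of $R'$ is $m(R')=\ell(R')\cdot[D_{R_0^*}:D_KC_{R_0^*}]$. *)

(* Defs.v *)
From HB Require Import structures.
From mathcomp Require Import all_boot all_order all_algebra.
From mathcomp Require Import boolp classical_sets.
From mathcomp Require Import mpoly.

Set Implicit Arguments.
Unset Strict Implicit.
Unset Printing Implicit Defensive.

Import GRing.Theory.
Local Open Scope classical_set_scope.
Local Open Scope ring_scope.

(* A difference ring is a commutative ring together with a bijective ring     *)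
(* endomorphism sigma.  Subrings, subfields and ideals are subsets of an      *)
(* ambient ring; comUnitRingType loses no generality, since units are         *)
(* classically decidable in any nonzero ring.                                 *)

Section DifferenceRing.
Variables (T : comUnitRingType) (sigma : T -> T).

Definition constants : set T := [set a | sigma a = a].

(* sigma is bijective in all uses, so sigma^m a = a for some integer m != 0   *)
(* iff the same holds for some m > 0.                                         *)
Definition periodic : set T := [set a | exists2 m, (0 < m)%N & iter m sigma a = a].

End DifferenceRing.

Section Substructures.
Variable T : comUnitRingType.

Definition subring (S : set T) : Prop := subring_closed (mem S).

(* x^-1 = x when x is not a unit, hence the second clause.                    *)
Definition subfield (F : set T) : Prop :=
  divring_closed (mem F) /\ (forall x, F x -> x != 0 -> x \is a GRing.unit).

Definition subring_gen (G : set T) : set T := smallest subring G.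
Definition subfield_gen (G : set T) : set T := smallest subfield G.

Definition entries m n (M : 'M[T]_(m, n)) : set T :=
  [set x | exists i j, x = M i j].

(* F[y, det(y)^-1] *)
Definition adjoin_GL (F : set T) n (y : 'M[T]_n) : set T :=
  subring_gen (F `|` entries y `|` [set (\det y)^-1]).

Definition ideal_in (S I : set T) : Prop :=
  [/\ I `<=` S, I 0, (forall x y, I x -> I y -> I (x + y))
    & forall a x, S a -> I x -> I (a * x)].

End Substructures.

(* S is a Picard-Vessiot ring for sigma(X) = A X over F, where both F and S   *)
(* are subrings of the difference ring (T, sigma).                            *)
Definition Picard_Vessiot (T : comUnitRingType) (sigma : {rmorphism T -> T})
    (F : set T) n (A : 'M[T]_n) (S : set T) : Prop :=
  [/\ subfield F /\ sigma @` F = F,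
      entries A `<=` F /\ A \in unitmx,
      exists y : 'M[T]_n,
        [/\ y \in unitmx, map_mx sigma y = A *m y & S = adjoin_GL F y]
    & forall I : set T, ideal_in S I -> sigma @` I `<=` I ->
        I = [set 0] \/ I = S].

Definition prime_ideal (R : comUnitRingType) (P : set R) : Prop :=
  idealr_closed (mem P) /\ prime_idealr_closed (mem P).

Definition prime_chain (R : comUnitRingType) d (P : 'I_d.+1 -> set R) : Prop :=
  (forall i, prime_ideal (P i)) /\
  (forall i j : 'I_d.+1, (i < j)%N -> P i `<` P j).

Definition Krull_dim (R : comUnitRingType) (d : nat) : Prop :=
  (exists P : 'I_d.+1 -> set R, prime_chain P) /\
  (forall d' (P : 'I_d'.+1 -> set R), prime_chain P -> (d' <= d)%N).

Section FieldExtensions.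
Variable L : fieldType.

Definition algebraically_independent (F : set L) d (b : 'I_d -> L) : Prop :=
  forall p : {mpoly L[d]}, p \is a mpolyOver d (mem F) ->
    p.@[b] = 0 -> p = 0.

Definition algebraic_over (F : set L) (x : L) : Prop :=
  exists2 p : {poly L}, p != 0 & (p \is a polyOver (mem F)) /\ root p x.

Definition tr_deg (F : set L) (d : nat) : Prop :=
  exists2 b : 'I_d -> L, algebraically_independent F b &
    forall x, algebraic_over (subfield_gen (F `|` range b)) x.

(* [E : F] = d *)
Definition field_degree (E F : set L) (d : nat) : Prop :=
  F `<=` E /\
  exists b : 'I_d -> L, (forall i, E (b i)) /\
    forall x, E x -> exists! c : {ffun 'I_d -> L},
      (forall i, F (c i)) /\ x = \sum_i c i * b i.

Definition is_fraction_field_of (R : set L) : Prop :=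
  forall x, exists a b, [/\ R a, R b, b != 0 & x = a / b].

End FieldExtensions.

Section Idempotents.
Variables (R : comUnitRingType) (sigma : {rmorphism R -> R}).

Definition primitive_idempotent (e : R) : Prop :=
  [/\ e != 0, e * e = e &
    forall f g, f * f = f -> g * g = g -> f * g = 0 -> e = f + g ->
      f = 0 \/ g = 0].

(* R is the direct sum of the e_i R for e_i := sigma^i e0, i < l, the e_i     *)
(* are exactly the (l distinct) primitive idempotents of R, and each e_i R    *)
(* is a domain stable under sigma^l.                                          *)
Definition idempotent_decomposition (l : nat) (e0 : R) : Prop :=
  let e (i : 'I_l) := iter i sigma e0 in
  [/\ (0 < l)%N,
      injective e /\ (forall x, primitive_idempotent x <-> exists i, x = e i),
      \sum_i e i = 1 /\ (forall i j, i != j -> e i * e j = 0),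
      forall i x y, e i * x * y = 0 -> e i * x = 0 \/ e i * y = 0
    & forall i, iter l sigma (e i) = e i].

End Idempotents.

(* phi is the composite R -> e0 R -> Frac(e0 R) of x |-> e0 x with the        *)
(* inclusion; Q is the field of fractions of e0 R, and tau is the             *)
(* automorphism of Q extending sigma^l.                                       *)
Definition component_fraction_field (R : comUnitRingType)
    (sigma : {rmorphism R -> R}) (l : nat) (e0 : R)
    (Q : fieldType) (phi : {rmorphism R -> Q}) (tau : {rmorphism Q -> Q}) : Prop :=
  [/\ forall x, phi x = 0 <-> e0 * x = 0,
      is_fraction_field_of (range phi),
      bijective tau
    & forall x, tau (phi x) = phi (iter l sigma x)].

(* m(R) = m.  All choices of e0 (permuted transitively by sigma) and of the   *)
(* fraction field (Q, phi, tau) of e0 R give isomorphic data, so that m is    *)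
(* determined by R.                                                           *)
Definition m_invariant (K : fieldType) (sigmaK : {rmorphism K -> K})
    (R : comUnitRingType) (iota : {rmorphism K -> R})
    (sigma : {rmorphism R -> R}) (m : nat) : Prop :=
  exists l e0 (Q : fieldType) (phi : {rmorphism R -> Q})
      (tau : {rmorphism Q -> Q}) d,
    [/\ idempotent_decomposition sigma l e0,
        component_fraction_field sigma l e0 phi tau,
        field_degree (periodic tau)
          (subfield_gen ((phi \o iota) @` periodic sigmaK `|` constants tau)) d
      & m = (l * d)%N].

(* Main.v *)
(* Let U be the quotient of the difference ring L (x)_K R' by a maximal          *)
(* sigma-stable ideal. The fundamental matrices Y of L and y of R' satisfy       *)
(* y = Y W with W constant, so U is generated by L and its field of constants    *)
(* C_U, and Y lies in R' C_U. Since constants are linearly disjoint from simple  *)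
(* difference rings, U = L (x)_{C_L} C_U and R' C_U = R' (x)_{C_R'} C_U, and the *)
(* latter is simple.                                                             *)
(*   A nonzero sigma-stable ideal I of KC_L[R] generates an ideal I C_U that     *)
(* meets R' C_U, hence contains 1, and linear disjointness gives 1 in I.         *)
(*   C_U is a field and a finitely generated C_L-algebra, so it is finite over   *)
(* C_L and U is finite over L. A maximal ideal q of U therefore has a finite     *)
(* orbit under sigma, and P = q n R' is a prime ideal with finite orbit whose    *)
(* translates decompose R' into domains. In the field U / q, which contains both *)
(* L and R' / P, a transcendence basis of R' / P over K is also one over KC_L,   *)
(* so that Kr.dim(R') = tr.deg(L / KC_L).                                        *)
(*   The periodic elements of U are spanned over C_U by those of L, and also by  *)
(* those of R', because the denominators of a periodic element form a            *)
(* sigma-stable ideal. Hence [D_L : C_L] is the dimension over C_R' of the       *)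
(* periodic elements of R', and these split along the l idempotents.             *)
Require Import Defs.
From HB Require Import structures.
From mathcomp Require Import all_boot all_order all_algebra.
From mathcomp Require Import boolp classical_sets.
From mathcomp Require Import mpoly ring.

Set Implicit Arguments.
Unset Strict Implicit.
Unset Printing Implicit Defensive.

Import GRing.Theory.
Local Open Scope classical_set_scope.
Local Open Scope ring_scope.

(** * Ideals, quotients and subring types *)

(** L and R' are compared inside one difference ring, the sigma-simple compositum [U] of
    [difference_compositum], whose constants C_U form a field. Two fundamental matrices of one
    equation differ by a constant matrix ([fundamental_constants]), so U is both L C_U and a
    localization of R' C_U. It remains to see what an extension of constants can change. Linear
    disjointness ([free_constants]) limits this: R' C_U stays simple ([stable_contains1]), elements
    fixed by a power of sigma come from such elements below ([fixed_span]), and algebraic dependence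
    does not increase ([acl_constants]).

    Simplicity of KC_L[R] is descended from that of R' C_U in [extension_simple].

    For the dimension, the main tool is [nonunit_specialization]: in characteristic 0, a finitely
    generated algebra over F in which x is transcendental cannot contain the inverses of all x - k.
    It makes C_U algebraic over C_L ([U_residue]), makes fixed elements of residue fields of R'
    algebraic over K ([fixed_algebraic]), and produces chains of primes ([indep_at_specialize]).
    Conversely a strict inclusion of primes raises the transcendence degree
    ([indep_at_generize_cons]). By simplicity every prime of R' contains a translate of one fixed
    prime P, so the Krull dimension is the transcendence degree of Frac(R' / P) over K;
    [Krull_dim_tr_deg] compares it with that of L in a residue field of U.

    For the degree, bases of the periodic elements of L over C_L and of R' over C_R' both become
    bases over C_U of the periodic elements of U ([periodic_U_span_L], [periodic_U_span_R]). By
    [component_decomposition], R' has l components permuted cyclically by sigma, so a basis of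
    length d on one component gives l d elements. The equality C_K = D_K shows that D_K adds nothing
    to the constants of the component, and that the periodic elements of the component are of
    bounded dimension. *)

Lemma zorn_above (T : Type) (P : set (set T)) (I0 : set T) :
  P I0 ->
  (forall F : set (set T), F `<=` P -> total_on F subset -> F !=set0 ->
     P (\bigcup_(X in F) X)) ->
  exists M, [/\ P M, I0 `<=` M & forall B, P B -> M `<=` B -> B `<=` M].
Proof.
move=> PI0 Pchain.
(* Zorn is applied to the sets A with P (I0 [|] A), which builds the lower bound I0 into the
   predicate. The empty chain then corresponds to I0 itself. *)
have [|A [PA maxA]] := @Zorn_bigcup T (fun A => P (I0 `|` A)).
- move=> F FP Ftot; have [->|F0] := eqVneq F set0.
    by rewrite bigcup_set0 setU0.
  have -> : I0 `|` \bigcup_(X in F) X = \bigcup_(X in [set I0 `|` X | X in F]) X.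
    apply/seteqP; split=> x.
      have /set0P[X0 FX0] := F0.
      by case=> [xI|[X FX Xx]];
        [exists (I0 `|` X0); [exists X0|left]|exists (I0 `|` X); [exists X|right]].
    by case=> _ [X FX <-] [|Xx]; [left|right; exists X].
  apply: Pchain => [_ [X FX <-]|_ _ [X FX <-] [Z FZ <-]|].
  + exact: FP.
  + by have [XZ|ZX] := Ftot _ _ FX FZ; [left|right]; apply: setUS.
  + by have /set0P[X FX] := F0; exists (I0 `|` X), X.
exists (I0 `|` A); split=> // B PB IAB x Bx; apply: contrapT => nx.
have IB : I0 `<=` B by move=> z Iz; apply: IAB; left.
apply: (maxA B); last by rewrite (setUidr IB).
rewrite properEneq; split; last by move=> z Az; apply: IAB; right.
by apply/eqP => AB; apply: nx; right; rewrite AB.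
Qed.

Lemma rmorphism_of (R S : nzRingType) (f : R -> S) :
  {morph f : x y / x + y} -> {morph f : x y / x * y} -> f 1 = 1 ->
  exists g : {rmorphism R -> S}, g =1 f.
Proof.
move=> fD fM f1.
have f0 : f 0 = 0 by apply: (addrI (f 0)); rewrite -fD !addr0.
have fB : zmod_morphism f.
  by move=> x y; apply: (addIr (f y)); rewrite -fD subrK subrK.
pose g : {rmorphism R -> S} := HB.pack f
  (GRing.isZmodMorphism.Build _ _ f fB)
  (GRing.isMonoidMorphism.Build _ _ f (conj f1 fM)).
by exists g.
Qed.

Lemma iter_rmorphism (R : nzRingType) (s : {rmorphism R -> R}) m :
  exists f : {rmorphism R -> R}, forall x, f x = iter m s x.
Proof.
elim: m => [|m [f fE]]; first by exists idfun.
by exists (s \o f) => x /=; rewrite fE.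
Qed.

Section StableIdeal.
Variable (R : comNzRingType).

(** For [s := id] the last clause is void, so ordinary ideals and their maximal ones are the same
    notion and the same Zorn argument. *)
Definition stable_ideal (s : R -> R) (I : set R) : Prop :=
  [/\ I 0, forall x y, I x -> I y -> I (x + y), forall a x, I x -> I (a * x)
    & forall x, I x -> I (s x)].

Lemma stable_ideal_id s I : stable_ideal s I -> stable_ideal id I.
Proof. by case. Qed.

Lemma stable_idealB s I x y : stable_ideal s I -> I x -> I y -> I (x - y).
Proof. by case=> _ ID IM _ Ix Iy; apply: ID => //; rewrite -mulN1r; apply: IM. Qed.

Lemma max_stable_ideal s I0 : stable_ideal s I0 -> ~ I0 1 ->
  exists M, [/\ stable_ideal s M, ~ M 1, I0 `<=` M &
    forall B, stable_ideal s B -> ~ B 1 -> M `<=` B -> B `<=` M].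
Proof.
move=> I0s I01.
have [|F FP Ftot [X0 FX0]|M [[Ms M1] IM maxM]] :=
  @zorn_above R (fun I => stable_ideal s I /\ ~ I 1) I0.
- by split.
- split; last by case=> X /FP[_ X1] /X1.
  split.
  + by exists X0 => //; case: (FP _ FX0) => -[].
  + move=> x y [X FX Xx] [Z FZ Zy]; have [XZ|ZX] := Ftot _ _ FX FZ.
      by exists Z => //; case: (FP _ FZ) => -[_ ZD _ _] _; apply: ZD; first exact: XZ.
    by exists X => //; case: (FP _ FX) => -[_ XD _ _] _; apply: XD => //; exact: ZX.
  + by move=> a x [X FX Xx]; exists X => //; case: (FP _ FX) => -[_ _ XM _] _; apply: XM.
  + by move=> x [X FX Xx]; exists X => //; case: (FP _ FX) => -[_ _ _ Xs] _; apply: Xs.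
by exists M; split=> // B Bs B1; apply: maxM.
Qed.

Definition is_prime (P : set R) : Prop :=
  [/\ stable_ideal id P, ~ P 1 & forall x y, P (x * y) -> P x \/ P y].

Lemma maximal_prime M : stable_ideal id M -> ~ M 1 ->
  (forall B, stable_ideal id B -> ~ B 1 -> M `<=` B -> B `<=` M) -> is_prime M.
Proof.
move=> Ms M1 maxM; split=> // x y Mxy; apply: contrapT => /not_orP[nx ny].
have [M0 MD MM _] := Ms.
pose B := [set z | exists a m, M m /\ z = m + a * x].
have MB : M `<=` B by move=> m Mm; exists 0, m; rewrite mul0r addr0.
have Bs : stable_ideal id B.
  split=> //; first exact: MB.
  - move=> _ _ [a [m [Mm ->]]] [a' [m' [Mm' ->]]]; exists (a + a'), (m + m').
    by rewrite mulrDl addrACA; split=> //; apply: MD.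
  - move=> b _ [a [m [Mm ->]]]; exists (b * a), (b * m).
    by rewrite mulrDr mulrA; split=> //; apply: MM.
have B1 : B 1.
  apply: contrapT => nB1; apply: nx; apply: (maxM B) => //.
  by exists 1, 0; rewrite add0r mul1r.
have [a [m [Mm e]]] := B1; apply: ny.
rewrite -[y]mul1r e mulrDl; apply: MD; first by rewrite mulrC; apply: MM.
by rewrite -mulrA; apply: MM.
Qed.

Lemma exists_prime I : stable_ideal id I -> ~ I 1 -> exists P, is_prime P /\ I `<=` P.
Proof.
move=> Is I1; have [M [Ms M1 IM maxM]] := max_stable_ideal Is I1.
by exists M; split=> //; apply: maximal_prime.
Qed.

Lemma prime_prod P (J : Type) (r : seq J) (Q : pred J) (F : J -> R) : is_prime P ->
  P (\prod_(j <- r | Q j) F j) -> exists2 j, Q j & P (F j).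
Proof.
case=> _ P1 PM; elim: r => [|j r IH]; first by rewrite big_nil.
rewrite big_cons; case: ifP => // Qj /PM[]; first by exists j.
exact: IH.
Qed.

End StableIdeal.

Section ClassicalUnits.
Variable R : comNzRingType.

(** A copy of R on which inverses are chosen classically, with x^-1 = x off the units. It turns a
    quotient ring into a [comUnitRingType]. *)
Definition with_units : Type := R.
HB.instance Definition _ := GRing.ComNzRing.on with_units.

Definition has_inverse : {pred with_units} := fun x => `[< exists y, y * x = 1 >].
Definition classical_inv (x : with_units) : with_units :=
  if pselect (exists y, y * x = 1) is left p then projT1 (cid p) else x.

Lemma classical_mulVr : {in has_inverse, left_inverse 1 classical_inv *%R}.
Proof.
move=> x /asboolP ux; rewrite /classical_inv; case: pselect => // p.
exact: projT2 (cid p).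
Qed.
Lemma classical_unitP (x y : with_units) : y * x = 1 -> has_inverse x.
Proof. by move=> e; apply/asboolP; exists y. Qed.
Lemma classical_inv_out : {in [predC has_inverse], classical_inv =1 id}.
Proof.
move=> x; rewrite inE => /asboolP nx; rewrite /classical_inv.
by case: pselect.
Qed.
HB.instance Definition _ := GRing.ComNzRing_hasMulInverse.Build with_units
  classical_mulVr classical_unitP classical_inv_out.
End ClassicalUnits.

Section QuotientRing.
Variables (R : comNzRingType) (I : set R).

(** The proofs are parameters so that the instance of proper ideal below can be attached to the
    predicate. *)
Definition ideal_pred (Is : stable_ideal id I) (I1 : ~ I 1) : {pred R} :=
  fun x => `[<I x>].

Lemma ideal_pred_closed Is I1 : idealr_closed (@ideal_pred Is I1).
Proof.
have [I0 ID IM _] := Is.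
split; [exact/asboolP|exact/asboolP|move=> a x y /asboolP Ix /asboolP Iy].
by apply/asboolP; apply: ID => //; apply: IM.
Qed.
HB.instance Definition _ Is I1 :=
  isIdealr.Build R (@ideal_pred Is I1) (ideal_pred_closed Is I1).

Lemma quotient_ring : stable_ideal id I -> ~ I 1 ->
  exists (S : comUnitRingType) (p : {rmorphism R -> S}),
    (forall x, p x = 0 <-> I x) /\ forall q, exists x, q = p x.
Proof.
move=> Is I1; pose Q := {ideal_quot (@ideal_pred Is I1)}.
pose pi := (\pi_Q)%qT.
have piE x y : (pi x = pi y) <-> I (x - y).
  rewrite /pi; split.
    by move/eqP; rewrite -Quotient.idealrBE => /asboolP.
  by move=> Ixy; apply/eqP; rewrite -Quotient.idealrBE; apply/asboolP.
have [|||p pE] := @rmorphism_of R (with_units Q) pi.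
- by move=> x y; exact: (rmorphD (\pi_Q)%qT).
- by move=> x y; exact: (rmorphM (\pi_Q)%qT).
- exact: (rmorph1 (\pi_Q)%qT).
exists (with_units Q), p; split=> [x|q].
  by rewrite -(rmorph0 p) !pE piE subr0.
by exists (repr q)%qT; rewrite pE /pi reprK.
Qed.
End QuotientRing.

Definition domain_of (Q : comUnitRingType)
  (H : GRing.integral_domain_axiom Q) : Type := Q.
HB.instance Definition _ Q H := GRing.ComUnitRing.on (@domain_of Q H).
HB.instance Definition _ Q H :=
  GRing.ComUnitRing_isIntegral.Build (@domain_of Q H) H.

Lemma residue_field (R : comNzRingType) (P : set R) : is_prime P ->
  exists (Q : fieldType) (p : {rmorphism R -> Q}),
    (forall x, p x = 0 <-> P x) /\
    forall q, exists a b, p b != 0 /\ q = p a / p b.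
Proof.
case=> Ps P1 PM; have [S [p [pE pS]]] := quotient_ring Ps P1.
have H : GRing.integral_domain_axiom S.
  move=> x y; have [a ->] := pS x; have [b ->] := pS y.
  by rewrite -rmorphM => /pE/PM[] /pE ->; rewrite eqxx ?orbT.
pose D := domain_of H; pose Q := {fraction D}.
have [|||f fE] := @rmorphism_of R Q (fun x => FracField.tofrac (p x : D)).
- by move=> x y; rewrite rmorphD tofracD.
- by move=> x y; rewrite rmorphM tofracM.
- by rewrite rmorph1 tofrac1.
exists Q, f; split=> [x|].
  rewrite fE; split; first by move/eqP; rewrite tofrac_eq0 => /eqP/pE.
  by move/pE => ->; rewrite tofrac0.
elim/quotW => r; have [a ea] := pS \n_r; have [b eb] := pS \d_r.
have bn0 : FracField.tofrac (\d_r : D) != 0 by rewrite tofrac_eq0 denom_ratioP.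
exists a, b; rewrite !fE -ea -eb; split=> //.
apply: (mulIf bn0); rewrite divfK //; unlock FracField.tofrac.
rewrite -[LHS]FracField.pi_mul; apply/eqmodP; rewrite /= FracField.equivfE.
rewrite /FracField.mulf !numden_Ratio ?oner_neq0 ?mulf_neq0 ?denom_ratioP //.
- by rewrite !mulr1 mulrC.
- exact: oner_neq0.
- exact: oner_neq0.
Qed.

(** Since the kernels agree, g is nonzero on every admissible denominator and g a / g b depends only
    on the fraction p a / p b. *)
Lemma fraction_extend (R : comNzRingType) (Q M : fieldType)
    (p : {rmorphism R -> Q}) (g : {rmorphism R -> M}) :
  (forall q, exists a b, p b != 0 /\ q = p a / p b) ->
  (forall x, g x = 0 <-> p x = 0) ->
  exists h : {rmorphism Q -> M}, forall x, h (p x) = g x.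
Proof.
move=> pQ gp.
have gn x : p x != 0 -> g x != 0.
  by move=> /eqP px; apply/eqP => /gp.
have key a b a' b' : p b != 0 -> p b' != 0 -> p a / p b = p a' / p b' ->
    g a / g b = g a' / g b'.
  move=> b0 b0' /eqP; rewrite eqr_div // => /eqP e.
  apply/eqP; rewrite eqr_div ?gn // -subr_eq0 -!rmorphM -rmorphB.
  by apply/eqP/gp; rewrite rmorphB !rmorphM e subrr.
pose num q := projT1 (cid (pQ q)).
pose den q := projT1 (cid (projT2 (cid (pQ q)))).
have denP q : p (den q) != 0 /\ q = p (num q) / p (den q).
  exact: projT2 (cid (projT2 (cid (pQ q)))).
pose h q := g (num q) / g (den q).
have hE a b : p b != 0 -> h (p a / p b) = g a / g b.
  by move=> b0; have [d0 e] := denP (p a / p b); apply: key.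
have hp x : h (p x) = g x.
  by rewrite -[p x]divr1 -(rmorph1 p) hE ?rmorph1 ?oner_neq0 // divr1.
have [|||f fE] := @rmorphism_of Q M h.
- move=> x y; have [dx ->] := denP x; have [dy ->] := denP y.
  rewrite addf_div // -!rmorphM -rmorphD hE; last by rewrite rmorphM mulf_neq0.
  by rewrite !hE // addf_div ?gn // !rmorphD !rmorphM.
- move=> x y; have [dx ->] := denP x; have [dy ->] := denP y.
  rewrite mulf_div -!rmorphM hE; last by rewrite rmorphM mulf_neq0.
  by rewrite !hE // mulf_div -!rmorphM.
- by rewrite -(rmorph1 p) hp rmorph1.
by exists f => x; rewrite fE hp.
Qed.

Lemma factor_surj (A B C : comNzRingType) (p : {rmorphism A -> B})
    (g : {rmorphism A -> C}) :
  (forall b, exists a, b = p a) -> (forall a, p a = 0 -> g a = 0) ->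
  exists h : {rmorphism B -> C}, forall a, h (p a) = g a.
Proof.
move=> pS pg; pose sec b := projT1 (cid (pS b)).
have secP b : p (sec b) = b by rewrite -(projT2 (cid (pS b))).
have gE a a' : p a = p a' -> g a = g a'.
  move=> e; apply/eqP; rewrite -subr_eq0 -rmorphB; apply/eqP/pg.
  by rewrite rmorphB e subrr.
have [|||f fE] := @rmorphism_of B C (g \o sec).
- by move=> x y /=; rewrite -rmorphD; apply: gE; rewrite rmorphD !secP.
- by move=> x y /=; rewrite -rmorphM; apply: gE; rewrite rmorphM !secP.
- by rewrite /= -(rmorph1 g); apply: gE; rewrite secP rmorph1.
by exists f => a; rewrite fE; apply: gE; rewrite secP.
Qed.

Lemma factor_inj (A B C : comNzRingType) (i : {rmorphism B -> C})
    (g : {rmorphism A -> C}) :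
  injective i -> (forall a, exists b, g a = i b) ->
  exists h : {rmorphism A -> B}, forall a, i (h a) = g a.
Proof.
move=> iI gi; pose sec a := projT1 (cid (gi a)).
have secP a : i (sec a) = g a by rewrite -(projT2 (cid (gi a))).
have [|||f fE] := @rmorphism_of A B sec.
- by move=> x y; apply: iI; rewrite rmorphD !secP rmorphD.
- by move=> x y; apply: iI; rewrite rmorphM !secP rmorphM.
- by apply: iI; rewrite rmorph1 secP rmorph1.
by exists f => a; rewrite fE.
Qed.

Section SubringType.
Variables (T : comUnitRingType) (S : set T).

Definition subring_pred (SS : subring S) : {pred T} := mem S.
Definition sub_type (SS : subring S) : Type := {x : T | x \in subring_pred SS}.
HB.instance Definition _ SS :=
  GRing.isSubringClosed.Build T (subring_pred SS) SS.
HB.instance Definition _ SS := [isSub for (@sval _ _ : sub_type SS -> T)].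
HB.instance Definition _ SS := [Choice of sub_type SS by <:].
HB.instance Definition _ SS := [SubChoice_isSubComNzRing of sub_type SS by <:].

Lemma subring_type : subring S ->
  exists (A : comNzRingType) (i : {rmorphism A -> T}),
    injective i /\ forall x, S x <-> exists a, x = i a.
Proof.
move=> SS; exists (sub_type SS), (val : sub_type SS -> T).
split=> [|x]; first exact: val_inj.
split=> [Sx|[a ->]]; last by have := valP a; rewrite in_setE.
by exists (Sub x (mem_set Sx)); exact: (esym (SubK _ _)).
Qed.
End SubringType.

Section SubfieldType.
Variables (T : comUnitRingType) (F : set T).

Definition subfield_pred (SF : subfield F) : {pred T} := mem F.
Definition subfield_sort (SF : subfield F) : Type := {x : T | x \in subfield_pred SF}.
HB.instance Definition _ SF :=
  GRing.isDivringClosed.Build T (subfield_pred SF) (proj1 SF).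
HB.instance Definition _ SF := [isSub for (@sval _ _ : subfield_sort SF -> T)].
HB.instance Definition _ SF := [Choice of subfield_sort SF by <:].
HB.instance Definition _ SF :=
  [SubChoice_isSubComUnitRing of subfield_sort SF by <:].

Lemma subfield_sort_field SF : GRing.field_axiom (subfield_sort SF).
Proof.
move=> x x0; rewrite unfold_in /=; have [_ Fu] := SF.
apply: Fu; first by have := valP x; rewrite in_setE.
by apply: contra x0 => /eqP e; apply/eqP/val_inj; rewrite rmorph0.
Qed.
HB.instance Definition _ SF := GRing.ComUnitRing_isField.Build (subfield_sort SF)
  (@subfield_sort_field SF).

Lemma subfield_type : subfield F ->
  exists (A : fieldType) (i : {rmorphism A -> T}), forall x, F x <-> exists a, x = i a.
Proof.
move=> SF; exists (subfield_sort SF), (val : subfield_sort SF -> T) => x.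
split=> [Fx|[a ->]]; last by have := valP a; rewrite in_setE.
by exists (Sub x (mem_set Fx)); exact: (esym (SubK _ _)).
Qed.
End SubfieldType.

(** * Generated subrings and subfields *)

Section Subring.
Variables (T : comUnitRingType).
Implicit Types (S G : set T).

Lemma subringP S : subring S <->
  [/\ S 1, forall x y, S x -> S y -> S (x - y) & forall x y, S x -> S y -> S (x * y)].
Proof.
split=> [[S1 SB SM]|[S1 SB SM]].
  split; first by rewrite in_setE in S1.
    by move=> x y /mem_set Sx /mem_set Sy; have := SB _ _ Sx Sy; rewrite in_setE.
  by move=> x y /mem_set Sx /mem_set Sy; have := SM _ _ Sx Sy; rewrite in_setE.
by split; [exact/mem_set|move=> x y /set_mem Sx /set_mem Sy; apply/mem_set; auto..].
Qed.

Section Closed.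
Variables (S : set T) (SS : subring S).
Lemma subring1 : S 1. Proof. by case/subringP: SS. Qed.
Lemma subringB x y : S x -> S y -> S (x - y).
Proof. by case/subringP: SS => _ SB _; apply: SB. Qed.
Lemma subringM x y : S x -> S y -> S (x * y).
Proof. by case/subringP: SS => _ _; apply. Qed.
Lemma subring0 : S 0. Proof. by rewrite -(subrr 1); apply: subringB subring1 subring1. Qed.
Lemma subringN x : S x -> S (- x).
Proof. by rewrite -[- x]add0r; apply/subringB/subring0. Qed.
Lemma subringD x y : S x -> S y -> S (x + y).
Proof. by move=> Sx Sy; rewrite -[y]opprK; apply: subringB => //; apply: subringN. Qed.
Lemma subringX x n : S x -> S (x ^+ n).
Proof.
move=> Sx; elim: n => [|n IH]; first by rewrite expr0; apply: subring1.
by rewrite exprS; apply: subringM.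
Qed.
Lemma subring_sum J (r : seq J) (P : pred J) F :
  (forall j, P j -> S (F j)) -> S (\sum_(j <- r | P j) F j).
Proof. by move=> SF; apply: big_ind => //; [exact: subring0|exact: subringD]. Qed.
Lemma subring_prod J (r : seq J) (P : pred J) F :
  (forall j, P j -> S (F j)) -> S (\prod_(j <- r | P j) F j).
Proof. by move=> SF; apply: big_ind => //; [exact: subring1|exact: subringM]. Qed.
Lemma subring_nat n : S n%:R.
Proof. by elim: n => [|n IH]; [exact: subring0|rewrite mulrS; apply/subringD/IH/subring1]. Qed.
Lemma subring_horner (p : {poly T}) x : (forall i, S p`_i) -> S x -> S p.[x].
Proof.
move=> Sp Sx; rewrite horner_coef; apply: subring_sum => i _.
by apply: subringM => //; apply: subringX.
Qed.
Lemma subring_mulmx m n p (A : 'M[T]_(m, n)) (B : 'M_(n, p)) :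
  (forall i j, S (A i j)) -> (forall i j, S (B i j)) -> forall i j, S ((A *m B) i j).
Proof.
by move=> SA SB i j; rewrite mxE; apply: subring_sum => k _; apply: subringM.
Qed.
Lemma subring_det n (A : 'M[T]_n) : (forall i j, S (A i j)) -> S (\det A).
Proof.
move=> SA; apply: subring_sum => s _; apply: subringM.
  by apply: subringX; apply: subringN; apply: subring1.
by apply: subring_prod.
Qed.
End Closed.

Lemma subring_gen_subring G : subring (subring_gen G).
Proof.
apply/subringP; split=> [S [/subringP[] //]|x y Sx Sy S SG|x y Sx Sy S SG].
  by apply: (subringB SG.1); [exact: Sx|exact: Sy].
by apply: (subringM SG.1); [exact: Sx|exact: Sy].
Qed.

Lemma sub_subring_gen G : G `<=` subring_gen G.
Proof. exact: sub_gen_smallest. Qed.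

Lemma subring_gen_sub G S : subring S -> G `<=` S -> subring_gen G `<=` S.
Proof. by move=> SS GS; apply: smallest_sub. Qed.

Lemma subring_genS G G' : G `<=` G' -> subring_gen G `<=` subring_gen G'.
Proof.
move=> GG'; apply: subring_gen_sub; first exact: subring_gen_subring.
by apply: (subset_trans GG'); apply: sub_subring_gen.
Qed.

Lemma subring_gen_trans G G' : G `<=` subring_gen G' -> subring_gen G `<=` subring_gen G'.
Proof. by apply: subring_gen_sub; apply: subring_gen_subring. Qed.

Lemma subring_gen_id S : subring S -> subring_gen S = S.
Proof.
move=> SS; apply/seteqP; split; last exact: sub_subring_gen.
exact: subring_gen_sub.
Qed.

Lemma subring_setT : subring [set: T].
Proof. by apply/subringP. Qed.

Definition poly_over S (p : {poly T}) := forall i, S p`_i.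

Lemma poly_overE S (p : {poly T}) : S 0 ->
  p \is a polyOver (mem S) <-> poly_over S p.
Proof.
move=> S0; split=> [/(all_nthP 0) Sp i|Sp].
  have [/Sp|ip] := ltnP i (size p); first by rewrite in_setE.
  by rewrite nth_default.
by apply/(all_nthP 0) => i _; apply/mem_set.
Qed.

Section PolyOver.
Variables (S : set T) (SS : subring S).
Lemma poly_overB p q : poly_over S p -> poly_over S q -> poly_over S (p - q).
Proof. by move=> Sp Sq i; rewrite coefB; apply: subringB. Qed.
Lemma poly_overM p q : poly_over S p -> poly_over S q -> poly_over S (p * q).
Proof.
move=> Sp Sq i; rewrite coefM; apply: subring_sum => // j _.
by apply: subringM.
Qed.
Lemma poly_overC c : S c -> poly_over S c%:P.
Proof. by move=> Sc i; rewrite coefC; case: ifP => // _; apply: subring0. Qed.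
Lemma poly_overX : poly_over S 'X.
Proof. by move=> i; rewrite coefX; apply: subring_nat. Qed.
Lemma poly_over_poly n E : (forall i, S (E i)) -> poly_over S (\poly_(i < n) E i).
Proof. by move=> SE i; rewrite coef_poly; case: ifP => // _; apply: subring0. Qed.
End PolyOver.

Lemma subring_gen_adjoin G x y : subring_gen (G `|` [set x]) y <->
  exists2 p, poly_over (subring_gen G) p & y = p.[x].
Proof.
have SG := subring_gen_subring G; split=> [|[p Sp ->]].
  move: y; apply: subring_gen_sub => [|y].
    apply/subringP; split=> [|_ _ [p Sp ->] [q Sq ->]|_ _ [p Sp ->] [q Sq ->]].
    - by exists 1%:P; [apply: poly_overC => //; apply: subring1|rewrite hornerC].
    - by exists (p - q); [exact: poly_overB|rewrite hornerD hornerN].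
    - by exists (p * q); [exact: poly_overM|rewrite hornerM].
  case=> [Gy|->]; last by exists 'X; [exact: poly_overX|rewrite hornerX].
  exists y%:P; last by rewrite hornerC.
  by apply: poly_overC => //; apply: sub_subring_gen.
apply: (subring_horner (subring_gen_subring _)).
  by move=> i; apply: subring_genS (Sp i) => z; left.
by apply: sub_subring_gen; right.
Qed.

End Subring.

Lemma subring_image (T M : comUnitRingType) (f : {rmorphism T -> M}) S :
  subring S -> subring (f @` S).
Proof.
move=> SS; apply/subringP; split.
- by exists 1; [exact: subring1|rewrite rmorph1].
- by move=> _ _ [x Sx <-] [y Sy <-]; exists (x - y); [exact: subringB|rewrite rmorphB].
- by move=> _ _ [x Sx <-] [y Sy <-]; exists (x * y); [exact: subringM|rewrite rmorphM].
Qed.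

Lemma subring_preimage (T M : comUnitRingType) (f : {rmorphism T -> M}) S :
  subring S -> subring (f @^-1` S).
Proof.
move=> SS; apply/subringP; split=> /=.
- by rewrite rmorph1; apply: subring1.
- by move=> x y Sx Sy; rewrite rmorphB; apply: subringB.
- by move=> x y Sx Sy; rewrite rmorphM; apply: subringM.
Qed.

Lemma subring_range (T M : comUnitRingType) (f : {rmorphism T -> M}) : subring (range f).
Proof. exact/subring_image/subring_setT. Qed.

Lemma subring_gen_image (T M : comUnitRingType) (f : {rmorphism T -> M}) G :
  subring_gen (f @` G) = f @` (subring_gen G).
Proof.
apply/seteqP; split.
  apply: subring_gen_sub; first exact/subring_image/subring_gen_subring.
  by move=> _ [x Gx <-]; exists x => //; apply: sub_subring_gen.
move=> _ [x Gx <-]; move: x Gx.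
apply: (subring_gen_sub (S := f @^-1` (subring_gen (f @` G)))) => [|x Gx].
  exact/subring_preimage/subring_gen_subring.
by apply: sub_subring_gen; exists x.
Qed.

Section Subfield.
Variable (M : fieldType).
Implicit Types (F S G : set M).

Lemma subfieldP F : subfield F <->
  subring F /\ (forall x, F x -> F x^-1).
Proof.
split=> [[[F1 FB FD] _]|[/subringP[F1 FB FM] FV]].
  have inv x : F x -> F x^-1.
    by move=> /mem_set Fx; have := FD _ _ F1 Fx; rewrite div1r in_setE.
  split=> //; apply/subringP; split=> [|x y /mem_set Fx /mem_set Fy|x y Fx Fy].
  - by rewrite in_setE in F1.
  - by have := FB _ _ Fx Fy; rewrite in_setE.
  - rewrite -[y]invrK; have /mem_set Fy' := inv _ Fy; move/mem_set: Fx => Fx.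
    by have := FD _ _ Fx Fy'; rewrite in_setE.
split=> [|x _]; last by rewrite unitfE.
split; first exact/mem_set.
  by move=> x y /set_mem Fx /set_mem Fy; apply/mem_set/FB.
by move=> x y /set_mem Fx /set_mem Fy; apply/mem_set/FM => //; apply: FV.
Qed.

Lemma subfield_subring F : subfield F -> subring F.
Proof. by case/subfieldP. Qed.

Lemma subfieldV F x : subfield F -> F x -> F x^-1.
Proof. by case/subfieldP => _; apply. Qed.

Lemma subfield_gen_subfield G : subfield (subfield_gen G).
Proof.
apply/subfieldP; split.
  apply/subringP; split=> [S [/subfieldP[/subringP[] //]]|x y Sx Sy S SG|x y Sx Sy S SG].
    by apply: (subringB (subfield_subring SG.1)); [exact: Sx|exact: Sy].
  by apply: (subringM (subfield_subring SG.1)); [exact: Sx|exact: Sy].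
by move=> x Sx S SG; apply: (subfieldV SG.1); apply: Sx.
Qed.

Lemma sub_subfield_gen G : G `<=` subfield_gen G.
Proof. exact: sub_gen_smallest. Qed.

Lemma subfield_gen_sub G F : subfield F -> G `<=` F -> subfield_gen G `<=` F.
Proof. by move=> FF GF; apply: smallest_sub. Qed.

Lemma subring_subfield_gen G : subring_gen G `<=` subfield_gen G.
Proof.
apply: subring_gen_sub; last exact: sub_subfield_gen.
exact/subfield_subring/subfield_gen_subfield.
Qed.

Definition fractions S : set M := [set x | exists a b, [/\ S a, S b, b != 0 & x = a / b]].

Lemma fractions_subfield S : subring S -> subfield (fractions S).
Proof.
move=> SS; apply/subfieldP; split.
  apply/subringP; split.
  - exists 1, 1; rewrite divr1 oner_neq0; split=> //; exact: subring1.
  - move=> _ _ [a [b [Sa Sb b0 ->]]] [c [d [Sc Sd d0 ->]]].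
    exists (a * d - c * b), (b * d); rewrite mulf_neq0 // -[- (c / d)]mulNr addf_div // mulNr.
    by split=> //; do ?[apply: subringB|apply: subringM].
  - move=> _ _ [a [b [Sa Sb b0 ->]]] [c [d [Sc Sd d0 ->]]].
    exists (a * c), (b * d); rewrite mulf_neq0 // mulf_div.
    by split=> //; apply: subringM.
move=> _ [a [b [Sa Sb b0 ->]]]; have [->|a0] := eqVneq a 0.
  by exists 0, 1; rewrite mul0r invr0 mul0r oner_neq0; split=> //;
    [exact: subring0|exact: subring1].
by exists b, a; rewrite invf_div.
Qed.

Lemma subfield_genE G : subfield_gen G = fractions (subring_gen G).
Proof.
have SG := subring_gen_subring G.
apply/seteqP; split.
  apply: subfield_gen_sub; first exact: fractions_subfield.
  move=> x Gx; exists x, 1; rewrite divr1 oner_neq0; split=> //.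
    exact: sub_subring_gen.
  exact: (subring1 SG).
move=> _ [a [b [Sa Sb b0 ->]]].
have FG := subfield_gen_subfield G; apply: (subringM (subfield_subring FG)).
  exact: subring_subfield_gen.
by apply: (subfieldV FG); apply: subring_subfield_gen.
Qed.

Lemma subfield_gen_id F : subfield F -> subfield_gen F = F.
Proof.
move=> FF; apply/seteqP; split; last exact: sub_subfield_gen.
exact: subfield_gen_sub.
Qed.

End Subfield.

Lemma subfield_image (F M : fieldType) (f : {rmorphism F -> M}) (S : set F) :
  subfield S -> subfield (f @` S).
Proof.
move/subfieldP => [SS SV]; apply/subfieldP; split; first exact: subring_image.
by move=> _ [x Sx <-]; exists x^-1; [exact: SV|rewrite fmorphV].
Qed.

Lemma subfield_range (F M : fieldType) (f : {rmorphism F -> M}) : subfield (range f).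
Proof. by apply/subfield_image/subfieldP; split=> //; apply: subring_setT. Qed.

Lemma subfield_gen_image (F M : fieldType) (f : {rmorphism F -> M}) G :
  subfield_gen (f @` G) = f @` (subfield_gen G).
Proof.
rewrite !subfield_genE subring_gen_image; apply/seteqP; split.
  move=> _ [_ [_ [[a Sa <-] [b Sb <-] b0 ->]]]; exists (a / b); last exact: fmorph_div.
  by exists a, b; split=> //; apply: contra b0 => /eqP ->; rewrite rmorph0.
move=> _ [_ [a [b [Sa Sb b0 ->]]] <-]; exists (f a), (f b); rewrite fmorph_eq0 fmorph_div.
by split=> //; [exists a|exists b].
Qed.

(** * Algebraic dependence *)

Lemma poly_over_image (A B : comUnitRingType) (f : {rmorphism A -> B}) (S : set A)
    (p : {poly B}) : S 0 ->
  poly_over (f @` S) p -> exists2 q, poly_over S q & p = map_poly f q.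
Proof.
move=> S0 fp; have /choice[c cP] i : exists a, S a /\ f a = p`_i.
  by have [a Sa e] := fp i; exists a.
exists (\poly_(i < size p) c i).
  by move=> i; rewrite coef_poly; case: ifP => // _; case: (cP i).
apply/polyP => i; rewrite coef_map coef_poly; case: ltnP => [_|pi].
  by case: (cP i).
by rewrite nth_default // raddf0.
Qed.

Lemma poly_over_range (A B : comUnitRingType) (f : {rmorphism A -> B})
    (p : {poly B}) : poly_over (range f) p -> exists q, p = map_poly f q.
Proof. by move=> /(@poly_over_image _ _ _ setT)[//|q _ ->]; exists q. Qed.

Lemma poly_over_map (A B : comUnitRingType) (f : {rmorphism A -> B}) (S : set A)
    (q : {poly A}) : poly_over S q -> poly_over (f @` S) (map_poly f q).
Proof. by move=> Sq i; rewrite coef_map; exists q`_i. Qed.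

Lemma set_cons (T : eqType) (x : T) (s : seq T) : [set` x :: s] = [set x] `|` [set` s].
Proof.
apply/seteqP; split=> z /=; rewrite inE; first by case/orP => [/eqP ->|]; [left|right].
by case=> [->|->]; rewrite ?eqxx ?orbT.
Qed.

Lemma set_nil (T : eqType) : [set` [::]] = set0 :> set T.
Proof. by apply/seteqP; split. Qed.

Lemma image_set_seq (T T' : eqType) (f : T -> T') (s : seq T) :
  f @` [set` s] = [set` [seq f x | x <- s]].
Proof.
apply/seteqP; split=> [_ [x xs <-]|x /mapP[y ys ->]] /=; first exact: map_f.
by exists y.
Qed.

Section AlgebraicClosure.
Variable M : fieldType.
Implicit Types (S G : set M) (x y : M) (s t : seq M).

Lemma common_denominator S r (v : 'I_r -> M) : subring S -> (forall i, fractions S (v i)) ->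
  exists d, [/\ S d, d != 0 & forall i, S (d * v i)].
Proof.
move=> SS fv; have /choice[c cP] i : exists d, [/\ S d, d != 0 & S (d * v i)].
  have [a [d [Sa Sd d0 ->]]] := fv i; exists d; split=> //.
  by rewrite mulrC divfK.
exists (\prod_i c i); split.
- by apply: subring_prod => // i _; case: (cP i).
- by apply/prodf_neq0 => i _; case: (cP i).
- move=> i; rewrite (bigD1 i) //= mulrAC; apply: subringM => //; first by case: (cP i).
  by apply: subring_prod => // j _; case: (cP j).
Qed.

Lemma clear_denominators S (p : {poly M}) : subring S -> poly_over (fractions S) p ->
  exists d, [/\ S d, d != 0 & poly_over S (d *: p)].
Proof.
move=> SS fp.
have [d [Sd d0 Sdp]] := @common_denominator S (size p) (fun i => p`_i) SS (fun i => fp i).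
exists d; split=> // i; rewrite coefZ; have [ip|pi] := ltnP i (size p).
  exact: (Sdp (Ordinal ip)).
by rewrite nth_default // mulr0; apply: subring0.
Qed.

(* The relative algebraic closure in M of the field generated by S. *)
Definition acl S : set M :=
  [set x | exists2 p, p != 0 & poly_over (subring_gen S) p /\ root p x].

(** Clearing denominators passes between coefficients in the generated subring and in the generated
    subfield. The subfield as a type of its own gives access to the closure properties of
    [algebraicOver]. *)
Lemma acl_algebraicOver S : exists (F : fieldType) (j : {rmorphism F -> M}),
  range j = subfield_gen S /\ forall x, acl S x <-> algebraicOver j x.
Proof.
have SS := subring_gen_subring S.
have [F [j jE]] := subfield_type (subfield_gen_subfield S).
have rj : range j = subfield_gen S.
  by apply/seteqP; split=> [_ [a _ <-]|x /jE[a ->]]; [apply/jE; exists a|exists a].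
exists F, j; split=> // x; split=> [[p p0 [Sp px]]|[p p0 px]].
  have /poly_over_range[q e] : poly_over (range j) p.
    by move=> i; rewrite rj; apply: subring_subfield_gen.
  by exists q; [apply: contra p0 => /eqP q0; rewrite e q0 rmorph0|rewrite -e].
have [|d [Sd d0 Sp]] := @clear_denominators (subring_gen S) (map_poly j p) SS.
  by rewrite -subfield_genE -rj => i; rewrite coef_map; exists p`_i.
exists (d *: map_poly j p); first by rewrite scaler_eq0 map_poly_eq0 negb_or d0.
by split=> //; rewrite rootZ.
Qed.

Lemma acl_algebraic_over S x : acl S x <-> algebraic_over (subfield_gen S) x.
Proof.
have [F [j [rj aE]]] := acl_algebraicOver S.
have FS : subring (subfield_gen S) by apply/subfield_subring/subfield_gen_subfield.
rewrite aE; split=> [[p p0 px]|[p p0 [Sp px]]].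
  exists (map_poly j p); first by rewrite map_poly_eq0.
  split=> //; apply/poly_overE; first exact: (subring0 FS).
  by move=> i; rewrite -rj coef_map; exists p`_i.
move/(poly_overE _ (subring0 FS)): Sp; rewrite -rj => /poly_over_range[q e].
by exists q; [apply: contra p0 => /eqP q0; rewrite e q0 rmorph0|rewrite -e].
Qed.

Lemma acl_subfield S : subfield (acl S).
Proof.
have [F [j [_ aE]]] := acl_algebraicOver S.
apply/subfieldP; split; first (apply/subringP; split).
- exact/aE/algebraic1.
- by move=> x y /aE ax /aE ay; apply/aE/algebraic_sub.
- by move=> x y /aE ax /aE ay; apply/aE/algebraic_mul.
- by move=> x /aE ax; apply/aE/algebraic_inv.
Qed.

Lemma acl_subring S : subring (acl S).
Proof. exact/subfield_subring/acl_subfield. Qed.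

Lemma sub_acl S : S `<=` acl S.
Proof.
move=> x Sx; exists ('X - x%:P); first by rewrite polyXsubC_eq0.
split; last by rewrite root_XsubC.
have SS := subring_gen_subring S.
apply: poly_overB => //; first exact: poly_overX.
by apply: poly_overC => //; apply: sub_subring_gen.
Qed.

Lemma acl_sub S G : S `<=` acl G -> acl S `<=` acl G.
Proof.
move=> SG x [p p0 [Sp px]]; have [F [j [_ aE]]] := acl_algebraicOver G.
apply/aE/integral_algebraic; apply: integral_root p0 px _.
apply/integral_poly => i; apply/integral_algebraic/aE.
by have := Sp i; apply: subring_gen_sub; first exact: acl_subring.
Qed.

Lemma aclS S G : S `<=` G -> acl S `<=` acl G.
Proof. by move=> SG; apply: acl_sub => x /SG; apply: sub_acl. Qed.

Lemma subfield_gen_acl S : subfield_gen S `<=` acl S.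
Proof. by apply: subfield_gen_sub; [exact: acl_subfield|exact: sub_acl]. Qed.

Lemma subring_gen_acl S : subring_gen S `<=` acl S.
Proof. by apply: subring_gen_sub; [exact: acl_subring|exact: sub_acl]. Qed.

(** A relation for y over S[x] is rewritten as a polynomial in x whose coefficients are the r_j(y),
    with r_j over S. If it vanished identically, all r_j(y) would be 0; the leading coefficient in y
    gives some r_j != 0, and y would be algebraic over S. *)
Lemma acl_exchange S x y : acl (S `|` [set x]) y -> ~ acl S y -> acl (S `|` [set y]) x.
Proof.
move=> [p p0 [Sp py]] nSy; have SS := subring_gen_subring S.
have /choice[q qP] i : exists q, poly_over (subring_gen S) q /\ p`_i = q.[x].
  by have /subring_gen_adjoin[q Sq e] := Sp i; exists q.
pose m := \max_(i < size p) size (q i).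
pose r j := \poly_(i < size p) (q i)`_j.
have Sr j : poly_over (subring_gen S) (r j).
  by apply: poly_over_poly => // i; case: (qP i).
have rE : \sum_(j < m) (r j).[y] * x ^+ j = 0.
  transitivity p.[y]; last exact/rootP.
  rewrite horner_coef.
  under eq_bigr => j _ do rewrite horner_poly mulr_suml.
  rewrite exchange_big /=; apply: eq_bigr => i _.
  have [_ ->] := qP i; rewrite (@horner_coef_wide _ m); last exact: leq_bigmax.
  by rewrite mulr_suml; apply: eq_bigr => j _; rewrite mulrAC.
exists (\poly_(j < m) (r j).[y]); last first.
  split; last by rewrite rootE horner_poly rE.
  apply: poly_over_poly; first exact: subring_gen_subring.
  by move=> j; apply/subring_gen_adjoin; exists (r j).
apply: contra_notN nSy => /eqP P0.
have p00 : lead_coef p != 0 by rewrite lead_coef_eq0.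
have sp : ((size p).-1 < size p)%N by rewrite prednK ?leqnn ?size_poly_gt0.
pose i := Ordinal sp.
have qi0 : q i != 0.
  apply: contra p00 => /eqP qi; have [_ e] := qP i.
  by rewrite /lead_coef e qi horner0.
pose j := (size (q i)).-1.
have jm : (j < m)%N.
  apply: (@leq_trans (size (q i))); last exact: (leq_bigmax i).
  by rewrite prednK ?size_poly_gt0.
exists (r j).
  apply: contra qi0 => /eqP/(congr1 (fun f : {poly M} => f`_i)).
  by rewrite coef_poly ltn_ord coef0 => /eqP; rewrite -lead_coef_eq0.
split=> //; have := congr1 (fun f : {poly M} => f`_j) P0.
by rewrite coef_poly jm coef0 => /eqP.
Qed.

(* Every element is transcendental over the field generated by S and the ones  *)
(* behind it.                                                                   *)
Fixpoint indep S s : Prop :=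
  if s is x :: s' then ~ acl (S `|` [set` s']) x /\ indep S s' else True.

Lemma indep_acl S G s : S `<=` acl G -> indep G s -> indep S s.
Proof.
move=> SG; elim: s => //= x s IH [nx /IH]; split=> //.
apply: contra_not nx; apply: acl_sub => z [/SG|sz]; last by apply: sub_acl; right.
by apply: aclS => ?; left.
Qed.

Lemma indep_adjoin S s y : indep S s ->
  (~ acl (S `|` [set` s]) y -> indep (S `|` [set y]) s) /\
  (acl (S `|` [set` s]) y -> exists s', [/\ size s = (size s').+1,
     {subset s' <= s} & indep (S `|` [set y]) s']) \/ acl S y.
Proof.
elim: s => [_|x s IH /= [nx ind]].
  by have [aSy|nSy] := pselect (acl S y); [right|left; rewrite set_nil setU0].
case: (IH ind) => [[IH1 IH2]|]; last by right.
left; split=> [ny|ay].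
  have ny' : ~ acl (S `|` [set` s]) y.
    apply: contra_not ny; apply: aclS; apply: setUS => z; rewrite /= inE => ->.
    exact: orbT.
  split; last exact: IH1.
  move=> ax; apply: ny; rewrite set_cons [[set x] `|` _]setUC setUA.
  by apply: acl_exchange => //; rewrite setUAC.
have [ay'|ny'] := pselect (acl (S `|` [set` s]) y).
  have [s' [es ss' ind']] := IH2 ay'.
  exists (x :: s'); rewrite /= es; split=> //.
    by move=> z; rewrite !inE => /orP[->//|/ss' ->]; rewrite orbT.
  split=> //; apply: contra_not nx; apply: acl_sub => z [[Sz|->//]|/ss' sz].
    by apply: sub_acl; left.
  by apply: sub_acl; right.
exists s; split=> //; last exact: IH1.
by move=> z; rewrite inE => ->; rewrite orbT.
Qed.

Lemma indep_nil_acl S s : {subset s <= acl S} -> indep S s -> s = [::].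
Proof.
case: s => //= x s sS [nx _]; case: nx.
have /set_mem : x \in acl S by apply: sS; rewrite inE eqxx.
by apply: aclS => z; left.
Qed.

(** The members of t are moved into the base one at a time; each costs s at most one member, and
    when t is exhausted s must be empty. *)
Lemma steinitz S s t : indep S s -> (forall x, x \in s -> acl (S `|` [set` t]) x) ->
  (size s <= size t)%N.
Proof.
elim: t S s => [|y t IH] S s ind st.
  rewrite (@indep_nil_acl S s) // => x /st; rewrite set_nil setU0.
  exact: mem_set.
have st' x : x \in s -> acl (S `|` [set y] `|` [set` t]) x.
  by move=> /st; rewrite set_cons setUA.
case: (indep_adjoin y ind) => [[ind1 ind2]|ay].
  have [ay|ny] := pselect (acl (S `|` [set` s]) y).
    have [s' [-> ss' ind']] := ind2 ay.
    by apply: (IH (S `|` [set y])) => // x /ss'; apply: st'.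
  by apply: (leq_trans (IH _ _ (ind1 ny) _)).
apply: leqW; apply: (IH S) => // x /st'; apply: acl_sub => z [[Sz|->]|tz].
- by apply: sub_acl; left.
- by apply: aclS ay => w; left.
- by apply: sub_acl; right.
Qed.

Lemma exists_basis S t : exists s, [/\ indep S s, {subset s <= t} &
  forall x, x \in t -> acl (S `|` [set` s]) x].
Proof.
elim: t => [|y t [s [ind st ts]]]; first by exists [::].
have [ay|ny] := pselect (acl (S `|` [set` s]) y).
  exists s; split=> // [x /st|x]; rewrite inE; first by move=> ->; rewrite orbT.
  by case/orP => [/eqP ->|/ts].
exists (y :: s); split=> // [x|x]; rewrite inE.
  by case/orP => [/eqP ->|/st]; rewrite inE ?eqxx // => ->; rewrite orbT.
case/orP => [/eqP ->|/ts]; first by apply: sub_acl; right; rewrite /= inE eqxx.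
by apply: aclS; apply: setUS => z; rewrite /= inE => ->; rewrite orbT.
Qed.

End AlgebraicClosure.

Section AclMorphism.
Variables (F M : fieldType) (f : {rmorphism F -> M}).

Lemma acl_image (S : set F) x : acl (f @` S) (f x) <-> acl S x.
Proof.
split=> [[p p0 [Sp px]]|[p p0 [Sp px]]].
  rewrite subring_gen_image in Sp.
  have [|q Sq e] := poly_over_image _ Sp; first exact: subring0 (subring_gen_subring S).
  exists q; first by apply: contra p0 => /eqP q0; rewrite e q0 rmorph0.
  by split=> //; rewrite e fmorph_root in px.
exists (map_poly f p); first by rewrite map_poly_eq0.
rewrite subring_gen_image fmorph_root; split=> //; exact: poly_over_map.
Qed.

Lemma indep_image (S : set F) s : indep (f @` S) [seq f x | x <- s] <-> indep S s.
Proof.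
elim: s => //= x s [IH1 IH2]; rewrite -image_set_seq -image_setU.
by split=> -[nx /[dup] _]; [move=> /IH1|move=> /IH2]; split=> //;
  apply: contra_not nx => /acl_image.
Qed.
End AclMorphism.

(** * Linear independence and finiteness *)

Section FreeFamilies.

Definition free_over (S T : comNzRingType) (f : S -> T) r (v : 'I_r -> T) :=
  forall c : 'I_r -> S, \sum_i f (c i) * v i = 0 -> forall i, c i = 0.

(** If r exceeded the number of spanning elements, the coefficient matrix would have a nonzero row
    in its left kernel, which is a relation between the v i. *)
Lemma free_span_le (F : fieldType) (T : comNzRingType) (j : {rmorphism F -> T})
    r (I : finType) (v : 'I_r -> T) (w : I -> T) :
  free_over j v -> (forall i, exists c : I -> F, v i = \sum_k j (c k) * w k) ->
  (r <= #|I|)%N.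
Proof.
move=> fv /choice[g gE]; rewrite leqNgt; apply/negP => lt.
pose G : 'M[F]_(r, #|I|) := \matrix_(i, k) g i (enum_val k).
have : kermx G != 0.
  rewrite kermx_eq0 /row_free; apply: contraL lt => /eqP <-.
  by rewrite -leqNgt rank_leq_col.
case/rowV0Pn => u /sub_kermxP uG /rV0Pn[i]; case/eqP.
apply: fv => {i}; transitivity (\sum_k j ((u *m G) 0 (enum_rank k)) * w k).
  under eq_bigr => i _ do rewrite gE mulr_sumr.
  rewrite exchange_big /=; apply: eq_bigr => k _.
  rewrite mxE rmorph_sum mulr_suml; apply: eq_bigr => i _.
  by rewrite mxE enum_rankK rmorphM mulrA.
by rewrite uG; apply: big1 => k _; rewrite mxE rmorph0 mul0r.
Qed.

Lemma exists_max_free (F : fieldType) (T : comNzRingType) (j : {rmorphism F -> T})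
    (D : set T) B :
  (forall r (v : 'I_r -> T), (forall i, D (v i)) -> free_over j v -> (r <= B)%N) ->
  exists r (v : 'I_r -> T), [/\ forall i, D (v i), free_over j v &
    forall x, D x -> exists c, x = \sum_i j (c i) * v i].
Proof.
move=> bD.
pose P r := `[< exists v : 'I_r -> T, (forall i, D (v i)) /\ free_over j v >].
have P0 : exists r, P r.
  exists 0%N; apply/asboolP; exists (fun=> 0); split; first by case.
  by move=> c _; case.
have PB r : P r -> (r <= B)%N by move/asboolP => [v [Dv fv]]; apply: bD fv.
case: (ex_maxnP P0 PB) => r /asboolP[v [Dv fv]] maxr.
exists r, v; split=> // x Dx.
pose v' (i : 'I_r.+1) := if unlift ord0 i is Some k then v k else x.
have : ~ free_over j v'.
  move=> fv'; suff /maxr : P r.+1 by rewrite ltnn.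
  apply/asboolP; exists v'; split=> // i.
  by rewrite /v'; case: unliftP.
move/existsNP => [c]; move/not_implyP => [].
rewrite big_ord_recl /v' unlift_none.
under eq_bigr => k _ do rewrite liftK.
move=> e.
have [c0 nc|c0 _] := eqVneq (c ord0) 0.
  case: nc => i; case: (unliftP ord0 i) => [k|] -> //.
  by apply: (fv (c \o lift ord0)); rewrite c0 rmorph0 mul0r add0r in e.
exists (fun k => - (c ord0)^-1 * c (lift ord0 k)).
under eq_bigr do rewrite rmorphM -mulrA.
rewrite -mulr_sumr; move/eqP: e; rewrite addrC addr_eq0 => /eqP ->.
by rewrite mulrN rmorphN mulNr opprK mulrA -rmorphM mulVf // rmorph1 mul1r.
Qed.

Lemma finite_span (F : fieldType) (T : comUnitRingType) (j : {rmorphism F -> T})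
    (a : seq T) :
  (forall x, x \in a -> exists2 p : {poly F}, p != 0 & root (map_poly j p) x) ->
  exists (I : finType) (w : I -> T), forall x,
    subring_gen (range j `|` [set` a]) x -> exists c, x = \sum_k j (c k) * w k.
Proof.
elim: a => [_|a s IH alg].
  exists unit, (fun=> 1) => x; rewrite set_nil setU0 subring_gen_id; last exact: subring_range.
  by move=> [c _ <-]; exists (fun=> c); rewrite (big_pred1 tt) ?mulr1 //; case.
have [x xs|I [w wP]] := IH; first by apply: alg; rewrite inE xs orbT.
have [p p0 /rootP pa] := alg a (mem_head _ _).
exists (I * 'I_(size p))%type, (fun k : I * 'I_(size p) => w k.1 * a ^+ k.2) => x.
rewrite set_cons [[set a] `|` _]setUC setUA => /subring_gen_adjoin[q Sq ->].
have /choice[c cE] i : exists c : I -> F, q`_i = \sum_k j (c k) * w k by exact: (wP _ (Sq i)).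
(* Remainders modulo p express every power of [a] through the first [size p] powers, with
   coefficients in F; p only has to be nonzero because F is a field. *)
pose e i := 'X^i %% p.
have eE i : a ^+ i = \sum_(l < size p) j (e i)`_l * a ^+ l.
  rewrite -[a ^+ i]hornerXn -(map_polyXn j) [X in map_poly j X](divp_eq _ p).
  rewrite rmorphD rmorphM hornerD hornerM pa mulr0 add0r.
  rewrite (@horner_coef_wide _ (size p)); last first.
    by rewrite size_map_poly ltnW // ltn_modp.
  by apply: eq_bigr => l _; rewrite coef_map.
exists (fun k : I * 'I_(size p) => \sum_(i < size q) c i k.1 * (e i)`_k.2).
transitivity (\sum_(i < size q) \sum_k \sum_(l < size p)
    j (c i k * (e i)`_l) * (w k * a ^+ l)).
  rewrite horner_coef; apply: eq_bigr => i _; rewrite cE eE mulr_suml.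
  apply: eq_bigr => k _; rewrite mulr_sumr; apply: eq_bigr => l _.
  by rewrite rmorphM mulrACA.
rewrite -(pair_bigA _ (fun k (l : 'I_(size p)) =>
  j (\sum_(i < size q) c i k * (e i)`_l) * (w k * a ^+ l))) /= exchange_big.
apply: eq_bigr => k _; rewrite exchange_big; apply: eq_bigr => l _.
by rewrite rmorph_sum mulr_suml.
Qed.

End FreeFamilies.

Section AlgebraicFamilies.
Variable M : fieldType.
Implicit Types (S G : set M) (s : seq M).

Definition free_set S r (v : 'I_r -> M) :=
  forall c : 'I_r -> M, (forall i, S (c i)) -> \sum_i c i * v i = 0 ->
  forall i, c i = 0.

Lemma acl_root S x (p : {poly M}) : p != 0 -> poly_over (acl S) p -> root p x -> acl S x.
Proof.
move=> p0 Sp px; apply: (@acl_sub _ (acl S)) => //; exists p => //; split=> // i.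
exact: sub_subring_gen.
Qed.

(** Algebraic elements and transcendental ones are linearly disjoint. After clearing denominators, a
    relation with coefficients q_i(x) is a polynomial in x over the closure of the smaller base; x
    being transcendental, it is zero, and each of its coefficients is a relation over the smaller
    base. *)
Lemma free_set_adjoin S r (v : 'I_r -> M) s :
  (forall i, acl S (v i)) -> free_set (subfield_gen S) v -> indep S s ->
  free_set (subfield_gen (S `|` [set` s])) v.
Proof.
move=> av fv; elim: s => [|x s IH] /=; first by rewrite set_nil setU0.
move=> [nx /IH{}IH] c; rewrite set_cons [[set x] `|` _]setUC setUA.
set G := S `|` _ in nx IH *; set H := G `|` _.
move=> Hc e.
have SG := subring_gen_subring G.
have [|d [Sd d0 Sdc]] := common_denominator (subring_gen_subring H) (v := c).
  by move=> i; rewrite -subfield_genE; apply: Hc.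
have /choice[q qP] i : exists q, poly_over (subring_gen G) q /\ d * c i = q.[x].
  by have /subring_gen_adjoin[q Gq ->] := Sdc i; exists q.
have P0 : \sum_i v i *: q i = 0.
  apply/eqP; apply: contra_notT nx => P0; apply: acl_root P0 _ _.
    move=> l; rewrite coef_sum; apply: (subring_sum (acl_subring G)) => i _.
    rewrite coefZ; apply: (subringM (acl_subring G)).
      by apply: aclS (av i) => z; left.
    by apply: subring_gen_acl; case: (qP i).
  rewrite rootE horner_sum; apply/eqP.
  transitivity (d * \sum_i c i * v i); last by rewrite e mulr0.
  rewrite mulr_sumr.
  by apply: eq_bigr => i _; rewrite hornerZ mulrA; case: (qP i) => _ ->; rewrite mulrC.
have q0 i : q i = 0.
  apply/polyP => l; rewrite coef0.
  apply: (IH (fun i => (q i)`_l)) => [k|].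
    by apply: subring_subfield_gen; case: (qP k).
  have := congr1 (fun f : {poly M} => f`_l) P0; rewrite coef0 coef_sum => e'.
  by rewrite -[RHS]e'; apply: eq_bigr => k _; rewrite coefZ mulrC.
move=> i; apply/eqP; have := mulf_eq0 d (c i); rewrite (negPf d0) /= => <-.
by have [_ ->] := qP i; rewrite q0 horner0.
Qed.

(** With s a transcendence basis taken from a, the field M is finite over the field generated by S
    and s, and a family algebraic over S keeps its independence over that field. Hence its length is
    at most that finite degree. *)
Lemma finite_algebraic_part S (a : seq M) :
  (forall x, subfield_gen (S `|` [set` a]) x) -> exists B, forall r (v : 'I_r -> M),
  (forall i, acl S (v i)) -> free_set (subfield_gen S) v -> (r <= B)%N.
Proof.
move=> Ma; have [s [ind sa as_]] := exists_basis S a.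
have [F [j [rj aE]]] := acl_algebraicOver (S `|` [set` s]).
have [I [w wP]] := @finite_span F M j a (fun x xa => (aE x).1 (as_ x xa)).
exists #|I| => r v av fv.
pose A := subring_gen (range j `|` [set` a]).
have SA : subring A := subring_gen_subring _.
have Aalg x : A x -> algebraicOver j x.
  move=> Ax; apply/aE; move: x Ax; apply: subring_gen_sub; first exact: acl_subring.
  by move=> x; rewrite rj => -[]; [exact: subfield_gen_acl|exact: as_].
have Aj c : A (j c) by apply: sub_subring_gen; left; exists c.
have FA : subfield A.
  apply/subfieldP; split=> // x Ax; have [->|x0] := eqVneq x 0.
    by rewrite invr0; apply: subring0.
  have [p p0 px] := Aalg x Ax.
  (* Dividing p by its power of X leaves q with q(0) != 0 and q(x) = 0; writing q = q' X + q(0)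
     gives x^-1 = - q(0)^-1 q'(x), so the ring A is already a field. *)
  have [m [q q0 pE]] := multiplicity_XsubC p 0.
  have {}q0 : q.[0] != 0 by rewrite -rootE; apply: (implyP q0).
  have qx : (map_poly j q).[x] = 0.
    move: px; rewrite pE polyC0 subr0 rmorphM rmorphXn /= map_polyX rootM.
    by rewrite !rootE hornerXn expf_eq0 (negPf x0) andbF orbF => /eqP.
  have [q' qE] : exists q', q = q' * 'X + (q.[0])%:P.
    by elim/poly_ind: q {q0 qx pE} => [|q c _];
      [exists 0|exists q]; rewrite ?hornerE ?mul0r ?addr0 ?add0r ?mulr0 ?add0r.
  have -> : x^-1 = - j (q.[0])^-1 * (map_poly j q').[x].
    apply: (mulIf x0); rewrite mulVf // -mulrA.
    move: qx; rewrite {1}qE rmorphD rmorphM /= map_polyX map_polyC hornerD hornerM hornerX hornerC.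
    move/eqP; rewrite addr_eq0 => /eqP ->.
    by rewrite mulrNN -rmorphM mulVf // rmorph1.
  apply: (subringM SA); first by apply: (subringN SA).
  by apply: (subring_horner SA) => // i; rewrite coef_map; apply: Aj.
have fj : free_over j v.
  move=> c e i; apply/eqP; rewrite -(fmorph_eq0 j); apply/eqP.
  apply: (free_set_adjoin av fv ind) e i => i.
  by rewrite -rj; exists (c i).
apply: (free_span_le fj) => i; apply: wP; rewrite -/A.
have := Ma (v i); move: (v i); apply: subfield_gen_sub => // x [Sx|ax].
  apply: sub_subring_gen; left; rewrite rj; apply: sub_subfield_gen; left=> //.
by apply: sub_subring_gen; right.
Qed.

End AlgebraicFamilies.

(** * Specialization of transcendental elements *)

Section NonUnits.
Variable M : fieldType.
Implicit Types (F G : set M) (a : seq M).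

(** Each element of a is added to the base unless this would make x algebraic; in that case the
    exchange property makes it algebraic over the base and x. *)
Lemma transcendence_adjust F a x : ~ acl F x -> exists G,
  [/\ F `<=` G, ~ acl G x & forall y, y \in a -> acl (G `|` [set x]) y].
Proof.
elim: a F => [|y a IH] F nx; first by exists F; split.
have [ax|nx'] := pselect (acl (F `|` [set y]) x).
  have [G [FG nGx aG]] := IH F nx; exists G; split=> // z.
  rewrite inE => /orP[/eqP ->|]; last exact: aG.
  by apply: (@aclS _ (F `|` [set x])); [apply: setSU|apply: acl_exchange].
have [G [FG nGx aG]] := IH _ nx'; exists G; split=> // [z Fz|z].
  by apply: FG; left.
rewrite inE => /orP[/eqP ->|]; last exact: aG.
by apply: sub_acl; left; apply: FG; right.
Qed.

Definition char0 := forall k, k.+1%:R != 0 :> M.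

(** For p of degree n + 1 with leading coefficient h, h^n p(y) is a monic polynomial in h y.
    Injectivity of f excludes a constant p. *)
Lemma lead_coef_integral (A : comUnitRingType) (f : {rmorphism A -> M}) (p : {poly A}) y :
  injective f -> p != 0 -> root (map_poly f p) y -> integralOver f (f (lead_coef p) * y).
Proof.
move=> fI p0 py; set h := lead_coef p.
have sp : size p = (size p).-1.+1 by rewrite prednK ?size_poly_gt0.
have [n e] : exists n, size p = n.+2.
  case en: (size p).-1 => [|n]; last by exists n; rewrite sp en.
  have hp : p = h%:P by rewrite /h /lead_coef en; apply: size1_polyC; rewrite sp en.
  move: py; rewrite hp map_polyC rootC => /eqP fh.
  by case/eqP: p0; rewrite hp; congr _%:P; apply: fI; rewrite fh rmorph0.
pose P := \poly_(i < n.+1) (p`_i * h ^+ (n - i)).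
exists ('X^(n.+1) + P).
  rewrite monicE lead_coefDl ?lead_coefXn //.
  by rewrite size_polyXn ltnS size_poly.
rewrite rootE rmorphD /= map_polyXn hornerD hornerXn.
rewrite (@horner_coef_wide _ n.+1); last first.
  exact: leq_trans (size_poly _ _) (size_poly _ _).
apply/eqP; transitivity (f h ^+ n * (map_poly f p).[y]); last by rewrite (rootP py) mulr0.
have -> : (map_poly f p).[y] = \sum_(i < n.+2) f p`_i * y ^+ i.
  rewrite (@horner_coef_wide _ (size p)) ?size_poly // e.
  by apply: eq_bigr => i _; rewrite coef_map.
rewrite [in RHS]big_ord_recr /= mulrDr addrC; congr (_ + _); last first.
  have -> : p`_n.+1 = h by rewrite /h /lead_coef e.
  by rewrite exprMn exprSr mulrA.
rewrite mulr_sumr; apply: eq_bigr => i _; rewrite !coef_map /= coef_poly ltn_ord.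
rewrite rmorphM rmorphXn exprMn -mulrA [_ * (f h ^+ i * _)]mulrA -exprD.
by rewrite subnK ?leq_ord // mulrCA.
Qed.

(* Choose G with x transcendental and every element of a algebraic over G(x).   *)
(* For some h <> 0 the h * y, y in a, are integral over G[x]; if x - k is        *)
(* invertible in F[a], some h^s / (x - k) is integral over G[x], so h(k) = 0.    *)
Lemma nonunit_specialization F a x : char0 -> ~ acl F x ->
  exists k : nat, forall u, subring_gen (F `|` [set` a]) u -> (x - k%:R) * u <> 1.
Proof.
move=> ch0 nx; have [G [FG nGx aG]] := transcendence_adjust a nx.
have [E [j [rj _]]] := acl_algebraicOver G.
have [f fE] : exists f : {rmorphism {poly E} -> M}, forall p, f p = (map_poly j p).[x].
  by exists (horner_eval x \o map_poly j).
have fI : injective f.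
  move=> p q /eqP; rewrite -subr_eq0 -rmorphB fE => /eqP e.
  apply/eqP; rewrite -subr_eq0; apply: contra_notT nGx => pq.
  apply: (@acl_root _ _ _ (map_poly j (p - q))); last exact/rootP.
    by rewrite map_poly_eq0.
  by move=> i; rewrite coef_map; apply: subfield_gen_acl; rewrite -rj; exists (p - q)`_i.
have [h h0 ha] : exists2 h, h != 0 & forall y, y \in a -> integralOver f (f h * y).
  elim: a aG => [|y a IH] aG; first by exists 1; rewrite ?oner_neq0.
  have [z za|h h0 ha] := IH; first by apply: aG; rewrite inE za orbT.
  have [p p0 [Sp py]] := aG y (mem_head _ _).
  have [|q e] := @poly_over_range _ _ f p.
    move=> i; have /subring_gen_adjoin[q Sq ->] := Sp i.
    have [|q' e] := @poly_over_range _ _ j q.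
      by move=> l; rewrite rj; apply: subring_subfield_gen.
    by exists q'; rewrite ?fE ?e.
  have q0 : q != 0 by apply: contra p0 => /eqP q0; rewrite e q0 rmorph0.
  exists (lead_coef q * h); first by rewrite mulf_neq0 // lead_coef_eq0.
  move=> z; rewrite inE rmorphM => /orP[/eqP ->|za].
    by rewrite mulrAC; apply: integral_mul (integral_id _ _);
      apply: lead_coef_integral => //; rewrite -e.
  by rewrite -mulrA; apply: integral_mul (ha _ za); apply: integral_id.
(* The elements that become integral over E[x] after multiplication by a power of h. They form a
   ring containing F and a, hence every candidate inverse u of x - k. *)
pose A := [set u | exists k, integralOver f (f h ^+ k * u)].
have SA : subring A.
  have up k l u : integralOver f (f h ^+ k * u) -> integralOver f (f h ^+ (k + l) * u).
    by rewrite addnC exprD -mulrA => iu; apply: integral_mul iu; rewrite -rmorphXn;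
      apply: integral_id.
  apply/subringP; split=> [|u v [k uk] [l vl]|u v [k uk] [l vl]].
  - by exists 0%N; rewrite mul1r; apply: integral1.
  - exists (k + l)%N; rewrite mulrBr; apply: integral_sub; first exact: up.
    by rewrite addnC; apply: up.
  - by exists (k + l)%N; rewrite exprD mulrACA; apply: integral_mul.
(* In characteristic 0 the integers below [size h] are distinct, more than h has roots. *)
have [k hk] : exists k : nat, h.[k%:R] != 0.
  apply: contrapT => /forallNP hk; pose rs := [seq (i%:R : E) | i <- iota 0 (size h)].
  have : (size rs < size h)%N.
    apply: max_poly_roots => //.
      by apply/allP => _ /mapP[i _ ->]; apply/rootP/eqP; apply: contra_notT (hk i).
    have inj (i l : nat) : (i < l)%N -> (i%:R : E) != l%:R.
      move=> il; rewrite eq_sym -subr_eq0 -natrB; last exact: ltnW.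
      rewrite -(subnSK il) -(fmorph_eq0 j) rmorph_nat.
      exact: ch0.
    rewrite map_inj_uniq ?iota_uniq // => i l /eqP; apply: contraTeq => il.
    by have [lt|lt|e] := ltngtP i l; [exact: inj|rewrite eq_sym; exact: inj|rewrite e eqxx in il].
  by rewrite size_map size_iota ltnn.
exists k => u Au xu; have : A u.
  move: u Au {xu}; apply: subring_gen_sub => // u [Fu|ua].
    have [c _ <-] : range j u by rewrite rj; apply: sub_subfield_gen; apply: FG.
    exists 0%N; rewrite mul1r; have -> : j c = f c%:P by rewrite fE map_polyC hornerC.
    exact: integral_id.
  by exists 1%N; rewrite expr1; apply: ha.
case=> s [Q Qm]; set w := f h ^+ s * u => Qw.
pose L : {poly E} := 'X - (k%:R)%:P.
have wL : w * f L = f (h ^+ s).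
  rewrite [f L]fE rmorphB /= map_polyX map_polyC hornerD hornerN hornerX hornerC /= rmorph_nat.
  by rewrite -mulrA [u * _]mulrC xu mulr1 rmorphXn.
have [n e] : exists n, size Q = n.+1.
  by exists (size Q).-1; rewrite prednK // size_poly_gt0 monic_neq0.
(* The integral equation of w is multiplied by L^n, and w L = h^s removes w. The resulting identity
   between polynomials, evaluated at k where L vanishes, keeps only its top term, a power of
   h(k). *)
have : f (\sum_(i < n.+1) Q`_i * (h ^+ s) ^+ i * L ^+ (n - i)) = 0.
  transitivity (f L ^+ n * (map_poly f Q).[w]); last by rewrite (rootP Qw) mulr0.
  rewrite (@horner_coef_wide _ (size Q)) ?size_poly //.
  rewrite rmorph_sum mulr_sumr e; apply: eq_bigr => i _.
  rewrite coef_map /= !rmorphM (rmorphXn f i (h ^+ s)) (rmorphXn f _ L) -wL exprMn.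
  by rewrite -!mulrA -exprD subnKC ?leq_ord // [RHS]mulrC mulrA.
rewrite -(rmorph0 f) => /fI /(congr1 (fun p : {poly E} => p.[k%:R])).
rewrite horner0 horner_sum big_ord_recr /= big1 => [|i _].
  rewrite subnn expr0 mulr1 add0r.
  have -> : Q`_n = 1 by move: Qm; rewrite monicE /lead_coef e => /eqP.
  by rewrite mul1r !horner_exp => /eqP; rewrite !expf_eq0 (negPf hk) !andbF.
rewrite hornerM horner_exp /L hornerXsubC subrr expr0n subn_eq0.
by rewrite leqNgt ltn_ord mulr0.
Qed.
End NonUnits.

(** * Krull dimension and transcendence degree *)

Section MultivariateIndependence.
Variable M : fieldType.

Lemma mcoeff_muni d (p : {mpoly M[d.+1]}) (m : 'X_{1..d.+1}) :
  ((muni p)`_(m ord_max))@_[multinom m (widen_ord (leqnSn d) i) | i < d] = p@_m.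
Proof.
rewrite muniE coef_sum raddf_sum [in RHS](mpolyE p) raddf_sum /=.
apply: eq_bigr => m' _; rewrite coefZ coefXn mulr_natr mcoeffMn !mcoeffZ !mcoeffX.
rewrite -mulrnAr; congr (_ * _); rewrite -mulrnA; congr (_ *+ _).
rewrite mulnb; congr nat_of_bool; apply/andP/eqP => [[/eqP/mnmP e /eqP e']|-> //].
apply/mnmP => i; have [li|] := ltnP i d; last first.
  move=> di; have -> : i = ord_max; last by rewrite e'.
  by apply/val_inj/eqP; rewrite eqn_leq leq_ord.
have := e (Ordinal li); rewrite !mnmE.
by have -> : widen_ord (leqnSn d) (Ordinal li) = i by apply: val_inj.
Qed.

Lemma meval_muni d (p : {mpoly M[d.+1]}) (b : 'I_d.+1 -> M) :
  p.@[b] = (map_poly (meval (b \o widen_ord (leqnSn d))) (muni p)).[b ord_max].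
Proof.
rewrite muniE mevalE rmorph_sum horner_sum; apply: eq_bigr => m _ /=.
rewrite map_polyZ map_polyXn hornerZ hornerXn /= mevalZ mevalX big_ord_recr /= mulrA.
by congr (_ * _ * _); apply: eq_bigr => i _; rewrite mnmE.
Qed.

Lemma mpoly_overE d (F : set M) (p : {mpoly M[d]}) : F 0 ->
  p \is a mpolyOver d (mem F) <-> forall m, F p@_m.
Proof.
move=> F0; rewrite qualifE /=; split=> [/allP Fp m|Fp].
  have [/(map_f (fun m => p@_m))/Fp|] := boolP (m \in msupp p); first by rewrite /= in_setE.
  by rewrite -mcoeff_eq0 => /eqP ->.
by apply/allP => _ /mapP[m _ ->]; apply/mem_set.
Qed.

(** The list is reversed because [indep] has the head transcendental over the tail, while [muni]
    views a polynomial as univariate in its last variable. *)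
Lemma indep_algebraically_independent (F : set M) (s : seq M) : subring F ->
  indep F s -> algebraically_independent F (fun i : 'I_(size s) => (rev s)`_i).
Proof.
move=> FF; have F0 := subring0 FF.
have step d (b : 'I_d.+1 -> M) :
    algebraically_independent F (b \o widen_ord (leqnSn d)) ->
    ~ acl (F `|` range (b \o widen_ord (leqnSn d))) (b ord_max) ->
    algebraically_independent F b.
  set b' := b \o _ => ib nb p /(mpoly_overE _ F0) Fp; rewrite meval_muni -/b' => pb.
  have Fm k : (muni p)`_k \is a mpolyOver d (mem F).
    apply/(mpoly_overE _ F0) => m; pose m' := (mnmwiden m + U_(ord_max) *+ k)%MM.
    have := mcoeff_muni p m'.
    have -> : m' ord_max = k by rewrite /m' mnmE mulmnE mnmwiden_ordmax mnm1E eqxx mul1n.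
    have -> : [multinom m' (widen_ord (leqnSn d) i) | i < d] = m.
      apply/mnmP => i; rewrite mnmE /m' mnmDE mulmnE mnmwiden_widen mnm1E.
      by rewrite -val_eqE /= gtn_eqF // mul0n addn0.
    by move=> ->.
  have P0 : map_poly (meval b') (muni p) = 0.
    apply/eqP; apply: contra_notT nb => P0; exists (map_poly (meval b') (muni p)) => //.
    split; last exact/rootP.
    move=> k; rewrite coef_map /= mevalE.
    have SG := subring_gen_subring (F `|` range b').
    apply: (subring_sum SG) => m _; apply: (subringM SG).
      apply: sub_subring_gen; left; exact: ((mpoly_overE _ F0).1 (Fm k)).
    apply: (subring_prod SG) => i _; apply: (subringX SG).
    by apply: sub_subring_gen; right; exists i.
  apply/mpolyP => m; rewrite -mcoeff_muni mcoeff0.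
  have -> : (muni p)`_(m ord_max) = 0; last by rewrite mcoeff0.
  apply: ib => //.
  by have := congr1 (fun f : {poly M} => f`_(m ord_max)) P0; rewrite coef_map coef0.
elim: s => [_|x s IH [nx ind]] /=.
  move=> p Fp; rewrite mevalE => p0; apply/mpolyP => m; rewrite mcoeff0 -[RHS]p0.
  rewrite [in LHS](mpolyE p) raddf_sum /=; apply: eq_bigr => m' _.
  rewrite big_ord0 mulr1 mcoeffZ mcoeffX.
  have -> : m' = m by apply/mnmP => -[].
  by rewrite eqxx mulr1.
have eb : (fun i : 'I_(size s).+1 => (rev (x :: s))`_i) \o widen_ord (leqnSn (size s)) =
          (fun i : 'I_(size s) => (rev s)`_i).
  by apply: funext => i /=; rewrite rev_cons nth_rcons size_rev ltn_ord.
apply: step; rewrite eb; first exact: IH.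
rewrite /= rev_cons nth_rcons size_rev ltnn eqxx.
apply: contra_not nx; apply: aclS; apply: setUS => _ [i _ <-] /=.
by rewrite -mem_rev mem_nth // size_rev.
Qed.

End MultivariateIndependence.

Section Specialization.
Variables (K : fieldType) (R : comUnitRingType) (iota : {rmorphism K -> R}).
Implicit Types (Q : fieldType) (s : seq R).

(** Prime ideals of R are handled as kernels of maps phi to fields; this is algebraic independence
    over K at the point phi. *)
Definition indep_at Q (phi : {rmorphism R -> Q}) s :=
  indep (range (phi \o iota)) [seq phi x | x <- s].

Lemma range_comp_image Q (phi : {rmorphism R -> Q}) s :
  range (phi \o iota) `|` [set` [seq phi x | x <- s]] = phi @` (range iota `|` [set` s]).
Proof.
by rewrite image_setU image_comp image_set_seq.
Qed.

(** The subring K[s] meets the kernel of phi only in 0. A polynomial in the head x that vanishes at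
    phi x must have all coefficients in the kernel, and these are 0 by induction. *)
Lemma indep_at_injective Q (phi : {rmorphism R -> Q}) s : indep_at phi s ->
  forall g, subring_gen (range iota `|` [set` s]) g -> phi g = 0 -> g = 0.
Proof.
elim: s => [_|x s IH [nx /IH{}IH]] g.
  rewrite set_nil setU0 subring_gen_id; last exact: subring_range.
  move=> [k _ <-] /eqP; rewrite -[phi _]/((phi \o iota) k) fmorph_eq0 => /eqP ->.
  by rewrite rmorph0.
rewrite set_cons [[set x] `|` _]setUC setUA => /subring_gen_adjoin[p Sp ->] e.
suff -> : p = 0 by rewrite horner0.
have p0 : map_poly phi p = 0.
  apply/eqP; apply: contra_notT nx => p0; exists (map_poly phi p) => //.
  split; last by rewrite rootE horner_map e.
  by rewrite range_comp_image subring_gen_image; apply: poly_over_map.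
apply/polyP => i; rewrite coef0; apply: IH => //.
by have := congr1 (fun f : {poly Q} => f`_i) p0; rewrite coef_map coef0.
Qed.

Lemma not_acl_at Q (phi : {rmorphism R -> Q}) s z :
  (forall q, poly_over (subring_gen (range iota `|` [set` s])) q ->
     phi q.[z] = 0 -> q = 0) ->
  ~ acl (range (phi \o iota) `|` [set` [seq phi x | x <- s]]) (phi z).
Proof.
move=> H [p p0 []]; rewrite range_comp_image subring_gen_image.
have SG := subring_gen_subring (range iota `|` [set` s]).
move=> /(poly_over_image (subring0 SG))[q Sq e]; rewrite e rootE horner_map => /eqP qz.
by move: p0; rewrite e (H q Sq qz) rmorph0 eqxx.
Qed.

(** Functions independent on a closed subvariety are independent on the whole variety: a relation
    modulo the smaller prime is one modulo the larger. *)
Lemma indep_at_generize Q Q' (phi : {rmorphism R -> Q}) (phi' : {rmorphism R -> Q'}) s :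
  (forall x, phi x = 0 -> phi' x = 0) -> indep_at phi' s -> indep_at phi s.
Proof.
move=> ker; elim: s => //= x s IH [nx ind]; split; last exact: IH.
apply: not_acl_at => q Sq /ker qx; apply/polyP => i; rewrite coef0.
apply: (indep_at_injective ind) => //.
have /(congr1 (fun f : {poly Q'} => f`_i)) : map_poly phi' q = 0; last by rewrite coef_map coef0.
apply/eqP; apply: contra_notT nx => q0; exists (map_poly phi' q) => //.
split; last by rewrite rootE horner_map qx.
by rewrite range_comp_image subring_gen_image; apply: poly_over_map.
Qed.

(** An element a of the larger prime outside the smaller one is transcendental over s at the latter:
    in a relation q(a) a + c, the map phi' kills a, so c = 0, and phi a can be cancelled. A strict
    inclusion of primes thus raises the transcendence degree. *)
Lemma indep_at_generize_cons Q Q' (phi : {rmorphism R -> Q}) (phi' : {rmorphism R -> Q'}) s a :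
  (forall x, phi x = 0 -> phi' x = 0) -> indep_at phi' s ->
  phi' a = 0 -> phi a != 0 -> indep_at phi (a :: s).
Proof.
move=> ker ind a'0 a0; split; last exact: indep_at_generize ind.
apply: not_acl_at; elim/poly_ind => [//|q c IH] Sqc e.
have Sq : poly_over (subring_gen (range iota `|` [set` s])) q.
  by move=> i; have := Sqc i.+1; rewrite coefD coefMX coefC /= addr0.
have Sc : subring_gen (range iota `|` [set` s]) c.
  by have := Sqc 0%N; rewrite coefD coefMX coefC /= add0r.
have c0 : c = 0.
  apply: (indep_at_injective ind) => //; move: (ker _ e).
  by rewrite !hornerE rmorphD rmorphM a'0 mulr0 add0r.
move: e; rewrite c0 !hornerE rmorphM => /eqP; rewrite mulf_eq0 (negPf a0) orbF.
by move=> /eqP/(IH Sq) ->; rewrite mul0r.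
Qed.

Variables (gens : seq R).
Hypothesis gensP : forall x, subring_gen (range iota `|` [set` gens]) x.

(** Some x - k is not invertible in the algebra generated over K(s) by the image of R; a prime of
    that algebra containing it contracts to a strictly larger prime of R. The list s remains
    independent because the field K(s) embeds in the new residue field. *)
Lemma indep_at_specialize Q (phi : {rmorphism R -> Q}) x s : char0 Q ->
  indep_at phi (x :: s) -> exists Q' (phi' : {rmorphism R -> Q'}),
    [/\ forall r, phi r = 0 -> phi' r = 0, exists2 r, phi' r = 0 & phi r != 0
      & indep_at phi' s].
Proof.
move=> ch0 [nx ind]; set G := range _ `|` _ in nx.
have nx' : ~ acl (subfield_gen G) (phi x).
  by apply: contra_not nx; apply: acl_sub; apply: subfield_gen_acl.
have [k nu] := nonunit_specialization [seq phi r | r <- gens] ch0 nx'.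
have [F [j jE]] := subfield_type (subfield_gen_subfield G).
set S := subring_gen _ in nu.
have [A [i [iI iE]]] := subring_type (subring_gen_subring
  (subfield_gen G `|` [set` [seq phi r | r <- gens]])).
have phiS r : S (phi r).
  have : (phi @` (subring_gen (range iota `|` [set` gens]))) (phi r) by exists r.
  rewrite -subring_gen_image -range_comp_image; apply: subring_genS; apply: setSU => y Ky.
  by apply: sub_subfield_gen; left.
have [h hE] := factor_inj (g := phi) iI (fun r => (iE (phi r)).1 (phiS r)).
have jS c : S (j c) by apply: sub_subring_gen; left; apply/jE; exists c.
have [g gE] := factor_inj (g := j) iI (fun c => (iE (j c)).1 (jS c)).
pose y := h (x - k%:R).
have [||P [Pp yP]] := @exists_prime A [set b | exists c, b = c * y].
- split=> //; first by exists 0; rewrite mul0r.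
    by move=> _ _ [c ->] [d ->]; exists (c + d); rewrite mulrDl.
  by move=> b _ [c ->]; exists (b * c); rewrite mulrA.
- move=> [c e]; apply: (nu (i c)); first by apply/iE; exists c.
  rewrite -(rmorph_nat phi k) -rmorphB -hE -/y mulrC -rmorphM -e.
  exact: rmorph1.
have [Q' [p [pE _]]] := residue_field Pp.
exists Q', (p \o h : {rmorphism R -> Q'}); split=> [r r0||].
- rewrite /= (_ : h r = 0) ?rmorph0 //; apply: iI.
  by rewrite hE r0 rmorph0.
- exists (x - k%:R); first by apply/pE/yP; exists 1; rewrite mul1r.
  rewrite rmorphB rmorph_nat subr_eq0; apply: contra_notN nx => /eqP ->.
  exact: (subring_nat (acl_subring G)).
have jG r : G (phi r) -> exists c, j c = phi r.
  by move=> Gr; have /jE[c ->] := sub_subfield_gen Gr; exists c.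
(* The copy of K inside F, the subfield generated by K and s: independence of s is moved from Q to F
   and then along the embedding of F in Q'. *)
pose K0 := [set c | exists l, j c = phi (iota l)].
have jK0 : j @` K0 = range (phi \o iota).
  apply/seteqP; split=> [_ [c [l e] <-]|_ [l _ <-]]; first by exists l.
  have [|c e] := jG (iota l); first by left; exists l.
  by exists c => //; exists l.
have [t et] : exists t, [seq phi r | r <- s] = [seq j c | c <- t].
  have : {subset s <= s} by [].
  elim: {1 3}s => [|r s' IH] ss; first by exists [::].
  have [z zs|t et] := IH; first by apply: ss; rewrite inE zs orbT.
  have [|c e] := jG r; last by exists (c :: t); rewrite /= et e.
  by right; apply/map_f/ss/mem_head.
have : indep_at phi s by [].
rewrite /indep_at -jK0 et => /indep_image.
move=> /(indep_image (p \o g)); rewrite /indep_at.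
have -> : (p \o g) @` K0 = range (p \o h \o iota).
  have key c l : j c = phi (iota l) -> g c = h (iota l).
    by move=> e; apply: iI; rewrite gE hE.
  apply/seteqP; split=> [_ [c [l e] <-]|_ [l _ <-]].
    by exists l => //=; rewrite (key _ _ e).
  have [c _ e] : (j @` K0) (phi (iota l)) by rewrite jK0; exists l.
  by exists c; [exists l|rewrite /= (key _ _ e)].
have -> // : [seq (p \o g) c | c <- t] = [seq (p \o h) r | r <- s].
rewrite (map_comp p g) (map_comp p h); congr (map p _); apply: (inj_map iI).
by rewrite -(map_comp i g) -(map_comp i h) (eq_map gE) (eq_map hE).
Qed.

Lemma prime_idealE (P : set R) : is_prime P <-> prime_ideal P.
Proof.
split=> [[[P0 PD PM _] P1 PP]|[[P0 P1 PD] PP]].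
  split; first split.
  - exact/mem_set.
  - by apply/negP => /set_mem.
  - by move=> a x y /set_mem Px /set_mem Py; apply/mem_set/PD => //; apply: PM.
  - by move=> x y /set_mem/PP[/mem_set -> //|/mem_set ->]; rewrite orbT.
have {}P0 := set_mem P0.
have {}PD a x y : P x -> P y -> P (a * x + y).
  by move=> /mem_set Px /mem_set Py; apply/set_mem/PD.
split; first split=> //.
- by move=> x y Px Py; rewrite -[x]mul1r; apply: PD.
- by move=> a x Px; rewrite -[a * x]addr0; apply: PD.
- by move=> /mem_set; apply/negP.
- by move=> x y /mem_set/PP/orP[] /set_mem; [left|right].
Qed.

Lemma ker_prime Q (phi : {rmorphism R -> Q}) : is_prime [set x | phi x = 0].
Proof.
split; first split=> //=.
- exact: rmorph0.
- by move=> x y x0 y0; rewrite rmorphD x0 y0 addr0.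
- by move=> a x x0; rewrite rmorphM x0 mulr0.
- by move=> /= /eqP; rewrite rmorph1 oner_eq0.
- by move=> x y /eqP; rewrite rmorphM mulf_eq0 => /orP[] /eqP; [left|right].
Qed.

Lemma rmorph_char0 (Q Q' : fieldType) (f : {rmorphism Q -> Q'}) : char0 Q -> char0 Q'.
Proof. by move=> ch k; rewrite -(rmorph_nat f) fmorph_eq0. Qed.

Lemma indep_at_chain Q (phi : {rmorphism R -> Q}) s : char0 K -> indep_at phi s ->
  exists P : nat -> set R, [/\ P 0%N = [set x | phi x = 0], forall i, is_prime (P i) &
    forall i, (i < size s)%N -> P i `<` P i.+1].
Proof.
move=> ch0; elim: s Q phi => [|x s IH] Q phi ind.
  by exists (fun=> [set x | phi x = 0]); split=> // i; apply: ker_prime.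
have [|Q' [phi' [ker [r r0 nr] ind']]] := indep_at_specialize _ ind.
  exact: (rmorph_char0 (phi \o iota)).
have [P [P0 Pp Pl]] := IH _ phi' ind'.
exists (fun i => if i is l.+1 then P l else [set x | phi x = 0]); split=> // [[|i]|[|i]] //=.
- exact: ker_prime.
- move=> _; rewrite P0; split; first exact: ker.
  by move=> /(_ r r0) /= e; rewrite e eqxx in nr.
- exact: Pl.
Qed.

(** One element of P_(i+1) outside P_i is chosen at each step. The resulting list serves every phi
    whose kernel lies in the bottom prime, which allows a translate of a fixed map to be inserted
    later. *)
Lemma chain_indep_at d (P : 'I_d.+1 -> set R) : prime_chain P ->
  exists s, size s = d /\ forall Q (phi : {rmorphism R -> Q}),
    (forall x, phi x = 0 -> P ord0 x) -> indep_at phi s.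
Proof.
elim: d P => [|d IH] P [Pp Pl]; first by exists [::].
have [|s [ss ind]] := IH (P \o lift ord0).
  by split=> [i|i j ij] /=; [exact: Pp|exact: Pl].
have [P01 nP01] := Pl ord0 (lift ord0 ord0) isT.
have /existsNP[a /not_implyP[Pa nPa]] := nP01.
exists (a :: s); split=> [|Q phi ker]; first by rewrite /= ss.
have [Q' [phi' [phi'E _]]] := residue_field ((prime_idealE _).2 (Pp (lift ord0 ord0))).
apply: (@indep_at_generize_cons _ _ _ phi').
- by move=> x /ker/P01/phi'E.
- by apply: ind => x /phi'E.
- exact/phi'E.
- by apply: contra_notN nPa => /eqP/ker.
Qed.

End Specialization.

(** A chain of length [size z] comes from specializing z. Conversely the translates of ker phi
    intersect in 0, so the bottom prime of any chain contains one of them; the chain then gives an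
    independent family at phi \o sigma^i, whose values are algebraic over the image of z, and
    Steinitz bounds its length. *)
Lemma Krull_dim_difference_ring (K : fieldType) (R : comUnitRingType)
    (iota : {rmorphism K -> R}) (gens : seq R) (Q : fieldType) (phi : {rmorphism R -> Q})
    (sK : K -> K) (s : {rmorphism R -> R}) (N : nat) (z : seq R) :
  (forall x, subring_gen (range iota `|` [set` gens]) x) -> char0 K ->
  bijective sK -> (forall k, s (iota k) = iota (sK k)) ->
  (forall x, (forall i, (i < N)%N -> phi (iter i s x) = 0) -> x = 0) ->
  indep_at iota phi z ->
  (forall x, acl (range (phi \o iota) `|` [set` [seq phi x | x <- z]]) (phi x)) ->
  Krull_dim R (size z).
Proof.
move=> gensP ch0 [sK' sKK' sK'K] sE inter ind gen; split.
  have [P [P0 Pp Pl]] := indep_at_chain gensP ch0 ind.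
  exists (fun i : 'I_(size z).+1 => P i); split=> [i|i j]; first exact/prime_idealE.
  have : (j < (size z).+1)%N by [].
  move: (nat_of_ord j) => l lz; elim: l lz => // l IH lz; rewrite ltnS leq_eqVlt.
  case/orP => [/eqP ->|il]; first exact: Pl.
  have [P1 P2] := IH (ltnW lz) il; have [P3 P4] := Pl l lz.
  by split; [exact: subset_trans P1 P3|move=> /(subset_trans P3)].
move=> d P Pc; have [t [ts indt]] := chain_indep_at iota Pc.
have [Pp _] := Pc.
have siE i x : iter i s (iota x) = iota (iter i sK x).
  by elim: i => //= i ->; rewrite sE.
have rs' i : [set phi (iter i s (iota x)) | x in setT] = range (phi \o iota).
  apply/seteqP; split=> [_ [x _ <-]|_ [x _ <-]]; first by rewrite siE; exists (iter i sK x).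
  have siK : iter i sK (iter i sK' x) = x.
    by elim: i => //= i IH; rewrite -iterS iterSr sK'K IH.
  by exists (iter i sK' x) => //=; rewrite siE siK.
have [i iN ker] : exists2 i, (i < N)%N & forall x, phi (iter i s x) = 0 -> P ord0 x.
  apply: contrapT => nex.
  have /choice[w wP] (i : 'I_N) : exists x, phi (iter i s x) = 0 /\ ~ P ord0 x.
    apply: contrapT => /forallNP nx; apply: nex; exists i => // x x0.
    by apply: contrapT => nPx; apply: (nx x).
  have Pp0 := (prime_idealE _).2 (Pp ord0).
  have [[P00 _ _ _] _ _] := Pp0.
  (* The product of elements w i of the translates, all outside the prime, lies in every translate
     and is therefore 0. *)
  have /(prime_prod Pp0)[i _] : P ord0 (\prod_i w i); last by case: (wP i).
  rewrite (_ : \prod_i w i = 0) //; apply: inter => i iN.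
  have -> : iter i s (\prod_l w l) = \prod_l iter i s (w l).
    by elim: i {iN} => //= i ->; rewrite rmorph_prod.
  by rewrite (bigD1 (Ordinal iN)) //= rmorphM; case: (wP (Ordinal iN)) => -> _; rewrite mul0r.
have [f fE] := iter_rmorphism s i.
have rf : range ((phi \o f) \o iota) = range (phi \o iota).
  by rewrite -(rs' i); apply/seteqP; split=> _ [x _ <-]; exists x => //=; rewrite fE.
have /= indf := indt _ (phi \o f : {rmorphism R -> Q}) (fun x fx => ker x (etrans (esym (congr1 phi (fE x))) fx)).
rewrite /indep_at rf in indf.
have := @steinitz _ _ _ [seq phi x | x <- z] indf; rewrite !size_map ts; apply.
by move=> _ /mapP[x _ ->]; apply: gen.
Qed.

(** * Difference rings and linear disjointness *)

Definition consf (T : Type) r (x : T) (v : 'I_r -> T) (i : 'I_r.+1) : T :=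
  if unlift ord0 i is Some k then v k else x.

Lemma consf0 (T : Type) r (x : T) (v : 'I_r -> T) : consf x v ord0 = x.
Proof. by rewrite /consf unlift_none. Qed.

Lemma consfS (T : Type) r (x : T) (v : 'I_r -> T) k : consf x v (lift ord0 k) = v k.
Proof. by rewrite /consf liftK. Qed.

Lemma ord_consP r (P : 'I_r.+1 -> Prop) : P ord0 -> (forall k, P (lift ord0 k)) -> forall i, P i.
Proof. by move=> P0 PS i; case: (unliftP ord0 i) => [k|] ->. Qed.

Lemma span_products (T : comUnitRingType) (A B : set T) x : subring A -> subring B ->
  subring_gen (A `|` B) x -> exists r (a b : 'I_r -> T),
    [/\ forall i, A (a i), forall i, B (b i) & x = \sum_i a i * b i].
Proof.
move=> SA SB Ax.
have [s [sAB ->]] : exists s : seq (T * T), (forall p, p \in s -> A p.1 /\ B p.2) /\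
    x = \sum_(p <- s) p.1 * p.2.
  move: x Ax; apply: subring_gen_sub => [|x [Ax|Bx]]; last first.
  - exists [:: (1, x)]; rewrite big_seq1 mul1r; split=> // p.
    by rewrite inE => /eqP ->; split=> //; exact: (subring1 SA).
  - exists [:: (x, 1)]; rewrite big_seq1 mulr1; split=> // p.
    by rewrite inE => /eqP ->; split=> //; exact: (subring1 SB).
  apply/subringP; split.
  - exists [:: (1, 1)]; rewrite big_seq1 mulr1; split=> // p.
    by rewrite inE => /eqP ->; split; [exact: (subring1 SA)|exact: (subring1 SB)].
  - move=> _ _ [s [sAB ->]] [t [tAB ->]]; exists (s ++ [seq (- p.1, p.2) | p <- t]); split.
      move=> p; rewrite mem_cat => /orP[/sAB//|/mapP[q /tAB[Aq Bq] ->]].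
      by split=> //; apply: (subringN SA).
    rewrite big_cat big_map /= -sumrN; congr (_ + _).
    by apply: eq_bigr => p _; rewrite mulNr.
  - move=> _ _ [s [sAB ->]] [t [tAB ->]].
    exists [seq (p.1 * q.1, p.2 * q.2) | p <- s, q <- t]; split.
      move=> _ /allpairsP[[p q] [/sAB[Ap Bp] /tAB[Aq Bq] ->]].
      by split; [exact: (subringM SA)|exact: (subringM SB)].
    rewrite big_distrlr big_allpairs_dep /=; apply: eq_bigr => p _.
    by apply: eq_bigr => q _; rewrite mulrACA.
exists (size s), (fun i => (tnth (in_tuple s) i).1), (fun i => (tnth (in_tuple s) i).2).
by split=> [i|i|]; [case: (sAB _ (mem_tnth i (in_tuple s)))..|rewrite big_tnth].
Qed.

Definition sigma_simple (S : comNzRingType) (s : S -> S) :=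
  forall I, stable_ideal s I -> forall x, I x -> x != 0 -> I 1.

Lemma field_sigma_simple (F : fieldType) (s : F -> F) : sigma_simple s.
Proof. by move=> I [_ _ IM _] x Ix x0; rewrite -(mulVf x0); apply: IM. Qed.

(** The principal ideal of a nonzero constant is stable under sigma, hence contains 1. *)
Lemma constants_subfield (U : comUnitRingType) (s : {rmorphism U -> U}) :
  sigma_simple s -> subfield (constants s).
Proof.
move=> simple; split.
  split; first by apply/mem_set; rewrite /constants /= rmorph1.
    move=> x y /set_mem cx /set_mem cy; apply/mem_set; rewrite /constants /= in cx cy *.
    by rewrite rmorphB cx cy.
  move=> x y /set_mem cx /set_mem cy; apply/mem_set; rewrite /constants /= in cx cy *.
  rewrite rmorphM cx; congr (_ * _); have [uy|nuy] := boolP (y \is a GRing.unit).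
    by rewrite rmorphV // cy.
  by rewrite invr_out.
move=> x cx x0; have [] := simple [set y | exists b, y = b * x] _ x _ x0.
- split=> //=; first by exists 0; rewrite mul0r.
  + by move=> _ _ [b ->] [c ->]; exists (b + c); rewrite mulrDl.
  + by move=> a _ [b ->]; exists (a * b); rewrite mulrA.
  + by move=> _ [b ->]; exists (s b); rewrite rmorphM [s x]cx.
- by exists 1; rewrite mul1r.
- by move=> b e; apply/unitrP; exists b; rewrite -e mulrC.
Qed.

Section LinearDisjointness.
Variables (S U : comUnitRingType) (sS : {rmorphism S -> S}) (sU : {rmorphism U -> U}).
Variable f : {rmorphism S -> U}.
Hypothesis fs : forall x, sU (f x) = f (sS x).
Hypothesis simpleS : sigma_simple sS.

(* The possible leading coefficients of a linear relation over S between       *)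
(* constants form a sigma-stable ideal of S: a nontrivial relation can be made  *)
(* monic, and then its coefficients are constants.                              *)
Lemma free_constants r (c : 'I_r -> U) : (forall i, sU (c i) = c i) ->
  exists t (g : 'I_t -> U) (k : 'I_r -> 'I_t -> S),
    [/\ forall j, exists i, g j = c i, forall i j, sS (k i j) = k i j,
        forall i, c i = \sum_j f (k i j) * g j & free_over f g].
Proof.
elim: r c => [|r IH] c cc.
  exists 0%N, (fun=> 0), (fun _ _ => 0); split=> [[]//|[]//|[]//|d _ []//].
have [t [g [k [gc kc ck fg]]]] := IH (c \o lift ord0) (fun i => cc (lift ord0 i)).
have gcc j : sU (g j) = g j by have [i ->] := gc j; apply: cc.
pose I := [set a | exists d : 'I_t -> S, f a * c ord0 + \sum_j f (d j) * g j = 0].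
have [I0|] := pselect (forall a, I a -> a = 0).
  exists t.+1, (consf (c ord0) g), (fun i => consf
    (if unlift ord0 i is Some _ then 0 else 1)
    (fun j => if unlift ord0 i is Some l then k l j else 0)).
  split.
  - apply: ord_consP => [|j]; first by exists ord0; rewrite consf0.
    by have [i e] := gc j; exists (lift ord0 i); rewrite consfS e.
  - move=> i; apply: ord_consP => [|j]; rewrite ?consf0 ?consfS.
      by case: unliftP => *; rewrite ?rmorph0 ?rmorph1.
    by case: unliftP => [l _|_]; rewrite ?kc ?rmorph0.
  - apply: ord_consP => [|i]; rewrite big_ord_recl !consf0 ?unlift_none ?liftK.
      rewrite rmorph1 mul1r big1 ?addr0 // => j _.
      by rewrite !consfS rmorph0 mul0r.
    rewrite rmorph0 mul0r add0r [LHS]ck; apply: eq_bigr => j _.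
    by rewrite !consfS.
  - move=> d; rewrite big_ord_recl consf0.
    under eq_bigr => j _ do rewrite consfS.
    move=> e; have d0 : d ord0 = 0 by apply: I0; exists (d \o lift ord0).
    apply: ord_consP => // j; apply: (fg (d \o lift ord0)).
    by move: e; rewrite d0 rmorph0 mul0r add0r.
move=> /existsNP[a /not_implyP[Ia /eqP a0]].
have [|d] := simpleS _ Ia a0.
  split.
  - by exists (fun=> 0); rewrite rmorph0 mul0r add0r big1 // => j _ /=; rewrite ?rmorph0 mul0r.
  - move=> x y [d1 e1] [d2 e2]; exists (fun j => d1 j + d2 j).
    rewrite rmorphD mulrDl (eq_bigr (fun j => f (d1 j) * g j + f (d2 j) * g j)).
      by rewrite big_split /= addrACA e1 e2 addr0.
    by move=> j _; rewrite rmorphD mulrDl.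
  - move=> x y [d e]; exists (fun j => x * d j).
    rewrite rmorphM -mulrA (eq_bigr (fun j => f x * (f (d j) * g j))).
      by rewrite -mulr_sumr -mulrDr e mulr0.
    by move=> j _; rewrite rmorphM mulrA.
  - move=> x [d e]; exists (fun j => sS (d j)).
    transitivity (sU (f x * c ord0 + \sum_j f (d j) * g j)); last by rewrite e rmorph0.
    rewrite rmorphD rmorphM cc fs rmorph_sum; congr (_ + _).
    by apply: eq_bigr => j _; rewrite rmorphM fs gcc.
rewrite rmorph1 mul1r => e.
have dc j : sS (d j) = d j.
  apply/eqP; rewrite -subr_eq0; apply/eqP; apply: (fg (fun j => sS (d j) - d j)).
  have := congr1 sU e; rewrite rmorph0 rmorphD cc rmorph_sum => e2.
  have e' := addrI _ (etrans e2 (esym e)).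
  under eq_bigr => i _ do rewrite rmorphB mulrBl.
  rewrite sumrB -e'; apply/eqP; rewrite subr_eq0; apply/eqP.
  by apply: eq_bigr => i _; rewrite rmorphM fs gcc.
exists t, g, (consf (fun j => - d j) k); split=> //.
- by move=> j; have [i ->] := gc j; exists (lift ord0 i).
- by apply: ord_consP => [|i] j; rewrite ?consf0 ?consfS // rmorphN dc.
- apply: ord_consP => [|i]; rewrite ?consf0 ?consfS; last exact: (ck i).
  move/eqP: e; rewrite addr_eq0 => /eqP ->; rewrite -sumrN.
  by apply: eq_bigr => j _; rewrite rmorphN mulNr.
Qed.

Lemma regroup_constants r (a : 'I_r -> S) (c : 'I_r -> U) t (k : 'I_r -> 'I_t -> S) g :
  (forall i, c i = \sum_j f (k i j) * g j) ->
  \sum_i f (a i) * c i = \sum_j f (\sum_i a i * k i j) * g j.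
Proof.
move=> ck; under eq_bigr => i _ do rewrite ck mulr_sumr.
rewrite exchange_big; apply: eq_bigr => j _; rewrite rmorph_sum mulr_suml.
by apply: eq_bigr => i _; rewrite rmorphM mulrA.
Qed.

(** Once the constants are expanded along a family g free over S, applying tU acts only on the
    coefficients, so invariance of the sum is invariance of each coefficient. It is used with tU a
    power of sigma. *)
Lemma fixed_span (tS : S -> S) (tU : {rmorphism U -> U}) r (a : 'I_r -> S) (c : 'I_r -> U) :
  (forall x, tU (f x) = f (tS x)) -> (forall i, sU (c i) = c i) -> (forall i, tU (c i) = c i) ->
  tU (\sum_i f (a i) * c i) = \sum_i f (a i) * c i ->
  exists t (a' : 'I_t -> S) (g : 'I_t -> U), [/\ forall j, exists i, g j = c i,
    forall j, tS (a' j) = a' j & \sum_i f (a i) * c i = \sum_j f (a' j) * g j].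
Proof.
move=> ft cc tc; have [t [g [k [gc _ ck fg]]]] := free_constants cc.
rewrite (regroup_constants a ck) => e.
exists t, (fun j => \sum_i a i * k i j), g; split=> // j.
apply/eqP; rewrite -subr_eq0; apply/eqP.
apply: (fg (fun j => tS (\sum_i a i * k i j) - \sum_i a i * k i j)).
under eq_bigr => i _ do rewrite rmorphB mulrBl.
rewrite sumrB -e rmorph_sum; apply/eqP; rewrite subr_eq0; apply/eqP.
by apply: eq_bigr => i _; rewrite rmorphM ft; have [l ->] := gc i; rewrite tc.
Qed.

(** Expanding the coefficients c_i = sum_j k_ij g_j along a free family turns a relation over the
    constants of U into relations sum_i k_ij v_i = 0 over the constants of S. *)
Lemma free_over_constants (kS kU : fieldType) (iS : {rmorphism kS -> S})
    (iU : {rmorphism kU -> U}) r (v : 'I_r -> S) :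
  (forall x, sS x = x <-> exists a, x = iS a) ->
  (forall a, sU (iU a) = iU a) ->
  free_over iS v -> free_over iU (f \o v).
Proof.
move=> iSE iUc fv c e.
have [t [g [k [gc kc ck fg]]]] := free_constants (fun i => iUc (c i)).
have /choice[k' k'E] (p : 'I_r * 'I_t) : exists a, k p.1 p.2 = iS a by apply/iSE/kc.
move=> i; apply/eqP; rewrite -(fmorph_eq0 iU) ck; apply/eqP/big1 => j _.
rewrite (k'E (i, j)) (fv (fun i => k' (i, j))) ?rmorph0 ?mul0r // {i}.
under eq_bigr => i _ do rewrite -(k'E (i, j)) mulrC.
move: j; apply: fg; rewrite -[RHS]e -(regroup_constants v ck).
by apply: eq_bigr => i _; rewrite /= mulrC.
Qed.

(* A nonzero element of J with the fewest terms can be given the leading        *)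
(* coefficient 1; subtracting its image under sigma then makes it shorter.      *)
Lemma stable_contains1 (J : set U) :
  (forall c, sU c = c -> c != 0 -> exists2 d, sU d = d & d * c = 1) ->
  (forall x y, J x -> J y -> J (x + y)) -> (forall a x, J x -> J (f a * x)) ->
  (forall c x, sU c = c -> J x -> J (c * x)) -> (forall x, J x -> J (sU x)) ->
  forall r (a : 'I_r -> S) (c : 'I_r -> U), (forall i, sU (c i) = c i) ->
  J (\sum_i f (a i) * c i) -> \sum_i f (a i) * c i != 0 -> J 1.
Proof.
move=> inv JD JS JC Js; elim=> [|r IH] a c cc; first by rewrite big_ord0 eqxx.
have J0 x : J x -> J 0 by move=> Jx; rewrite -(mul0r x) -(rmorph0 f); apply: JS.
have JN x : J x -> J (- x).
  by move=> Jx; rewrite -mulN1r -(rmorph1 f) -rmorphN; apply: JS.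
set u := \sum_i _ => Ju u0.
have [a0|a0] := eqVneq (a ord0) 0.
  have uE : u = \sum_i f (a (lift ord0 i)) * c (lift ord0 i).
    by rewrite /u big_ord_recl a0 rmorph0 mul0r add0r.
  by apply: (IH (a \o lift ord0) (c \o lift ord0)); rewrite -?uE //= => i; apply: cc.
pose I := [set x | exists d : 'I_r -> S, J (f x * c ord0 + \sum_i f (d i) * c (lift ord0 i))].
have Ia : I (a ord0) by exists (a \o lift ord0); rewrite /u big_ord_recl in Ju.
have [|d] := simpleS _ Ia a0.
  split.
  - exists (fun=> 0); rewrite rmorph0 mul0r add0r big1; first exact: J0 Ju.
    by move=> j _ /=; rewrite ?rmorph0 mul0r.
  - move=> x y [d1 e1] [d2 e2]; exists (fun j => d1 j + d2 j).
    rewrite rmorphD mulrDl (eq_bigr (fun j => f (d1 j) * c (lift ord0 j) + f (d2 j) * c (lift ord0 j))).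
      by rewrite big_split /= addrACA; apply: JD.
    by move=> j _; rewrite rmorphD mulrDl.
  - move=> x y [d e]; exists (fun j => x * d j).
    rewrite rmorphM -mulrA (eq_bigr (fun j => f x * (f (d j) * c (lift ord0 j)))).
      by rewrite -mulr_sumr -mulrDr; apply: JS.
    by move=> j _; rewrite rmorphM mulrA.
  - move=> x [d e]; exists (fun j => sS (d j)); have := Js _ e.
    rewrite rmorphD rmorphM cc fs rmorph_sum.
    by under eq_bigr => j _ do rewrite rmorphM fs cc.
rewrite rmorph1 mul1r; set w := _ + _ => Jw.
have [w0|w0] := eqVneq w 0.
  have uE : u = \sum_i f (a (lift ord0 i) - a ord0 * d i) * c (lift ord0 i).
    have c0 : c ord0 = - \sum_i f (d i) * c (lift ord0 i).
      by apply/eqP; rewrite -addr_eq0 -/w w0.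
    rewrite /u big_ord_recl c0 mulrN addrC mulr_sumr -sumrB; apply: eq_bigr => i _.
    by rewrite rmorphB mulrBl rmorphM mulrA.
  by apply: (IH (fun i => a (lift ord0 i) - a ord0 * d i) (c \o lift ord0));
    rewrite -?uE //= => i; apply: cc.
have wE : sU w - w = \sum_i f (sS (d i) - d i) * c (lift ord0 i).
  rewrite /w rmorphD cc opprD addrACA subrr add0r rmorph_sum -sumrB.
  by apply: eq_bigr => i _; rewrite rmorphM fs cc rmorphB mulrBl.
have [cw|nw] := eqVneq (sU w - w) 0.
  have {}cw : sU w = w by apply/eqP; rewrite -subr_eq0 cw.
  by have [e ec <-] := inv w cw w0; apply: JC.
apply: (IH (fun i => sS (d i) - d i) (c \o lift ord0)
  (fun i => cc (lift ord0 i))); rewrite -wE //.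
by apply: JD; [exact: Js|exact: JN].
Qed.

End LinearDisjointness.

Section ConstantExtension.
Variables (Q M : fieldType) (tQ : {rmorphism Q -> Q}) (tM : {rmorphism M -> M}).
Variable f : {rmorphism Q -> M}.
Hypothesis ft : forall x, tM (f x) = f (tQ x).

(** New constants create no algebraic dependence. A relation for f x over E and C is expanded as
    sum_j g_j b_j with the g_j constants free over Q and the b_j in E[X]; freeness gives b_j(x) = 0
    for every j, and some b_j is nonzero. *)
Lemma acl_constants (E : set Q) (C : set M) x : subring E ->
  (forall y, tQ y = y -> E y) -> subring C -> (forall c, C c -> tM c = c) ->
  acl (f @` E `|` C) (f x) -> acl E x.
Proof.
move=> SE QE SC Cc [p p0 [Sp px]].
have [r [a [c [Ea Cci pE]]]] : exists r (a : 'I_r -> {poly Q}) (c : 'I_r -> M),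
    [/\ forall i, poly_over E (a i), forall i, C (c i) &
        p = \sum_i c i *: map_poly f (a i)].
  elim/poly_ind: p Sp {p0 px} => [_|p e IH Sp].
    exists 0%N, (fun=> 0), (fun=> 0); by split=> [[]//|[]//|]; rewrite big_ord0.
  have [i|r [a [c [Ea Cci pE]]]] := IH.
    by have := Sp i.+1; rewrite coefD coefMX coefC /= addr0.
  have : subring_gen (f @` E `|` C) e.
    by have := Sp 0%N; rewrite coefD coefMX coefC /= add0r.
  move=> /(span_products (subring_image f SE) SC)[r' [a' [c' [Ea' Cc' eE]]]].
  have /choice[a'' a''E] i : exists y, E y /\ f y = a' i by have [y] := Ea' i; exists y.
  exists (r + r')%N, (fun i => match split i with inl k => a k * 'X | inr k => (a'' k)%:P end),
    (fun i => match split i with inl k => c k | inr k => c' k end); split.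
  - move=> i; case: splitP => k _.
      by apply: poly_overM => //; apply: poly_overX.
    by apply: poly_overC => //; case: (a''E k).
  - by move=> i; case: splitP.
  rewrite big_split_ord /=; congr (_ + _).
    rewrite pE mulr_suml; apply: eq_bigr => i _.
    rewrite -[lshift _ _]/(unsplit (inl i)) unsplitK.
    by rewrite rmorphM /= map_polyX scalerAl.
  rewrite eE rmorph_sum; apply: eq_bigr => i _.
  rewrite -[rshift _ _]/(unsplit (inr i)) unsplitK map_polyC /=.
  by case: (a''E i) => _ ->; rewrite -mul_polyC -polyCM mulrC.
have [t [g [k [gc kc ck fg]]]] := free_constants ft (@field_sigma_simple _ tQ)
  (fun i => Cc _ (Cci i)).
pose b j := \sum_i k i j *: a i.
have Eb j : poly_over E (b j).
  move=> i; rewrite coef_sum; apply: (subring_sum SE) => l _.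
  by rewrite coefZ; apply: (subringM SE); [apply: QE|apply: Ea].
have pb : p = \sum_j g j *: map_poly f (b j).
  rewrite pE (eq_bigr (fun i => \sum_j g j *: map_poly f (k i j *: a i))).
    rewrite exchange_big; apply: eq_bigr => j _.
    by rewrite rmorph_sum scaler_sumr.
  move=> i _; rewrite ck scaler_suml; apply: eq_bigr => j _.
  by rewrite map_polyZ scalerA mulrC.
have bx j : (b j).[x] = 0.
  apply: (fg (fun j => (b j).[x])); rewrite -[RHS](rootP px) pb horner_sum.
  by apply: eq_bigr => i _; rewrite hornerZ horner_map mulrC.
have [j bj] : exists j, b j != 0.
  apply: contrapT => /forallNP nb; move: p0; rewrite pb big1 ?eqxx // => j _.
  by move: (nb j) => /negP; rewrite negbK => /eqP ->; rewrite rmorph0 scaler0.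
exists (b j) => //; split; last exact/rootP.
by move=> i; apply: sub_subring_gen; apply: Eb.
Qed.
End ConstantExtension.

(** * Decomposition into domains *)

Section Components.
Variables (R : comUnitRingType) (s : {rmorphism R -> R}).
Hypotheses (s_bij : bijective s) (simple : sigma_simple s).
Implicit Types (P I : set R).

Lemma iterM N i x : iter i s (iter N s x) = iter N s (iter i s x).
Proof. by rewrite -!iterD addnC. Qed.

Lemma iter_surj i x : exists y, iter i s y = x.
Proof.
have [t _ tK] := s_bij; exists (iter i t x).
by elim: i => //= i IH; rewrite -iterS iterSr tK IH.
Qed.

Lemma iter_morph i : [/\ forall x y, iter i s (x - y) = iter i s x - iter i s y,
  forall x y, iter i s (x * y) = iter i s x * iter i s y, iter i s 1 = 1 & iter i s 0 = 0].
Proof.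
have [f fE] := iter_rmorphism s i.
split=> [x y|x y||]; rewrite -!fE; [exact: rmorphB|exact: rmorphM|exact: rmorph1|exact: rmorph0].
Qed.

Lemma iterN_prime N P k x : (forall x, P (iter N s x) <-> P x) -> P (iter (k * N) s x) <-> P x.
Proof. by move=> Ps; elim: k => //= k IH; rewrite mulSn iterD Ps. Qed.

(** The elements whose first N iterates lie in I form a sigma-stable ideal: the N-th iterate returns
    to I because I is stable under sigma^N. It does not contain 1, so it is 0. *)
Lemma orbit_zero I N x : (0 < N)%N -> stable_ideal (iter N s) I -> ~ I 1 ->
  (forall i, (i < N)%N -> I (iter i s x)) -> x = 0.
Proof.
move=> N0 [I0 ID IM Is] I1 Ix; apply/eqP; apply: contra_notT I1 => x0.
have /(_ _)/(_ N0) : [set x | forall i, (i < N)%N -> I (iter i s x)] 1; last by [].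
apply: simple x0 => //; split=> /=.
- by move=> i _; have [_ _ _ ->] := iter_morph i.
- move=> y z Iy Iz i iN; have [f fE] := iter_rmorphism s i.
  by rewrite -fE rmorphD !fE; apply: ID; [apply: Iy|apply: Iz].
- by move=> a y Iy i iN; have [_ -> _ _] := iter_morph i; apply/IM/Iy.
- move=> y Iy i; rewrite leq_eqVlt => /orP[/eqP iN|iN]; rewrite -iterSr; last exact: Iy.
  by rewrite iN; apply/Is/(Iy 0%N).
Qed.

(** The preimages of I under sigma^i, i < N, intersect in 0, so one of them lies in the prime P,
    hence in I. Iterating N times, the preimage of I under sigma^(N i) lies in P, and sigma^(N i)
    preserves P. *)
Lemma prime_maximal N P I : (0 < N)%N -> is_prime P -> (forall x, P (iter N s x) <-> P x) ->
  stable_ideal (iter N s) I -> P `<=` I -> ~ I 1 -> I `<=` P.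
Proof.
move=> N0 Pp Ps Is PI I1.
have [i iN iP] : exists2 i, (i < N)%N & forall x, I (iter i s x) -> P x.
  apply: contrapT => nex.
  have /choice[w wP] (i : 'I_N) : exists x, I (iter i s x) /\ ~ P x.
    apply: contrapT => /forallNP nx; apply: nex; exists i => // x Ix.
    by apply: contrapT => nPx; apply: (nx x).
  have [[P0 _ _ _] _ _] := Pp.
  have /(prime_prod Pp)[i _] : P (\prod_i w i); last by case: (wP i).
  rewrite (_ : \prod_i w i = 0) //; apply: (orbit_zero N0 Is I1) => i iN.
  rewrite (bigD1 (Ordinal iN)) //=; have [_ -> _ _] := iter_morph i.
  by rewrite mulrC; case: Is => _ _ IM _; apply: IM; case: (wP (Ordinal iN)).
have ikP k y : I (iter (k.+1 * i) s y) -> P y.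
  elim: k => [|k IH]; first by rewrite mul1n; apply: iP.
  by rewrite mulSn iterD => /iP/PI; apply: IH.
move=> x Ix; have [y yx] := iter_surj (N * i) x.
rewrite -yx mulnC; apply/(iterN_prime _ _ Ps); apply: (ikP N.-1).
by rewrite prednK // yx.
Qed.

(** The denominators of an element fixed by sigma^N form a sigma^N-stable ideal strictly larger than
    P, so 1 is a denominator. *)
Lemma fixed_in_component N P (Q : fieldType) (phi : {rmorphism R -> Q})
    (t : {rmorphism Q -> Q}) x :
  (0 < N)%N -> is_prime P -> (forall x, P (iter N s x) <-> P x) ->
  (forall x, phi x = 0 <-> P x) -> (forall q, exists a b, phi b != 0 /\ q = phi a / phi b) ->
  (forall x, t (phi x) = phi (iter N s x)) -> t x = x -> exists r, x = phi r.
Proof.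
move=> N0 Pp Ps phiP phiQ tphi tx.
pose J := [set a | exists r, phi a * x = phi r].
have [a [b [b0 xE]]] := phiQ x.
have Jb : J b by exists a; rewrite xE mulrC divfK.
have Js : stable_ideal (iter N s) J.
  split.
  - by exists 0; rewrite !rmorph0 mul0r.
  - by move=> y z [r e] [r' e']; exists (r + r'); rewrite !rmorphD mulrDl e e'.
  - by move=> c y [r e]; exists (c * r); rewrite !rmorphM -mulrA e.
  - by move=> y [r e]; exists (iter N s r); rewrite -!tphi -e rmorphM tx.
have [[r]|J1] := pselect (J 1); first by rewrite rmorph1 mul1r; exists r.
have /phiP e : P b; last by rewrite e eqxx in b0.
apply: (prime_maximal N0 Pp Ps Js) => // y /phiP y0.
by exists 0; rewrite y0 mul0r rmorph0.
Qed.

(** For a transcendental fixed x, some x - k has no inverse in the image of R; but its inverse in Q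
    is again fixed, hence lies in that image. *)
Lemma fixed_algebraic (K : fieldType) (iota : {rmorphism K -> R}) (gens : seq R)
    N P (Q : fieldType) (phi : {rmorphism R -> Q}) (t : {rmorphism Q -> Q}) x :
  (forall x, subring_gen (range iota `|` [set` gens]) x) -> char0 K ->
  (0 < N)%N -> is_prime P -> (forall x, P (iter N s x) <-> P x) ->
  (forall x, phi x = 0 <-> P x) -> (forall q, exists a b, phi b != 0 /\ q = phi a / phi b) ->
  (forall x, t (phi x) = phi (iter N s x)) -> t x = x -> acl (range (phi \o iota)) x.
Proof.
move=> gensP ch0 N0 Pp Ps phiP phiQ tphi tx; apply: contrapT => nx.
have [k nu] := nonunit_specialization [seq phi r | r <- gens] (rmorph_char0 (phi \o iota) ch0) nx.
have u0 : x - k%:R != 0.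
  apply: contra_notN nx; rewrite subr_eq0 => /eqP ->.
  exact: (subring_nat (acl_subring _)).
have [r rE] : exists r, (x - k%:R)^-1 = phi r.
  apply: (fixed_in_component N0 Pp Ps phiP phiQ tphi).
  by rewrite fmorphV rmorphB tx rmorph_nat.
apply: (nu (phi r)); last by rewrite -rE divff.
by rewrite range_comp_image subring_gen_image; exists r.
Qed.

(** Take the least l with P stable under sigma^l. Different translates of P are comaximal: otherwise
    [prime_maximal] puts a translate inside P, against the minimality of l. As the translates
    intersect in 0, the Chinese remainder argument gives e0, which is 1 modulo P and 0 modulo the
    other translates; its annihilator is P. *)
Lemma component_decomposition N P : (0 < N)%N -> is_prime P ->
  (forall x, P (iter N s x) <-> P x) ->
  exists l e0, [/\ (0 < l)%N, forall x, P (iter l s x) <-> P x,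
    forall x, e0 * x = 0 <-> P x & idempotent_decomposition s l e0].
Proof.
move=> N0 Pp PN.
have exl : exists l, `[< (0 < l)%N /\ forall x, P (iter l s x) <-> P x >].
  by exists N; apply/asboolP.
case: (ex_minnP exl) => l /asboolP[l0 Pl] minl.
have {}minl i : (0 < i < l)%N -> ~ (forall x, P (iter i s x) <-> P x).
  move=> /andP[i0 il] Pi; have : (l <= i)%N by apply: minl; apply/asboolP.
  by rewrite leqNgt il.
have [Q [phi [phiE _]]] := residue_field Pp.
have [Psi P1 PM] := Pp; have [P0 PD PMl _] := Psi.
have Psl : stable_ideal (iter l s) P by split=> // x Px; apply/Pl.
have zero x : (forall i, (i < l)%N -> P (iter i s x)) -> x = 0.
  exact: (orbit_zero l0 Psl P1).
have comax i : (0 < i < l)%N -> exists j, P (1 - j) /\ P (iter i s j).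
  move=> il; have [i0 il'] := andP il.
  pose I := [set x | exists p q, [/\ P p, P (iter i s q) & x = p + q]].
  have PI : P `<=` I.
    by move=> p Pp'; exists p, 0; rewrite addr0; have [_ _ _ ->] := iter_morph i.
  have Is : stable_ideal (iter l s) I.
    have [f fE] := iter_rmorphism s i; have [g gE] := iter_rmorphism s l; split.
    - exact: PI.
    - move=> _ _ [p [q [pP qP ->]]] [p' [q' [pP' qP' ->]]]; exists (p + p'), (q + q').
      split; [exact: PD|rewrite -fE rmorphD !fE; exact: PD|by rewrite addrACA].
    - move=> a _ [p [q [pP qP ->]]]; exists (a * p), (a * q).
      split; [exact: PMl|rewrite -fE rmorphM !fE; exact: PMl|by rewrite mulrDr].
    - move=> _ [p [q [pP qP ->]]]; exists (iter l s p), (iter l s q).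
      split; [exact/Pl|by rewrite iterM Pl|by rewrite -gE rmorphD !gE].
  have [[p [q [pP qP e]]]|I1] := pselect (I 1); first by exists q; rewrite e addrK.
  have iP x : P (iter i s x) -> P x.
    move=> ix; apply: (prime_maximal l0 Pp Pl Is PI I1).
    by exists 0, x; rewrite add0r.
  case: (minl i il) => x; split=> [|Px]; first exact: iP.
  (* The inclusion of the translate in P is an equality: composing it l times gives sigma^(l i),
     under which P is stable. *)
  have ikP k y : P (iter (k * i) s y) -> P y.
    by elim: k => // k IH; rewrite mulSn iterD => /iP.
  apply: (ikP l.-1); rewrite -iterD addnC -mulSn prednK // mulnC.
  exact/(iterN_prime _ _ Pl).
have /choice[j jP] (i : 'I_l) : exists j, P (1 - j) /\ ((0 < i)%N -> P (iter i s j)).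
  have [i0|i0] := posnP i; first by exists 1; rewrite subrr.
  by have [|j [Pj1 Pj]] := comax i; [rewrite i0 ltn_ord|exists j].
pose e0 := \prod_i j i.
have phie : phi e0 = 1.
  rewrite rmorph_prod big1 // => i _; have [/phiE] := jP i.
  by rewrite rmorphB rmorph1 => /eqP; rewrite subr_eq0 => /eqP.
have eP i : (0 < i < l)%N -> P (iter i s e0).
  move=> /andP[i0 il]; rewrite /e0 (bigD1 (Ordinal il)) //=.
  have [_ -> _ _] := iter_morph i; rewrite mulrC; apply: PMl.
  by case: (jP (Ordinal il)) => _; apply.
have eE x : e0 * x = 0 <-> P x.
  split=> [e|Px]; first by apply/phiE; rewrite -[phi x]mul1r -phie -rmorphM e rmorph0.
  apply: zero => i il; have [->|i0] := posnP i; first exact: PMl.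
  have [_ -> _ _] := iter_morph i.
  by rewrite mulrC; apply: PMl; apply: eP; rewrite i0.
have ee : e0 * e0 = e0.
  apply/eqP; rewrite -subr_eq0 -{3}[e0]mulr1 -mulrBr; apply/eqP/eE/phiE.
  by rewrite rmorphB phie rmorph1 subrr.
have el : iter l s e0 = e0.
  apply/eqP; rewrite -subr_eq0; apply/eqP/zero => i il.
  have [-> _ _ _] := iter_morph i; have [->|i0] := posnP i.
    have : P (iter l s (1 - e0)) by apply/Pl/phiE; rewrite rmorphB phie rmorph1 subrr.
    have [-> _ -> _] := iter_morph l => /phiE; rewrite rmorphB rmorph1 => h.
    by apply/phiE; rewrite rmorphB phie -opprB h oppr0.
  apply: (stable_idealB Psi); last by apply: eP; rewrite i0.
  by rewrite iterM; apply/Pl/eP; rewrite i0.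
have e00 : e0 != 0 by apply/eqP => e; move/eqP: phie; rewrite e rmorph0 eq_sym oner_eq0.
have iter0 i x : iter i s x = 0 -> x = 0.
  by elim: i => //= i IH e; apply: IH; apply: (bij_inj s_bij); rewrite e rmorph0.
have orth i k : (i < k)%N -> (k < l)%N -> iter i s e0 * iter k s e0 = 0.
  move=> ik kl; rewrite -(subnKC (ltnW ik)) iterD.
  have [_ <- _ _] := iter_morph i.
  rewrite (eE _).2; first by case: (iter_morph i).
  by apply: eP; rewrite subn_gt0 ik (leq_ltn_trans (leq_subr _ _) kl).
have orthn (i k : 'I_l) : i != k -> iter i s e0 * iter k s e0 = 0.
  rewrite -val_eqE /= neq_ltn => /orP[ik|ki]; first exact: orth.
  by rewrite mulrC; apply: orth.
have ei0 i : iter i s e0 != 0 by apply: contra e00 => /eqP/iter0 ->.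
have idem i : iter i s e0 * iter i s e0 = iter i s e0.
  by have [_ <- _ _] := iter_morph i; rewrite ee.
(* The difference 1 - sum is fixed by sigma and lies in P, hence in all translates of P. *)
have sum1 : \sum_(i < l) iter i s e0 = 1.
  pose x := 1 - \sum_(i < l) iter i s e0.
  have sx : s x = x.
    rewrite rmorphB rmorph1; congr (_ - _); rewrite rmorph_sum.
    case: (l) l0 el => // l' _ el'; rewrite [LHS]big_ord_recr [RHS]big_ord_recl /=.
    by rewrite -iterS el' addrC.
  apply/eqP; rewrite eq_sym -subr_eq0 -/x; apply/eqP/zero => i il.
  rewrite iter_fix //; apply/phiE; rewrite rmorphB rmorph1 rmorph_sum.
  rewrite (bigD1 (Ordinal l0)) //= phie big1 ?addr0 ?subrr // => k k0.
  by apply/phiE/eP; rewrite ltn_ord andbT lt0n -val_eqE /= in k0 *.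
have dom (i : 'I_l) x y : iter i s e0 * x * y = 0 ->
    iter i s e0 * x = 0 \/ iter i s e0 * y = 0.
  have [x' <-] := iter_surj i x; have [y' <-] := iter_surj i y.
  have [_ m _ z] := iter_morph i; rewrite -!m => /iter0; rewrite -mulrA.
  by move=> /eE/PM[] /eE ->; rewrite z; [left|right].
exists l, e0; split=> //; split=> //; first split.
- move=> i k /= eik; apply/eqP; apply: contraT => /orthn; rewrite -eik idem => /eqP.
  by rewrite (negPf (ei0 _)).
(* A primitive x has x e != 0 for some component e. Primitivity of x gives x = x e, and e R being a
   domain gives e = e x. *)
- move=> x; split=> [[x0 xx xprim]|[i ->]].
    have [i xi] : exists i : 'I_l, x * iter i s e0 != 0.
      apply: contrapT => /forallNP nx; move: x0; rewrite -[x]mulr1 -sum1 mulr_sumr big1 ?eqxx //.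
      by move=> i _; apply/eqP; move: (nx i) => /negP; rewrite negbK.
    exists i; set e := iter i s e0 in xi *.
    have [xe0|x1] : x * e = 0 \/ x * (1 - e) = 0.
    + apply: xprim.
      * by rewrite mulrACA xx idem.
      * rewrite mulrACA xx; congr (_ * _).
        by rewrite mulrBl mul1r mulrBr mulr1 idem subrr subr0.
      * by rewrite mulrACA mulrBr mulr1 idem subrr mulr0.
      * by rewrite -mulrDr addrC subrK mulr1.
    + by rewrite xe0 eqxx in xi.
    have {}x1 : x = x * e by move/eqP: x1; rewrite mulrBr mulr1 subr_eq0 => /eqP.
    have [ex|ex] : e * x = 0 \/ e * (1 - x) = 0.
    + by apply: dom; rewrite -mulrA mulrBr mulr1 xx subrr mulr0.
    + by rewrite mulrC ex eqxx in xi.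
    by move/eqP: ex; rewrite mulrBr mulr1 subr_eq0 mulrC -x1 => /eqP.
  split=> // f g ff gg fg e.
  have ef : iter i s e0 * f = f by rewrite e mulrDl ff [g * f]mulrC fg addr0.
  have eg : iter i s e0 * g = g by rewrite e mulrDl gg fg add0r.
  have [] := dom i f g; first by rewrite -mulrA fg mulr0.
    by rewrite ef; left.
  by rewrite eg; right.
- by move=> i /=; rewrite -(iterM l i) el.
Qed.

End Components.

(** * The compositum U *)

(** A K-subspace of L maximal among those avoiding 1 is a complement of K; t is the projection along
    it. It yields the form that shows L and R to have a nonzero tensor product over K. *)
Lemma linear_retraction (K L : fieldType) (j : {rmorphism K -> L}) :
  exists t : {additive L -> K}, (forall a x, t (j a * x) = a * t x) /\ t 1 = 1.
Proof.
pose sub (V : set L) := [/\ forall x y, V x -> V y -> V (x + y),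
  forall a x, V x -> V (j a * x) & ~ V 1].
have [||V [[VD VM V1] V0 maxV]] := @zorn_above L sub [set 0].
- split=> [x y -> ->|a x ->|/eqP]; rewrite ?addr0 ?mulr0 //.
  by rewrite oner_eq0.
- move=> F Fsub Ftot [X0 FX0]; split.
  + move=> x y [X FX Xx] [Z FZ Zy]; have [XZ|ZX] := Ftot _ _ FX FZ.
      by exists Z => //; case: (Fsub _ FZ) => ZD _ _; apply: ZD => //; apply: XZ.
    by exists X => //; case: (Fsub _ FX) => XD _ _; apply: XD => //; apply: ZX.
  + by move=> a x [X FX Xx]; exists X => //; case: (Fsub _ FX) => _ XM _; apply: XM.
  + by case=> X FX; case: (Fsub _ FX).
have {}V0 : V 0 by apply: V0.
have VN x : V x -> V (- x) by move=> Vx; rewrite -mulN1r -(rmorph1 j) -rmorphN; apply: VM.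
have VB x y : V x -> V y -> V (x - y) by move=> Vx Vy; apply: VD => //; apply: VN.
have uniq a b x : V (x - j a) -> V (x - j b) -> a = b.
  move=> Va Vb; apply/eqP; rewrite -subr_eq0; apply: contra_notT V1 => ab.
  have : V (j (a - b)).
    have -> : j (a - b) = (x - j b) - (x - j a) by ring.
    exact: VB.
  by move=> /(VM (a - b)^-1); rewrite -rmorphM mulVf ?rmorph1.
have /choice[t tP] x : exists a, V (x - j a).
  have [Vx|nVx] := pselect (V x); first by exists 0; rewrite rmorph0 subr0.
  pose W := [set y | exists v a, V v /\ y = v + j a * x].
  have VW : V `<=` W by move=> v Vv; exists v, 0; rewrite rmorph0 mul0r addr0.
  have [v [a [Vv e]]] : W 1.
    apply: contrapT => W1; apply: nVx; apply: (maxV W) => //; last first.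
      by exists 0, 1; rewrite rmorph1 mul1r add0r.
    split=> // [_ _ [v [a [Vv ->]]] [v' [a' [Vv' ->]]]|b _ [v [a [Vv ->]]]].
      by exists (v + v'), (a + a'); rewrite rmorphD mulrDl addrACA; split=> //; apply: VD.
    by exists (j b * v), (b * a); rewrite rmorphM mulrDr mulrA; split=> //; apply: VM.
  have a0 : a != 0.
    by apply: contra_notN V1 => /eqP a0; rewrite e a0 rmorph0 mul0r addr0.
  exists a^-1; have -> : x - j a^-1 = - (j a^-1 * v).
    have -> : v = 1 - j a * x by rewrite e addrK.
    by rewrite mulrBr mulr1 mulrA -rmorphM mulVf // rmorph1 mul1r opprB.
  by apply/VN/VM.
have tD : zmod_morphism t.
  move=> x y; apply: (uniq _ _ (x - y)) => //.
  have -> : x - y - j (t x - t y) = (x - j (t x)) - (y - j (t y)) by ring.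
  exact: VB.
pose t' : {additive L -> K} := HB.pack t (GRing.isZmodMorphism.Build _ _ t tD).
exists t'; split=> [a x|] /=.
  by apply: (uniq _ _ (j a * x)) => //; rewrite rmorphM -mulrBr; apply: VM.
by apply: (uniq _ _ 1) => //; rewrite rmorph1 subrr.
Qed.

Lemma mpoly_rmorphism_ext (K : comNzRingType) n (S : comNzRingType) (g h : {rmorphism {mpoly K[n]} -> S}) :
  (forall c, g c%:MP = h c%:MP) -> (forall i, g 'X_i = h 'X_i) -> g =1 h.
Proof.
move=> ghC ghX p; rewrite (mpolyE p) !rmorph_sum; apply: eq_bigr => m _.
rewrite -mul_mpolyC !rmorphM ghC mpolyXE_id !rmorph_prod; congr (_ * _).
by apply: eq_bigr => i _; rewrite !rmorphXn ghX.
Qed.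

Lemma mmap_rmorphism (K S : comNzRingType) n (f : {rmorphism K -> S}) (h : 'I_n -> S) :
  exists g : {rmorphism {mpoly K[n]} -> S}, (forall c, g c%:MP = f c) /\ (forall i, g 'X_i = h i).
Proof.
exists (mmap f h : {rmorphism {mpoly K[n]} -> S}); split=> [c|i].
  exact: mmapC.
by rewrite /= mmapX mmap1U.
Qed.

Lemma bijective_of (T T' : Type) (f : T -> T') : injective f -> (forall y, exists x, f x = y) ->
  bijective f.
Proof.
move=> fI fS; pose g y := projT1 (cid (fS y)).
have gK y : f (g y) = y by exact: projT2 (cid (fS y)).
by exists g => // x; apply: fI; rewrite gK.
Qed.

Section Compositum.
Variables (K L : fieldType) (R : comUnitRingType).
Variables (sK : {rmorphism K -> K}) (sL : {rmorphism L -> L}) (sR : {rmorphism R -> R}).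
Hypotheses (sK_bij : bijective sK) (sL_bij : bijective sL) (sR_bij : bijective sR).
Variables (j : {rmorphism K -> L}) (iota : {rmorphism K -> R}) (gens : seq R).
Hypothesis js : forall a, sL (j a) = j (sK a).
Hypothesis iotas : forall a, sR (iota a) = iota (sK a).
Hypothesis gensP : forall x, subring_gen (range iota `|` [set` gens]) x.

(* U is a simple quotient of the tensor product of L and R over K, presented as *)
(* a quotient of a polynomial ring over L.  The ideal I0 is the kernel of       *)
(* L[X] -> L (x) R: p lies in it iff every K-linear form on L, applied to the   *)
(* coefficients of p, sends p to a relation between the generators of R.        *)
Lemma difference_compositum : exists (U : comUnitRingType) (sU : {rmorphism U -> U})
    (jL : {rmorphism L -> U}) (jR : {rmorphism R -> U}),
  [/\ bijective sU /\ sigma_simple sU, forall x, sU (jL x) = jL (sL x),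
      forall x, sU (jR x) = jR (sR x), forall a, jL (j a) = jR (iota a)
    & forall u, subring_gen (range jL `|` range jR) u].
Proof.
pose N := size gens.
have [eps [epsC epsX]] := mmap_rmorphism iota (fun i : 'I_N => gens`_i).
have epsS r : exists p, r = eps p.
  suff : range eps r by move=> [p _ <-]; exists p.
  have := gensP r; move: r; apply: subring_gen_sub; first exact: subring_range.
  move=> r [[a _ <-]|/(nthP 0)[i iN <-]]; first by exists a%:MP.
  by exists 'X_(Ordinal iN).
have [lam [lamC lamX]] := mmap_rmorphism ((@mpolyC N L) \o j) (fun i : 'I_N => 'X_i).
(* T lifts the images under sigma of the generators to polynomials. Through it sigma lifts to [sA]
   on K[X] and to [sB] on L[X]. *)
have /choice[T TE] (i : 'I_N) : exists p, sR gens`_i = eps p by apply: epsS.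
have [sA [sAC sAX]] := mmap_rmorphism ((@mpolyC N K) \o sK) T.
have [sB [sBC sBX]] := mmap_rmorphism ((@mpolyC N L) \o sL) (lam \o T).
have epss p : eps (sA p) = sR (eps p).
  apply: (mpoly_rmorphism_ext (g := eps \o sA) (h := sR \o eps)) => [c|i] /=.
    by rewrite sAC /= !epsC iotas.
  by rewrite sAX epsX TE.
have lams p : lam (sA p) = sB (lam p).
  apply: (mpoly_rmorphism_ext (g := lam \o sA) (h := sB \o lam)) => [c|i] /=.
    by rewrite sAC /= !lamC sBC /= js.
  by rewrite sAX lamX sBX.
have lamE p : lam p = map_mpoly j p.
  apply: (mpoly_rmorphism_ext (h := map_mpoly j)) => [c|i] /=.
    by rewrite lamC map_mpolyC.
  by rewrite lamX map_mpolyX.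
pose lin (t : {additive L -> K}) := forall a x, t (j a * x) = a * t x.
have mapZ (t : {additive L -> K}) (c : L) (p : {mpoly K[N]}) : lin t ->
    map_mpoly t (c *: lam p) = t c *: p.
  move=> tl; apply/mpolyP => m; rewrite mcoeff_map_mpoly !mcoeffZ lamE mcoeff_map_mpoly.
  by rewrite mulrC tl mulrC.
have decomp (x : {mpoly L[N]}) : x = \sum_(m <- msupp x) x@_m *: lam 'X_[m].
  by rewrite {1}(mpolyE x); apply: eq_bigr => m _; rewrite lamE map_mpolyX.
have mapM (t : {additive L -> K}) p x : lin t ->
    map_mpoly t (lam p * x) = p * map_mpoly t x.
  move=> tl; rewrite (decomp x) mulr_sumr !raddf_sum mulr_sumr.
  apply: eq_bigr => m _; rewrite -scalerAr -rmorphM /= !mapZ //.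
  by rewrite scalerAr.
pose I0 : set {mpoly L[N]} := [set x | forall t : {additive L -> K}, lin t ->
  eps (map_mpoly t x) = 0].
have I0s : stable_ideal sB I0.
  split=> /=.
  - by move=> t _; rewrite !raddf0.
  - by move=> x y Ix Iy t tl; rewrite !raddfD /= Ix // Iy // addr0.
  - move=> b x Ix t tl; rewrite (decomp b) mulr_suml (raddf_sum (map_mpoly t)) rmorph_sum big1 // => m _.
    (* Multiplication by a scalar of L is absorbed into the linear form. *)
    pose t' c := t (b@_m * c).
    have tD : zmod_morphism t' by move=> u v; rewrite /t' mulrBr raddfB.
    pose t'' : {additive L -> K} := HB.pack t' (GRing.isZmodMorphism.Build _ _ t' tD).
    have tl'' : lin t'' by move=> a y; rewrite /= /t' mulrCA tl.
    have e : map_mpoly t (b@_m *: lam 'X_[m] * x) = map_mpoly t'' (lam 'X_[m] * x).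
      by apply/mpolyP => k; rewrite !mcoeff_map_mpoly -scalerAl mcoeffZ.
    by apply: (etrans (congr1 eps e)); rewrite mapM // rmorphM Ix // mulr0.
  - move=> x Ix t tl; have [sK' sKK' sK'K] := sK_bij.
    (* Twisting a form by sigma on both sides gives a form that is again K-linear. *)
    pose t' c := sK' (t (sL c)).
    have tD : zmod_morphism t'.
      by move=> u v; apply: (can_inj sKK'); rewrite rmorphB /t' !sK'K !raddfB.
    pose t'' : {additive L -> K} := HB.pack t' (GRing.isZmodMorphism.Build _ _ t' tD).
    have tl'' : lin t''.
      by move=> a y; apply: (can_inj sKK'); rewrite /= /t' rmorphM js tl rmorphM !sK'K.
    have e : map_mpoly t (sB x) = sA (map_mpoly t'' x).
      rewrite [in LHS](decomp x) [in RHS](decomp x) (raddf_sum (map_mpoly t'')).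
      rewrite (rmorph_sum sB) (raddf_sum (map_mpoly t)) (rmorph_sum sA); apply: eq_bigr => m _.
      have e1 : map_mpoly t (sB (x@_m *: lam 'X_[m])) = t (sL x@_m) *: sA 'X_[m].
        by rewrite -mul_mpolyC rmorphM sBC /= mul_mpolyC -lams mapZ.
      have e2 : sA (map_mpoly t'' (x@_m *: lam 'X_[m])) = t (sL x@_m) *: sA 'X_[m].
        by rewrite mapZ // -mul_mpolyC rmorphM sAC /= mul_mpolyC /t' sK'K.
      exact: etrans e1 (esym e2).
    by rewrite e epss Ix // rmorph0.
have I01 : ~ I0 1.
  have [t [tl t1]] := linear_retraction j; move=> /(_ t tl).
  rewrite -[1](rmorph1 lam) -[lam 1]scale1r mapZ // t1 scale1r rmorph1.
  by move/eqP; rewrite oner_eq0.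
have lamI0 p : eps p = 0 -> I0 (lam p).
  move=> p0 t tl; rewrite -[lam p]scale1r mapZ // -mul_mpolyC rmorphM p0.
  by rewrite mulr0.
have [M [Ms M1 I0M maxM]] := max_stable_ideal I0s I01.
have [U [pi [piE piS]]] := quotient_ring (stable_ideal_id Ms) M1.
have [M0 MD MM MsB] := Ms.
have [|sU sUE] := factor_surj (p := pi) (g := pi \o sB) piS.
  by move=> x /piE Mx; apply/piE/MsB.
have [|jR jRE] := factor_surj (p := eps) (g := pi \o lam) epsS.
  by move=> x /lamI0/I0M Mx; apply/piE.
pose jL : {rmorphism L -> U} := pi \o @mpolyC N L.
have sUL x : sU (jL x) = jL (sL x) by rewrite sUE /= sBC.
have sUR x : sU (jR x) = jR (sR x).
  by have [p ->] := epsS x; rewrite jRE sUE /= -lams -epss jRE.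
have gen u : subring_gen (range jL `|` range jR) u.
  have SG := subring_gen_subring (range jL `|` range jR).
  have [b ->] := piS u; rewrite (decomp b) rmorph_sum; apply: (subring_sum SG) => m _.
  rewrite -mul_mpolyC rmorphM; apply: (subringM SG); apply: sub_subring_gen.
    by left; exists b@_m.
  by right; exists (eps 'X_[m]) => //; rewrite jRE.
have preM B : stable_ideal sB B -> ~ B 1 -> M `<=` B -> B = M.
  by move=> Bs B1 MB; apply/seteqP; split=> //; apply: maxM.
exists U, sU, jL, jR; split=> //.
- split.
    apply: bijective_of => [|u].
      (* The preimage of M under sigma is a proper stable ideal containing M, so maximality gives
         equality, that is, injectivity on the quotient. *)
      have e : [set b | M (sB b)] = M.
        apply: preM => [||b]; last exact: MsB.
          split=> /=; [by rewrite rmorph0|..].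
          - by move=> x y Mx My; rewrite rmorphD; apply: MD.
          - by move=> a x Mx; rewrite rmorphM; apply: MM.
          - by move=> x Mx; apply: MsB.
        by rewrite /= rmorph1.
      move=> u v; have [b ->] := piS u; have [c ->] := piS v => /eqP.
      rewrite -subr_eq0 -!rmorphB sUE => /eqP/piE Mbc.
      apply/eqP; rewrite -subr_eq0 -rmorphB; apply/eqP/piE.
      by move: Mbc; rewrite -[M (sB _)]/([set b | M (sB b)] _) e.
    have : range sU u; last by case=> v _ <-; exists v.
    have := gen u; move: u; apply: subring_gen_sub; first exact: subring_range.
    move=> _ [[x _ <-]|[x _ <-]].
      by have [sL' _ sLK] := sL_bij; exists (jL (sL' x)) => //; rewrite sUL sLK.
    by have [sR' _ sRK] := sR_bij; exists (jR (sR' x)) => //; rewrite sUR sRK.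
  move=> I [J0 JD JM Js] x Ix x0; apply: contrapT => I1.
  have e : [set b | I (pi b)] = M.
    apply: preM => [||b Mb] /=.
    - split=> /=; [by rewrite rmorph0|..].
      + by move=> y z Iy Iz; rewrite rmorphD; apply: JD.
      + by move=> a y Iy; rewrite rmorphM; apply: JM.
      + by move=> y Iy; rewrite -[pi (sB y)]/((pi \o sB) y) -sUE; apply: Js.
    - by rewrite rmorph1.
    - by rewrite (piE b).2.
  have [b xb] := piS x; move/eqP: x0; apply.
  by rewrite xb; apply/piE; rewrite -e /= -xb.
- by move=> a; rewrite -epsC jRE /= lamC.
Qed.

End Compositum.

(** * Comparison of L, R' and U *)

(** A free subfamily g_j = c_(p j) spans the c_i with constant coefficients. By independence over
    constants this expansion must be c_i = c_i, so the coefficients sum to Kronecker deltas along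
    the fibres of p, and a relation over S can be read off through them. *)
Lemma constants_free_over (S U : comUnitRingType) (sS : {rmorphism S -> S})
    (sU : {rmorphism U -> U}) (f : {rmorphism S -> U}) r (c : 'I_r -> U) :
  (forall x, sU (f x) = f (sS x)) -> sigma_simple sS -> (forall i, sU (c i) = c i) ->
  (forall d : 'I_r -> S, (forall i, sS (d i) = d i) -> \sum_i f (d i) * c i = 0 ->
     forall i, d i = 0) -> free_over f c.
Proof.
move=> fs simpleS cc fc a e.
have [t [g [k [gc kc ck fg]]]] := free_constants fs simpleS cc.
have /choice[p pE] := gc.
have kE i l : \sum_(j | p j == l) k i j = (l == i)%:R.
  apply/eqP; rewrite eq_sym -subr_eq0; apply/eqP.
  move: l; apply: fc => [l|].
    rewrite rmorphB rmorph_nat rmorph_sum; congr (_ - _).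
    by apply: eq_bigr => j _; apply: kc.
  under eq_bigr => l _ do rewrite rmorphB rmorph_nat mulrBl.
  rewrite sumrB (bigD1 i) //= eqxx mul1r big1 ?addr0 => [|l /negPf ->]; last by rewrite mul0r.
  apply/eqP; rewrite subr_eq0 {1}ck (partition_big p predT) //=; apply/eqP.
  apply: eq_bigr => l _; rewrite rmorph_sum mulr_suml.
  by apply: eq_bigr => j /eqP <-; rewrite pE.
have ak j : \sum_i a i * k i j = 0.
  by move: j; apply: fg; rewrite -(regroup_constants a ck).
move=> l; transitivity (\sum_i a i * (l == i)%:R).
  rewrite (bigD1 l) //= eqxx mulr1 big1 ?addr0 // => i; rewrite eq_sym => /negPf ->.
  by rewrite mulr0.
under eq_bigr => i _ do rewrite -kE mulr_sumr.
by rewrite exchange_big big1.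
Qed.

Lemma field_degree_basis (L k : fieldType) (i : {rmorphism k -> L}) (D C : set L) r
    (v : 'I_r -> L) :
  (forall x, C x <-> exists a, x = i a) -> C `<=` D -> (forall l, D (v l)) -> free_over i v ->
  (forall x, D x -> exists c, x = \sum_l i (c l) * v l) -> field_degree D C r.
Proof.
move=> CE CD Dv fv sv; split=> //; exists v; split=> // x Dx.
have [c xE] := sv x Dx; exists [ffun l => i (c l)]; split.
  split=> [l|]; first by apply/CE; exists (c l); rewrite ffunE.
  by rewrite xE; apply: eq_bigr => l _; rewrite ffunE.
move=> c' [Cc' xE']; apply/ffunP => l; rewrite ffunE.
have /choice[b bE] l' : exists a, c' l' = i a by apply/CE.
rewrite bE; congr (i _); apply/eqP; rewrite -subr_eq0; apply/eqP.
move: l; apply: (fv (fun l => c l - b l)).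
under eq_bigr => l _ do rewrite rmorphB mulrBl.
rewrite sumrB -xE xE'; apply/eqP; rewrite subr_eq0; apply/eqP.
by apply: eq_bigr => l _; rewrite bE.
Qed.

(** If the translates of q were all distinct, maximality would give, among the first #|I| + 1 of
    them, elements e_i outside the i-th and inside the others. Such elements are free over L,
    although #|I| elements span U. *)
Lemma maximal_ideal_finite_orbit (L : fieldType) (U : comUnitRingType) (s : {rmorphism U -> U})
    (j : {rmorphism L -> U}) (I : finType) (w : I -> U) (q : set U) :
  bijective s -> (forall u, exists c, u = \sum_k j (c k) * w k) -> is_prime q ->
  (forall B, stable_ideal id B -> ~ B 1 -> q `<=` B -> B `<=` q) ->
  exists2 N, (0 < N)%N & forall x, q (iter N s x) <-> q x.
Proof.
move=> sb span qp maxq; have [qs q1 qM] := qp; have [q0 qD qMl _] := qs.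
have [M [p [pE _]]] := residue_field qp.
apply: contrapT => nN.
have /choice[x xP] (ik : 'I_#|I|.+1 * 'I_#|I|.+1) : exists x, ik.1 != ik.2 ->
    q (iter ik.2 s x) /\ ~ q (iter ik.1 s x).
  case: ik => i k /=; have [->|ik] := eqVneq i k; first by exists 0.
  apply: contrapT => /forallNP nx.
  have ki y : q (iter k s y) -> q (iter i s y).
    by move=> ky; apply: contrapT => niy; apply: (nx y).
  have ik' y : q (iter i s y) -> q (iter k s y).
    (* B is a proper ideal containing q, so maximality makes the inclusion of one translate in
       another an equality. *)
    pose B := [set z | exists2 y, z = iter k s y & q (iter i s y)].
    have [fi fiE] := iter_rmorphism s i; have [fk fkE] := iter_rmorphism s k.
    move=> iy; apply: (maxq B) => [||z qz|]; last by exists y.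
    - split=> //.
      + by exists 0; rewrite -?fiE -?fkE ?rmorph0.
      + move=> _ _ [u -> iu] [v -> iv]; exists (u + v); first by rewrite -!fkE rmorphD.
        by rewrite -fiE rmorphD !fiE; apply: qD.
      + move=> a _ [u -> iu]; have [b <-] := iter_surj sb k a.
        exists (b * u); first by rewrite -!fkE rmorphM.
        by rewrite -fiE rmorphM !fiE; apply: qMl.
    - move=> [u e iu]; apply: q1; have : fk u = fk 1 by rewrite fkE -e rmorph1.
      move: iu; rewrite -fiE; suff kinj : injective fk by move=> iu /kinj ue; rewrite ue rmorph1 in iu.
      have skinj : injective (iter k s).
        by elim: (nat_of_ord k) => //= m IH a b /(bij_inj sb)/IH.
      by move=> a b; rewrite !fkE => /skinj.
    - by have [u uz] := iter_surj sb k z; exists u => //; apply: ki; rewrite uz.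
  have key (a b : nat) : (a < b)%N ->
      (forall y, q (iter a s y) <-> q (iter b s y)) -> False.
    move=> ab e; apply: nN; exists (b - a)%N; first by rewrite subn_gt0.
    move=> z; have [y <-] := iter_surj sb a z.
    by rewrite -iterD subnK; [rewrite e|apply: ltnW].
  have [ltik|ltki|eik] := ltngtP i k.
  - by apply: (key i k ltik) => y; split; [apply: ik'|apply: ki].
  - by apply: (key k i ltki) => y; split; [apply: ki|apply: ik'].
  - by move/eqP: ik; apply; apply: val_inj.
have /choice[f fE] (i : 'I_#|I|.+1) : exists f : {rmorphism U -> U}, forall y, f y = iter i s y.
  exact: iter_rmorphism.
pose e (i : 'I_#|I|.+1) := \prod_(k | k != i) x (i, k).
have e0 i k : k != i -> p (f k (e i)) = 0.
  move=> ki; rewrite /e (bigD1 k) //= !rmorphM [p _](_ : _ = 0) ?mul0r //.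
  by apply/pE; rewrite fE; case: (xP (i, k)) => //=; rewrite eq_sym.
have en0 i : p (f i (e i)) != 0.
  rewrite !rmorph_prod; apply/prodf_neq0 => k ki; apply/eqP => /pE; rewrite fE.
  by case: (xP (i, k)) => //=; rewrite eq_sym.
have fe : free_over j e.
  move=> c ce k; apply/eqP; rewrite -(fmorph_eq0 (p \o f k \o j)) /=.
  have := congr1 (p \o f k) ce; rewrite rmorph0 rmorph_sum (bigD1 k) //=.
  rewrite big1 ?addr0 => [|i ik]; last by rewrite !rmorphM e0 ?mulr0 // eq_sym.
  by rewrite !rmorphM => /eqP; rewrite mulf_eq0 (negPf (en0 k)) orbF.
by have := free_span_le fe (fun i => span (e i)); rewrite ltnn.
Qed.

(** W = Y1^-1 Y2 is constant because both matrices satisfy the same equation. The quotient of the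
    determinants is also constant; it is included to recover the inverse determinant of Y2. *)
Lemma fundamental_constants (U : comUnitRingType) (s : {rmorphism U -> U}) n
    (A Y1 Y2 : 'M[U]_n) : Y1 \in unitmx -> Y2 \in unitmx ->
  map_mx s Y1 = A *m Y1 -> map_mx s Y2 = A *m Y2 ->
  exists c : seq U, (forall x, x \in c -> s x = x) /\ forall S : set U, subring S ->
    entries Y1 `<=` S -> S (\det Y1)^-1 -> [set` c] `<=` S ->
    entries Y2 `<=` S /\ S (\det Y2)^-1.
Proof.
move=> u1 u2 e1 e2; pose W := invmx Y1 *m Y2; pose w := \det Y1 / \det Y2.
have WE : Y2 = Y1 *m W by rewrite mulKVmx.
have d1 : \det Y1 \is a GRing.unit by rewrite -unitmxE.
have d2 : \det Y2 \is a GRing.unit by rewrite -unitmxE.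
have sW : map_mx s W = W.
  have us1 : map_mx s Y1 \in unitmx by rewrite unitmxE det_map_mx rmorph_unit.
  by rewrite -[LHS](mulKmx us1) -map_mxM -WE e2 {1}WE [A *m _]mulmxA -e1 mulKmx.
have sw : s w = w.
  apply: (mulIr (rmorph_unit s d2)); rewrite -rmorphM divrK // -!det_map_mx e1 e2.
  by rewrite !det_mulmx mulrCA divrK // mulrC.
exists (w :: [seq W k.1 k.2 | k <- enum {: 'I_n * 'I_n}]); split.
  move=> x; rewrite inE => /orP[/eqP -> //|/mapP[[i k] _ ->]] /=.
  by rewrite -[in RHS]sW [RHS]mxE.
move=> S SS Y1S d1S cS; split; last first.
  have -> : (\det Y2)^-1 = (\det Y1)^-1 * w by rewrite /w mulKr.
  by apply: (subringM SS) => //; apply: cS; rewrite /= inE eqxx.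
move=> _ [i [k ->]]; rewrite WE; apply: (subring_mulmx SS) => a b.
  by apply: Y1S; exists a, b.
apply: cS; rewrite /= inE; apply/orP; right; apply/mapP.
by exists (a, b); rewrite ?mem_enum.
Qed.

Lemma periodic_comp (T : Type) (s : T -> T) m k x : iter m s x = x -> iter (k * m) s x = x.
Proof. by move=> e; elim: k => //= k IH; rewrite mulSn iterD IH. Qed.

Lemma common_period (T : Type) (s : T -> T) r (v : 'I_r -> T) :
  (forall i, exists2 m, (0 < m)%N & iter m s (v i) = v i) ->
  exists2 m, (0 < m)%N & forall i, iter m s (v i) = v i.
Proof.
move=> pv; have /choice[m mP] i : exists m, (0 < m)%N /\ iter m s (v i) = v i.
  by have [m m0 e] := pv i; exists m.
exists (\prod_i m i)%N; first by rewrite prodn_gt0 // => i; case: (mP i).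
move=> i; rewrite (bigD1 i) //= mulnC; apply: periodic_comp.
by case: (mP i).
Qed.

Lemma adjoin_GL_generators (T : comUnitRingType) (F : set T) n (y : 'M[T]_n) :
  exists g : seq T, adjoin_GL F y = subring_gen (F `|` [set` g]).
Proof.
exists ((\det y)^-1 :: [seq y k.1 k.2 | k <- enum {: 'I_n * 'I_n}]); congr subring_gen.
rewrite -setUA; congr (_ `|` _); apply/seteqP; split=> x /=.
  case=> [[i [k ->]]|->]; rewrite inE; last by rewrite eqxx.
  by apply/orP; right; apply/mapP; exists (i, k); rewrite ?mem_enum.
rewrite inE => /orP[/eqP -> |/mapP[[i k] _ ->]]; first by right.
by left; exists i, k.
Qed.

Lemma subset_mapP (T T' : eqType) (f : T -> T') s t : {subset s <= [seq f x | x <- t]} ->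
  exists z, s = [seq f x | x <- z].
Proof.
elim: s => [|x s IH] st; first by exists [::].
have [z zs|z ->] := IH; first by apply: st; rewrite inE zs orbT.
by have /mapP[w _ ->] := st x (mem_head _ _); exists (w :: z).
Qed.

(** The products of constants of S with constants of U are collected, for each w p, into one
    constant of U. *)
Lemma constant_span (S U : comUnitRingType) (sS : {rmorphism S -> S}) (sU : {rmorphism U -> U})
    (f : {rmorphism S -> U}) (kU : fieldType) (iU : {rmorphism kU -> U}) (I : finType)
    (w : I -> S) r (a : 'I_r -> S) (c : 'I_r -> U) :
  (forall x, sU (f x) = f (sS x)) -> (forall x, sU x = x -> exists b, x = iU b) ->
  (forall i, sU (c i) = c i) ->
  (forall i, exists d : I -> S, (forall p, sS (d p) = d p) /\ a i = \sum_p d p * w p) ->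
  exists b, \sum_i f (a i) * c i = \sum_p iU (b p) * f (w p).
Proof.
move=> fs CE cc /choice[d dP].
have /choice[b bE] p : exists b, \sum_i f (d i p) * c i = iU b.
  apply: CE; rewrite rmorph_sum; apply: eq_bigr => i _.
  by rewrite rmorphM cc fs; case: (dP i) => ->.
exists b; transitivity (\sum_i \sum_p f (d i p) * c i * f (w p)).
  apply: eq_bigr => i _; case: (dP i) => _ ->; rewrite rmorph_sum mulr_suml.
  by apply: eq_bigr => p _; rewrite rmorphM mulrAC.
by rewrite exchange_big; apply: eq_bigr => p _; rewrite -bE mulr_suml.
Qed.

(** * Simplicity, denominators and periodic elements in the compositum *)

Section Setting.
Variables (K L : fieldType) (R U : comUnitRingType).
Variables (sK : {rmorphism K -> K}) (sL : {rmorphism L -> L})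
  (sR : {rmorphism R -> R}) (sU : {rmorphism U -> U}).
Variables (j : {rmorphism K -> L}) (iota : {rmorphism K -> R})
  (jL : {rmorphism L -> U}) (jR : {rmorphism R -> U}).
Variables (n : nat) (A : 'M[K]_n) (Y : 'M[L]_n) (y : 'M[R]_n).
Hypotheses (sK_bij : bijective sK) (sR_bij : bijective sR) (sU_bij : bijective sU).
Hypotheses (iotas : forall a, sR (iota a) = iota (sK a))
  (jLs : forall x, sU (jL x) = jL (sL x)) (jRs : forall x, sU (jR x) = jR (sR x))
  (jLR : forall a, jL (j a) = jR (iota a)).
Hypotheses (Yu : Y \in unitmx) (Ys : map_mx sL Y = map_mx j A *m Y).
Hypotheses (yu : y \in unitmx) (ys : map_mx sR y = map_mx iota A *m y).
Let RL := adjoin_GL (range j) Y.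
Hypothesis L_frac : is_fraction_field_of RL.
Hypothesis R_gen : [set: R] = adjoin_GL (range iota) y.
Hypotheses (simpleR : sigma_simple sR) (simpleU : sigma_simple sU).
Hypothesis U_gen : forall u, subring_gen (range jL `|` range jR) u.
Hypotheses (ch0 : char0 K) (CK : constants sK = periodic sK).

Let CL := constants sL.
Let CU := constants sU.

Lemma constants_U : subfield CU. Proof. exact: constants_subfield. Qed.
Lemma constants_U_subring : subring CU.
Proof.
have [[C1 CB CD] _] := constants_U; split=> // x x' /set_mem cx /set_mem cx'.
by apply/mem_set; rewrite /CU /constants /= in cx cx' *; rewrite rmorphM cx cx'.
Qed.
Lemma constants_L : subfield CL.
Proof. by apply: constants_subfield; apply: field_sigma_simple. Qed.
Lemma constants_L_subring : subring CL. Proof. exact/subfield_subring/constants_L. Qed.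

Lemma constants_U_inverse c : sU c = c -> c != 0 -> exists2 d, sU d = d & d * c = 1.
Proof.
move=> cc c0; have uc : c \is a GRing.unit by case: constants_U => _; apply.
by exists c^-1; [rewrite rmorphV // cc|rewrite mulVr].
Qed.

Lemma jR_adjoin (S : set U) : subring S -> jR @` range iota `<=` S ->
  entries (map_mx jR y) `<=` S -> S (\det (map_mx jR y))^-1 -> forall x, S (jR x).
Proof.
move=> SS KS yS dS x; have : adjoin_GL (range iota) y x by rewrite -R_gen.
apply: (subring_gen_sub (S := jR @^-1` S)); first exact: subring_preimage.
move=> _ [[[a _ <-]|[i [k ->]]]|->] /=.
- by apply: KS; exists (iota a) => //; exists a.
- by apply: yS; exists i, k; rewrite mxE.
- by move: dS; rewrite det_map_mx rmorphV // -unitmxE.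
Qed.

Lemma jL_adjoin (S : set U) : subring S -> jL @` range j `<=` S ->
  entries (map_mx jL Y) `<=` S -> S (\det (map_mx jL Y))^-1 -> forall x, RL x -> S (jL x).
Proof.
move=> SS KS YS dS x; apply: (subring_gen_sub (S := jL @^-1` S)); first exact: subring_preimage.
move=> _ [[[a _ <-]|[i [k ->]]]|->] /=.
- by apply: KS; exists (j a) => //; exists a.
- by apply: YS; exists i, k; rewrite mxE.
- by move: dS; rewrite det_map_mx rmorphV // -unitmxE.
Qed.

Lemma jL_fundamental : map_mx jL Y \in unitmx /\
  map_mx sU (map_mx jL Y) = map_mx (jL \o j) A *m map_mx jL Y.
Proof.
split; first by rewrite unitmxE det_map_mx rmorph_unit // -unitmxE.
transitivity (map_mx jL (map_mx sL Y)); first by apply/matrixP => i k; rewrite !mxE jLs.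
by rewrite Ys map_mxM; congr (_ *m _); apply/matrixP => i k; rewrite !mxE.
Qed.

Lemma jR_fundamental : map_mx jR y \in unitmx /\
  map_mx sU (map_mx jR y) = map_mx (jL \o j) A *m map_mx jR y.
Proof.
split; first by rewrite unitmxE det_map_mx rmorph_unit // -unitmxE.
transitivity (map_mx jR (map_mx sR y)); first by apply/matrixP => i k; rewrite !mxE jRs.
by rewrite ys map_mxM; congr (_ *m _); apply/matrixP => i k; rewrite !mxE /= jLR.
Qed.

(* y = Y W with W constant. *)
Lemma constants_over_L : exists c : seq U, (forall x, x \in c -> sU x = x) /\
  (forall S : set U, subring S -> jL @` RL `<=` S -> [set` c] `<=` S -> forall x, S (jR x)).
Proof.
have [u1 e1] := jL_fundamental; have [u2 e2] := jR_fundamental.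
have [c [cc cS]] := fundamental_constants u1 u2 e1 e2.
exists c; split=> // S SS LS cS'.
have sub x : RL x -> S (jL x) by move=> Rx; apply: LS; exists x.
have [||yS dS] := cS S SS _ _ cS'.
- move=> _ [i [k ->]]; rewrite mxE; apply: sub; apply: sub_subring_gen.
  by left; right; exists i, k.
- rewrite det_map_mx -rmorphV -?unitmxE //; apply: sub; apply: sub_subring_gen.
  by right.
apply: (jR_adjoin SS) => // _ [_ [a _ <-] <-]; rewrite -jLR; apply: sub.
by apply: sub_subring_gen; left; left; exists a.
Qed.

(* Y = y Z with Z constant. *)
Lemma constants_over_R : exists c : seq U, (forall x, x \in c -> sU x = x) /\
  (forall S : set U, subring S -> range jR `<=` S -> [set` c] `<=` S ->
     forall x, RL x -> S (jL x)).
Proof.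
have [u1 e1] := jR_fundamental; have [u2 e2] := jL_fundamental.
have [c [cc cS]] := fundamental_constants u1 u2 e1 e2.
exists c; split=> // S SS RS cS'.
have sub x : S (jR x) by apply: RS; exists x.
have [||YS dS] := cS S SS _ _ cS'.
- by move=> _ [i [k ->]]; rewrite mxE.
- by rewrite det_map_mx -rmorphV -?unitmxE //; apply: sub.
by apply: (jL_adjoin SS) => // _ [_ [a _ <-] <-]; rewrite jLR.
Qed.

(** This is U = L C_U, in the form of an induction principle: y = Y W places R' in L C_U. *)
Lemma U_span_R_over_L (S : set U) : subring S -> range jL `<=` S ->
  (forall c, CU c -> S c) -> forall u, S u.
Proof.
move=> SS LS CS u; have := U_gen u; move: u; apply: subring_gen_sub => // u [/LS//|[x _ <-]].
have [c [cc cS]] := constants_over_L.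
apply: cS => //; first by move=> _ [z _ <-]; apply: LS; exists z.
by move=> z /= /cc; apply: CS.
Qed.

Lemma RL_sub_span x : RL x -> subring_gen (range jR `|` CU) (jL x).
Proof.
have [c [cc cS]] := constants_over_R; apply: cS; first exact: subring_gen_subring.
  by move=> z Rz; apply: sub_subring_gen; left.
by move=> z /= /cc cz; apply: sub_subring_gen; right.
Qed.

Lemma RL_subring : subring RL. Proof. exact: subring_gen_subring. Qed.

Lemma span_stable u : subring_gen (range jR `|` CU) u -> subring_gen (range jR `|` CU) (sU u).
Proof.
have SG := subring_gen_subring (range jR `|` CU).
move: u; apply: (subring_gen_sub (S := sU @^-1` (subring_gen (range jR `|` CU)))).
  exact: subring_preimage SG.
move=> u [[x _ <-]|cu] /=; apply: sub_subring_gen; first by left; rewrite jRs; exists (sR x).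
by right; rewrite /CU /constants /= in cu *; rewrite cu.
Qed.

(** U is generated by L and R', L consists of fractions of [RL], and Y = y Z places [RL] in R' C_U.
    So a denominator from [RL] moves any element of U into R' C_U. *)
Lemma RL_denominator u : exists r, [/\ RL r, r != 0 & subring_gen (range jR `|` CU) (jL r * u)].
Proof.
set V := subring_gen _; have SV : subring V := subring_gen_subring _.
have := U_gen u; move: u; apply: (subring_gen_sub (S := [set u | exists r,
  [/\ RL r, r != 0 & V (jL r * u)]])) => [|u].
  apply/subringP; split=> [|u v [r [Rr r0 Vr]] [r' [Rr' r0' Vr']]|u v [r [Rr r0 Vr]] [r' [Rr' r0' Vr']]].
  - exists 1; rewrite oner_neq0 rmorph1 mulr1; split=> //; last exact: (subring1 SV).
    exact: (subring1 RL_subring).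
  - exists (r * r'); rewrite mulf_neq0 //; split=> //; first exact: (subringM RL_subring).
    have -> : jL (r * r') * (u - v) = jL r' * (jL r * u) - jL r * (jL r' * v).
      by rewrite rmorphM; ring.
    by apply: (subringB SV); apply: (subringM SV) => //; exact: RL_sub_span.
  - exists (r * r'); rewrite mulf_neq0 //; split=> //; first exact: (subringM RL_subring).
    by rewrite rmorphM mulrACA; apply: (subringM SV).
case=> [[x _ <-]|[x _ <-]]; last first.
  exists 1; rewrite oner_neq0 rmorph1 mul1r; split=> //; first exact: (subring1 RL_subring).
  by apply: sub_subring_gen; left; exists x.
have [a [b [Ra Rb b0 ->]]] := L_frac x; exists b; split=> //.
by rewrite -rmorphM mulrC divfK //; apply: RL_sub_span.
Qed.

Lemma span_contains1 (J : set U) :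
  (forall x x', J x -> J x' -> J (x + x')) -> (forall a x, J x -> J (jR a * x)) ->
  (forall c x, CU c -> J x -> J (c * x)) -> (forall x, J x -> J (sU x)) ->
  forall u, J u -> u != 0 -> subring_gen (range jR `|` CU) u -> J 1.
Proof.
move=> JD JR JC Js u Ju u0 /(span_products (subring_range jR) constants_U_subring).
move=> [r [a [c [Ra Cc e]]]]; have /choice[b bE] i : exists b, jR b = a i by have [b _] := Ra i; exists b.
apply: (stable_contains1 jRs simpleR constants_U_inverse JD JR JC Js (a := b) (c := c)) => //.
  by under eq_bigr => i _ do rewrite bE; rewrite -e.
by under eq_bigr => i _ do rewrite bE; rewrite -e.
Qed.

(** The common denominators in R' C_U of u, sigma u, ..., sigma^(m-1) u are stable under sigma and
    not all zero, so 1 is one of them and u lies in R' C_U. Linear disjointness then makes the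
    coefficients from R' fixed by sigma^m. *)
Lemma periodic_U_span_R u m : (0 < m)%N -> iter m sU u = u ->
  exists r (a : 'I_r -> R) (c : 'I_r -> U), [/\ forall i, iter m sR (a i) = a i,
    forall i, CU (c i) & u = \sum_i jR (a i) * c i].
Proof.
move=> m0 um; set V := subring_gen (range jR `|` CU).
have SV : subring V := subring_gen_subring _.
have Vu : V u.
  pose J := [set a | V a /\ forall i, (i < m)%N -> V (a * iter i sU u)].
  suff [_ /(_ 0%N m0)] : J 1 by rewrite mul1r.
  have /choice[r rP] (i : 'I_m) : exists r, [/\ RL r, r != 0 & V (jL r * iter i sU u)].
    exact: RL_denominator.
  pose d := \prod_i r i.
  have Rd : RL d by apply: (subring_prod RL_subring) => i _; case: (rP i).
  have Vd : V (jL d) by apply: RL_sub_span.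
  have d0 : d != 0 by apply/prodf_neq0 => i _; case: (rP i).
  apply: (@span_contains1 J _ _ _ _ (jL d)) => //.
  - move=> x x' [Vx Jx] [Vx' Jx']; split; first exact: (subringD SV).
    by move=> i im; rewrite mulrDl; apply: (subringD SV); [apply: Jx|apply: Jx'].
  - move=> a x [Vx Jx]; have Va : V (jR a) by apply: sub_subring_gen; left; exists a.
    split=> [|i im]; first exact: (subringM SV).
    by rewrite -mulrA; apply: (subringM SV) => //; apply: Jx.
  - move=> c x Cc [Vx Jx]; have Vc : V c by apply: sub_subring_gen; right.
    split=> [|i im]; first exact: (subringM SV).
    by rewrite -mulrA; apply: (subringM SV) => //; apply: Jx.
  - move=> x [Vx Jx]; split=> [|i im]; first exact: span_stable.
    case: i im => [_|i im] /=; last first.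
      by rewrite -rmorphM; apply: span_stable; apply: Jx; apply: ltnW.
    (* The periodicity of u enters here: sigma x * u is sigma (x * sigma^(m-1) u). *)
    rewrite -um -(prednK m0) /= -rmorphM; apply: span_stable; apply: Jx.
    by rewrite prednK.
  - split=> // i im; rewrite /d (bigD1 (Ordinal im)) //= rmorphM mulrAC.
    apply: (subringM SV); first by case: (rP (Ordinal im)).
    by apply: RL_sub_span; apply: (subring_prod RL_subring) => k _; case: (rP k).
  - by rewrite fmorph_eq0.
have [r [a' [c [Ra Cc e]]]] := span_products (subring_range jR) constants_U_subring Vu.
have /choice[a aE] i : exists b, jR b = a' i by have [b _] := Ra i; exists b.
have [f fE] := iter_rmorphism sU m.
have itC x : CU x -> f x = x by move=> cx; rewrite fE iter_fix.
have fR x : f (jR x) = jR (iter m sR x).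
  by rewrite fE; elim: (m) => //= k ->; rewrite jRs.
have eu : u = \sum_i jR (a i) * c i by rewrite e; apply: eq_bigr => i _; rewrite aE.
have [|t [b [g [gc bm e']]]] := fixed_span jRs simpleR fR Cc (fun i => itC _ (Cc i)) (a := a).
  by rewrite -eu fE.
exists t, b, g; split=> //; last by rewrite eu.
by move=> i; have [k ->] := gc i.
Qed.

Lemma periodic_U_span_L u m : iter m sU u = u ->
  exists r (a : 'I_r -> L) (c : 'I_r -> U), [/\ forall i, iter m sL (a i) = a i,
    forall i, CU (c i) & u = \sum_i jL (a i) * c i].
Proof.
move=> um.
have Vu : subring_gen (range jL `|` CU) u.
  apply: U_span_R_over_L; first exact: subring_gen_subring.
    by move=> x Lx; apply: sub_subring_gen; left.
  by move=> c Cc; apply: sub_subring_gen; right.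
have [r [a' [c [Ra Cc e]]]] := span_products (subring_range jL) constants_U_subring Vu.
have /choice[a aE] i : exists b, jL b = a' i by have [b _] := Ra i; exists b.
have [f fE] := iter_rmorphism sU m.
have itC x : CU x -> f x = x by move=> cx; rewrite fE iter_fix.
have fL x : f (jL x) = jL (iter m sL x).
  by rewrite fE; elim: (m) => //= k ->; rewrite jLs.
have eu : u = \sum_i jL (a i) * c i by rewrite e; apply: eq_bigr => i _; rewrite aE.
have [|t [b [g [gc bm e']]]] := fixed_span jLs (@field_sigma_simple _ sL) fL Cc
    (fun i => itC _ (Cc i)) (a := a).
  by rewrite -eu fE.
exists t, b, g; split=> //; last by rewrite eu.
by move=> i; have [k ->] := gc i.
Qed.

(** U is generated over L by the finitely many constants in c. Writing a constant of U as a
    combination of elements of B with coefficients in L, [fixed_span] allows coefficients in C_L, so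
    C_U is generated over C_L by c. *)
Lemma constants_U_generated : exists c : seq U, (forall x, x \in c -> sU x = x) /\
  (forall x, CU x -> subring_gen (jL @` CL `|` [set` c]) x) /\
  (forall u, subring_gen (range jL `|` [set` c]) u).
Proof.
have [c [cc cS]] := constants_over_L; exists c; split=> //.
set B := subring_gen (jL @` CL `|` _); have SB : subring B := subring_gen_subring _.
have BC : B `<=` CU.
  apply: subring_gen_sub; first exact: constants_U_subring.
  move=> _ [[x cx <-]|/= /cc //]; rewrite /CU /CL /constants /= in cx *.
  by rewrite jLs cx.
have gen u : subring_gen (range jL `|` [set` c]) u.
  set G := subring_gen _; have SG : subring G := subring_gen_subring _.
  have := U_gen u; move: u; apply: subring_gen_sub => // u [Lu|[x _ <-]].
    by apply: sub_subring_gen; left.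
  apply: cS => // z; last by move=> cz; apply: sub_subring_gen; right.
  by move=> [w _ <-]; apply: sub_subring_gen; left; exists w.
split=> // x cx.
have : subring_gen (range jL `|` B) x.
  apply: subring_genS (gen x); apply: setUS => z cz.
  by apply: sub_subring_gen; right.
move=> /(span_products (subring_range jL) SB)[r [a' [b [La Bb e]]]].
have /choice[a aE] i : exists z, jL z = a' i by have [z _] := La i; exists z.
have eu : x = \sum_i jL (a i) * b i by rewrite e; apply: eq_bigr => i _; rewrite aE.
have [|t [d [g [gb dc e']]]] := fixed_span jLs (@field_sigma_simple _ sL) jLs
    (fun i => BC _ (Bb i)) (fun i => BC _ (Bb i)) (a := a).
  by rewrite -eu.
rewrite eu e'; apply: (subring_sum SB) => i _; apply: (subringM SB).
  by apply: sub_subring_gen; left; exists (d i).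
by have [k ->] := gb i; apply: Bb.
Qed.

(** The set J = I C_U is stable under sigma, under R' and under C_U, and meets R' C_U in a nonzero
    element, so it contains 1 by simplicity of R'. Linear disjointness of L and C_U brings this back
    to L. *)
Lemma extension_simple (I : set L) :
  let S := subring_gen (subfield_gen (range j `|` CL) `|` RL) in
  ideal_in S I -> sL @` I `<=` I -> I = [set 0] \/ I = S.
Proof.
set KCL := subfield_gen _; move=> S [IS I0 ID IM] Is.
have SS : subring S := subring_gen_subring _.
have [->|/eqP In0] := eqVneq I [set 0]; [by left|right].
have [x Ix x0] : exists2 x, I x & x != 0.
  apply: contrapT => nx; case: In0; apply/seteqP; split=> [x Ix|_ -> //].
  by apply: contrapT => /eqP x0; apply: nx; exists x.
have KS z : KCL z -> S z by move=> Kz; apply: sub_subring_gen; left.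
have CS z : CL z -> S z by move=> Cz; apply: KS; apply: sub_subfield_gen; right.
have RS z : RL z -> S z by move=> Rz; apply: sub_subring_gen; right.
suff I1 : I 1 by apply/seteqP; split=> // z Sz; rewrite -[z]mulr1; apply: IM.
pose V := subring_gen (range j `|` CL).
have SV : subring V := subring_gen_subring _.
pose W := subring_gen (V `|` RL).
have SW : subring W := subring_gen_subring _.
have VS z : V z -> S z by move=> Vz; apply: KS; exact: subring_subfield_gen Vz.
have VW z : V z -> W z by move=> Vz; apply: sub_subring_gen; left.
(* Denominators from the field KC_L are cleared inside K[C_L], so that r x lies in R' C_U. *)
have [r [Vr r0 Wrx]] : exists r, [/\ V r, r != 0 & W (r * x)].
  have := IS _ Ix; move: (x); apply: (subring_gen_sub (S := [set x | exists r,
    [/\ V r, r != 0 & W (r * x)]])) => [|u [|Ru]].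
  - apply/subringP; split=> [|u v [r [Vr r0 Wr]] [r' [Vr' r0' Wr']]|u v [r [Vr r0 Wr]] [r' [Vr' r0' Wr']]].
    + exists 1; rewrite oner_neq0 mulr1; split=> //; [exact: (subring1 SV)|exact: (subring1 SW)].
    + exists (r * r'); rewrite mulf_neq0 //; split=> //; first exact: (subringM SV).
      have -> : r * r' * (u - v) = r' * (r * u) - r * (r' * v) by ring.
      by apply: (subringB SW); apply: (subringM SW) => //; apply: VW.
    + exists (r * r'); rewrite mulf_neq0 //; split=> //; first exact: (subringM SV).
      by rewrite mulrACA; apply: (subringM SW).
  - rewrite /KCL subfield_genE => -[a [b [Va Vb b0 ->]]]; exists b; split=> //.
    by rewrite mulrC divfK //; apply: VW.
  - exists 1; rewrite oner_neq0 mul1r; split=> //; first exact: (subring1 SV).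
    by apply: sub_subring_gen; right.
pose J := [set u | exists r (a : 'I_r -> L) (c : 'I_r -> U),
  [/\ forall i, I (a i), forall i, CU (c i) & u = \sum_i jL (a i) * c i]].
have JD u v : J u -> J v -> J (u + v).
  move=> [p [a [c [Ia Cc ->]]]] [p' [a' [c' [Ia' Cc' ->]]]].
  exists (p + p')%N, (fun i => match split i with inl k => a k | inr k => a' k end),
    (fun i => match split i with inl k => c k | inr k => c' k end); split.
  - by move=> i; case: splitP.
  - by move=> i; case: splitP.
  rewrite big_split_ord /=; congr (_ + _); apply: eq_bigr => i _.
    by rewrite -[lshift _ _]/(unsplit (inl i)) unsplitK.
  by rewrite -[rshift _ _]/(unsplit (inr i)) unsplitK.
have JC c u : CU c -> J u -> J (c * u).
  move=> Cc [p [a [d [Ia Cd ->]]]]; exists p, a, (fun i => c * d i); split=> // [i|].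
    exact: (subringM constants_U_subring).
  by rewrite mulr_sumr; apply: eq_bigr => i _; rewrite mulrCA.
have JL z u : S z -> J u -> J (jL z * u).
  move=> Sz [p [a [d [Ia Cd ->]]]]; exists p, (fun i => z * a i), d; split=> // [i|].
    exact: IM.
  by rewrite mulr_sumr; apply: eq_bigr => i _; rewrite rmorphM mulrA.
have JN u : J u -> J (- u).
  by move=> Ju; rewrite -mulN1r -(rmorph1 jL) -rmorphN; apply: JL => //;
    apply: (subringN SS); apply: (subring1 SS).
have JR z u : J u -> J (jR z * u).
  have [c [cc cS]] := constants_over_L.
  pose B := [set b | forall u, J u -> J (b * u)].
  move: u; apply: (cS B) => [||d /cc cd u Ju]; last exact: JC.
    apply/subringP; split=> [u|b b' Bb Bb' u Ju|b b' Bb Bb' u Ju].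
    - by rewrite mul1r.
    - by rewrite mulrBl; apply: JD; [exact: Bb|apply/JN/Bb'].
    - by rewrite -mulrA; apply/Bb/Bb'.
  by move=> _ [w /RS Sw <-] u Ju; apply: JL.
have Js u : J u -> J (sU u).
  move=> [p [a [d [Ia Cd ->]]]]; exists p, (fun i => sL (a i)), d; split=> // [i|].
    by apply: Is; exists (a i).
  by rewrite rmorph_sum; apply: eq_bigr => i _; rewrite rmorphM jLs Cd.
have Jrx : J (jL (r * x)).
  exists 1%N, (fun=> r * x), (fun=> 1); split=> [_|_|]; [by apply: IM => //; apply: VS|exact: rmorph1|].
  by rewrite big_ord1 mulr1.
have rx0 : jL (r * x) != 0 by rewrite fmorph_eq0 mulf_neq0.
have spanW z : W z -> subring_gen (range jR `|` CU) (jL z).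
  have SG := subring_gen_subring (range jR `|` CU).
  have SGj := subring_preimage jL SG.
  move: z; apply: (subring_gen_sub SGj) => z [|]; last exact: RL_sub_span.
  move: z; apply: (subring_gen_sub SGj) => z [[a _ <-]|cz] /=; apply: sub_subring_gen.
    by left; rewrite jLR; exists (iota a).
  by right; rewrite /CU /CL /constants /= in cz *; rewrite jLs cz.
have [p [a [c [Ia Cc e1]]]] : J 1.
  exact: (span_contains1 (J := J) JD JR JC Js Jrx rx0 (spanW _ Wrx)).
(* The constant 1 is put in front of the constants in 1 = sum_i a_i c_i, so that all of them are
   expanded along one family g free over L. *)
have cc i : sU (consf 1 c i) = consf 1 c i.
  by move: i; apply: ord_consP => [|i]; rewrite ?consf0 ?consfS ?rmorph1 //; apply: Cc.
have [t [g [k [gc kc ck fg]]]] := free_constants jLs (@field_sigma_simple _ sL) cc.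
(* Comparing coefficients of g_l writes the constants k_(0,l) expressing 1 as combinations of the
   a_i, which lie in I. One of them is nonzero, and it is invertible in C_L. *)
have kI l : I (k ord0 l).
  have -> : k ord0 l = \sum_i a i * k (lift ord0 i) l.
    apply/eqP; rewrite -subr_eq0; apply/eqP; move: l.
    apply: (fg (fun l => k ord0 l - \sum_i a i * k (lift ord0 i) l)).
    under eq_bigr => l _ do rewrite rmorphB mulrBl.
    rewrite sumrB -ck consf0.
    rewrite -(@regroup_constants _ _ jL _ a c t (fun i => k (lift ord0 i)) g).
      by rewrite e1 subrr.
    by move=> i; rewrite -ck consfS.
  apply: (big_ind (fun z => I z)) => // i _; rewrite mulrC; apply: IM => //.
  by apply: CS; apply: kc.
have [l kl] : exists l, k ord0 l != 0.
  apply: contrapT => /forallNP nk; have := ck ord0; rewrite consf0 big1.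
    by move/eqP; rewrite oner_eq0.
  by move=> l _; move: (nk l) => /negP; rewrite negbK => /eqP ->; rewrite rmorph0 mul0r.
rewrite -(mulVf kl); apply: IM => //; apply: CS.
by apply: (subfieldV constants_L); apply: kc.
Qed.

(** For a constant x of U transcendental over C_L in a residue field M, every x - k would be
    invertible in the finitely generated C_U, contrary to [nonunit_specialization]. So U is finite
    over L and the chosen maximal ideal has a finite orbit, which makes sigma^N descend to M. *)
Lemma U_residue : exists N (M : fieldType) (jM : {rmorphism U -> M}) (tM : {rmorphism M -> M}),
  [/\ (0 < N)%N, forall x, jM (iter N sU x) = 0 <-> jM x = 0,
      forall x, tM (jM x) = jM (iter N sU x) &
      forall x, CU x -> acl (jM @` (jL @` CL)) (jM x)].
Proof.
have [||q [qs q1 _ maxq]] := @max_stable_ideal U id [set 0].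
- split=> //= [x z -> ->|a x ->]; by rewrite ?addr0 ?mulr0.
- by move/eqP; rewrite oner_eq0.
have qp := maximal_prime qs q1 maxq.
have [M [jM [jME jMf]]] := residue_field qp.
have [c [cc [CUg Ug]]] := constants_U_generated.
have CUa x : CU x -> acl (jM @` (jL @` CL)) (jM x).
  move=> Cx; apply: contrapT => nx.
  have [k nu] := nonunit_specialization [seq jM r | r <- c]
    (rmorph_char0 (jM \o jL \o j) ch0) nx.
  have Cxk : CU (x - k%:R).
    apply: (subringB constants_U_subring) => //.
    exact: (subring_nat constants_U_subring).
  have xk0 : x - k%:R != 0.
    apply: contra_notN nx; rewrite subr_eq0 => /eqP ->; rewrite rmorph_nat.
    exact: (subring_nat (acl_subring _)).
  have [d Cd dx] := constants_U_inverse Cxk xk0.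
  apply: (nu (jM d)); last by rewrite -(rmorph_nat jM) -rmorphB -rmorphM mulrC dx rmorph1.
  rewrite -image_set_seq -image_setU subring_gen_image; exists d => //.
  exact: CUg.
have calg x : x \in c -> exists2 p : {poly L}, p != 0 & root (map_poly jL p) x.
  move=> xc; have Cx : CU x := cc _ xc; have [p p0 [Sp px]] := CUa _ Cx.
  rewrite !subring_gen_image (subring_gen_id constants_L_subring) image_comp in Sp.
  have [|p' Cp' e] := poly_over_image (f := jM \o jL) _ Sp.
    exact: (subring0 constants_L_subring).
  exists p'; first by apply: contra p0 => /eqP e'; rewrite e e' rmorph0.
  (* The relation is known only in M. Its value u in U is a constant that vanishes in M, and nonzero
     constants are units, so u = 0. *)
  apply/rootP/eqP; apply: contraT => u0; set u := _.[x] in u0.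
  have Cu : CU u.
    apply: (subring_horner constants_U_subring) => // i; rewrite coef_map /CU /constants /=.
    by have := Cp' i; rewrite /CL /constants /= jLs => ->.
  have [d _ du] := constants_U_inverse Cu u0.
  have : jM u = 0.
    rewrite /u -horner_map -map_poly_comp; apply/rootP; by rewrite -e.
  by move=> ju; have := congr1 jM du; rewrite rmorphM ju mulr0 rmorph1 => /eqP; rewrite eq_sym oner_eq0.
have [I [w span]] := finite_span calg.
have [N N0 qN] := maximal_ideal_finite_orbit sU_bij (fun u => span u (Ug u)) qp maxq.
have ker x : jM (iter N sU x) = 0 <-> jM x = 0 by rewrite !jME.
have [s sE] := iter_rmorphism sU N.
have [|tM tME] := fraction_extend (p := jM) (g := jM \o s) jMf.
  by move=> x; rewrite /= sE.
by exists N, M, jM, tM; split=> // x; rewrite tME /= sE.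
Qed.

(** * Krull dimension and the m-invariant through a residue field of the compositum *)

Section Residue.
Variables (N : nat) (M : fieldType) (jM : {rmorphism U -> M}) (tM : {rmorphism M -> M}).
Hypotheses (N0 : (0 < N)%N) (jMN : forall x, jM (iter N sU x) = 0 <-> jM x = 0)
  (tME : forall x, tM (jM x) = jM (iter N sU x))
  (CUa : forall x, CU x -> acl (jM @` (jL @` CL)) (jM x)).
Let P := [set x | jM (jR x) = 0].
Variables (Q : fieldType) (phi : {rmorphism R -> Q}).
Hypotheses (phiP : forall x, phi x = 0 <-> P x)
  (phiQ : forall q, exists a b, phi b != 0 /\ q = phi a / phi b).

Lemma residue_prime : is_prime P.
Proof. exact: (ker_prime (jM \o jR)). Qed.

Lemma jR_iter m x : jR (iter m sR x) = iter m sU (jR x).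
Proof. by elim: m => //= m <-; rewrite jRs. Qed.

Lemma residue_stable x : P (iter N sR x) <-> P x.
Proof. by rewrite /P /= jR_iter. Qed.

Lemma generators : exists g : seq R, forall x, subring_gen (range iota `|` [set` g]) x.
Proof.
have [g e] := adjoin_GL_generators (range iota) y; exists g => x.
by rewrite -e -R_gen.
Qed.

Lemma extend_iter m : (forall x, P (iter m sR x) <-> P x) ->
  exists t : {rmorphism Q -> Q}, bijective t /\ forall x, t (phi x) = phi (iter m sR x).
Proof.
move=> Pm; have [s sE] := iter_rmorphism sR m.
have [|t tE] := fraction_extend (p := phi) (g := phi \o s) phiQ.
  by move=> x; rewrite /= sE !phiP.
exists t; split=> [|x]; last by rewrite tE /= sE.
apply: bijective_of => [|q]; first exact: fmorph_inj.
have [a [b [b0 ->]]] := phiQ q.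
have [a' <-] := iter_surj sR_bij m a; have [b' <-] := iter_surj sR_bij m b.
by exists (phi a' / phi b'); rewrite fmorph_div !tE /= !sE.
Qed.

(** A transcendence basis z of Frac(R' / P) over K has the length of the Krull dimension. In M, over
    the images of K and C_L, it is compared with a transcendence basis b of L over KC_L. *)
Lemma Krull_dim_tr_deg : exists d, Krull_dim R d /\ tr_deg (subfield_gen (range j `|` CL)) d.
Proof.
have [g gP] := generators.
have [f fE] : exists f : {rmorphism Q -> M}, forall x, f (phi x) = jM (jR x).
  by apply: (fraction_extend (p := phi) (g := jM \o jR) phiQ) => x; rewrite phiP.
have [tQ [_ tQE]] := extend_iter residue_stable.
have ft x : tM (f x) = f (tQ x).
  have [a [b [_ ->]]] := phiQ x.
  by rewrite !(fmorph_div, tQE, fE) !tME !jR_iter.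
have [s [inds sg gs]] := exists_basis (range (phi \o iota)) [seq phi x | x <- g].
have [z zE] := subset_mapP sg; subst s.
have phi_acl x : acl (range (phi \o iota) `|` [set` [seq phi x | x <- z]]) (phi x).
  set G := acl _; have SG : subring (phi @^-1` G) by apply/subring_preimage/acl_subring.
  have := gP x; move: x; apply: (subring_gen_sub SG) => x [[a _ <-]|xg] /=.
    by apply: sub_acl; left; exists a.
  by apply: gs; apply: map_f.
exists (size z); split.
  apply: (Krull_dim_difference_ring (phi := phi) (N := N) gP ch0 sK_bij iotas) => // x xN.
  have [Ps P1 _] := residue_prime; have [P0 PD PM _] := Ps.
  apply: (orbit_zero simpleR N0 _ P1) => [|i iN]; last exact/phiP/xN.
  by split=> // w Pw; apply/residue_stable.
set SL := range j `|` CL; set Bs := (jM \o jL) @` SL.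
have CUB x : CU x -> acl Bs (jM x).
  move=> /CUa; apply: aclS => _ [_ [w Cw <-] <-]; exists w => //; by right.
(* The fixed elements of Q are algebraic over K, so [acl_constants] applies with E the closure of K
   and the later members of z: adjoining constants of L creates no dependence. *)
have indz : indep Bs [seq f x | x <- [seq phi x | x <- z]].
  elim: z inds {sg gs phi_acl} => //= x z IH [nx ind]; split; last exact: IH.
  pose H := range (phi \o iota) `|` [set` [seq phi x | x <- z]].
  have {}nx : ~ acl H (phi x) := nx.
  apply: contra_not nx => ax; apply: (@acl_sub _ (acl H)) => //.
  have SC : subring (jM @` CU) by apply/subring_image/constants_U_subring.
  apply: (acl_constants ft (acl_subring H) _ SC).
  - move=> q tq; apply: (@aclS _ (range (phi \o iota))); first by move=> w; left.
    exact: (fixed_algebraic sR_bij simpleR gP ch0 N0 residue_prime residue_stable phiP phiQ tQE tq).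
  - by move=> _ [w Cw <-]; rewrite tME iter_fix.
  - apply: aclS ax => w [[v [[a _ <-]|Cv] <-]|wz].
    + left; exists (phi (iota a)); first by apply: sub_acl; left; exists a.
      by rewrite fE /= jLR.
    + right; exists (jL v) => //; rewrite /CU /CL /constants /= in Cv *.
      by rewrite jLs Cv.
    + rewrite -image_set_seq in wz; case: wz => q qz <-; left; exists q => //.
      by apply: sub_acl; right.
pose Yg := [seq Y k.1 k.2 | k <- enum {: 'I_n * 'I_n}].
have [b [indb bY Yb]] := exists_basis SL Yg.
have Lb x : acl (SL `|` [set` b]) x.
  have FA := acl_subfield (SL `|` [set` b]).
  have SA := acl_subring (SL `|` [set` b]).
  have YA i k : acl (SL `|` [set` b]) (Y i k).
    by apply: Yb; apply/mapP; exists (i, k); rewrite ?mem_enum.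
  have RA w : RL w -> acl (SL `|` [set` b]) w.
    move: w; apply: (subring_gen_sub SA) => _ [[[a _ <-]|[i [k ->]]]|->] //.
      by apply: sub_acl; left; left; exists a.
    by apply: (subfieldV FA); apply: (subring_det SA).
  have [u [v [Ru Rv v0 ->]]] := L_frac x.
  by apply: (subringM SA); [exact: RA|apply: (subfieldV FA); exact: RA].
(* Steinitz in both directions over [Bs]: Y = y Z makes L algebraic over z, and y = Y W makes R'
   algebraic over b, the constants of U being algebraic over [Bs]. *)
have bz : size b = size z.
  apply/eqP; rewrite eqn_leq; apply/andP; split.
    have := @steinitz _ Bs [seq (jM \o jL) x | x <- b] [seq f x | x <- [seq phi x | x <- z]].
    rewrite !size_map; apply; first exact/indep_image.
    move=> _ /mapP[x _ ->]; set G := acl _.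
    have SG : subring G := acl_subring _; have FG : subfield G := acl_subfield _.
    have SGj := subring_preimage jM SG.
    have CUG w : CU w -> G (jM w) by move=> /CUB; apply: aclS => v; left.
    have RG w : G (jM (jR w)).
      have : acl (f @` (range (phi \o iota) `|` [set` [seq phi x | x <- z]])) (jM (jR w)).
        by rewrite -fE; apply/acl_image.
      apply: aclS; rewrite image_setU image_set_seq; apply: setSU => _ [_ [a _ <-] <-].
      by exists (j a); [left; exists a|rewrite /= fE jLR].
    have RLG w : RL w -> G (jM (jL w)).
      have [c [cc cS]] := constants_over_R.
      apply: (cS (jM @^-1` G)) => //; first by move=> _ [v _ <-]; apply: RG.
      by move=> v /= /cc; apply: CUG.
    have [u [v [Ru Rv v0 ->]]] := L_frac x.
    have -> : (jM \o jL) (u / v) = jM (jL u) / jM (jL v) by exact: fmorph_div.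
    by apply: (subringM SG); [exact: RLG|apply: (subfieldV FG); exact: RLG].
  have := @steinitz _ Bs [seq f x | x <- [seq phi x | x <- z]] [seq (jM \o jL) x | x <- b] indz.
  rewrite !size_map; apply=> _ /mapP[_ /mapP[x _ ->] ->]; rewrite fE.
  set G := acl _; have SG : subring G := acl_subring _.
  have SGj := subring_preimage jM SG.
  apply: (U_span_R_over_L SGj) => [_ [w _ <-]|c Cc] /=.
    have /acl_image : acl (SL `|` [set` b]) w by exact: Lb.
    by move=> /(_ _ (jM \o jL)); rewrite image_setU image_set_seq.
  by apply: aclS (CUB _ Cc) => v; left.
rewrite -bz; exists (fun i : 'I_(size b) => (rev b)`_i).
  apply: indep_algebraically_independent.
    exact/subfield_subring/subfield_gen_subfield.
  exact: indep_acl (@subfield_gen_acl _ SL) indb.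
move=> x; apply/acl_algebraic_over; apply: acl_sub (Lb x) => w [Sw|bw].
  by apply: sub_acl; left; apply: sub_subfield_gen.
apply: sub_acl; right; have ib : (index w (rev b) < size b)%N.
  by rewrite -size_rev index_mem mem_rev.
by exists (Ordinal ib) => //=; rewrite nth_index // mem_rev.
Qed.

(** A basis of the periodic elements of the component field Q over its constants lifts to g_1, ...,
    g_d in e0 R'. The l d elements sigma^k(g_i) form a basis of the periodic elements of R' over
    C_R', and both they and a basis of D_L over C_L are bases over C_U of the periodic elements of
    U. *)
Lemma m_invariant_degree : exists m, m_invariant sK iota sR m /\
  field_degree (periodic sL) CL m.
Proof.
have [gens gP] := generators.
have [l [e0 [l0 Pl eE dec]]] :=
  component_decomposition sR_bij simpleR N0 residue_prime residue_stable.
have [t [t_bij tE]] := extend_iter Pl.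
have [kQ [iQ iQE]] := subfield_type (constants_subfield (s := t) (@field_sigma_simple _ t)).
have [kR [iR iRE]] := subfield_type (constants_subfield simpleR).
have [kU [iU iUE]] := subfield_type constants_U.
have [kL [iL iLE]] := subfield_type constants_L.
have [_ [_ eprim] [_ orth] _ el] := dec.
have {}el : iter l sR e0 = e0 := el (Ordinal l0).
have [e00 ee _] : primitive_idempotent e0 by apply/eprim; exists (Ordinal l0).
have phie : phi e0 = 1.
  have : phi e0 != 0.
    by apply: contra e00 => /eqP/phiP/eE; rewrite ee => ->.
  by move=> p0; apply: (mulIf p0); rewrite mul1r -rmorphM ee.
have phiE x : phi x = 0 -> e0 * x = 0 by move/phiP/eE.
have phie0 (k : 'I_l) : (0 < k)%N -> phi (iter k sR e0) = 0.
  move=> k0; rewrite -[LHS]mul1r -phie -rmorphM.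
  by have /= -> := orth (Ordinal l0) k; rewrite ?rmorph0 // -val_eqE /= neq_ltn k0.
have tphi m x : iter m t (phi x) = phi (iter (m * l) sR x).
  by elim: m => //= m ->; rewrite tE -iterD -mulSn.
have Pml m x : P (iter (m * l) sR x) <-> P x by apply: iterN_prime.
have iterR m x x' : iter m sR (x * x') = iter m sR x * iter m sR x'.
  by have [_ -> _ _] := iter_morph sR m.
have iterRe m : iter (m * l) sR e0 = e0 by apply: periodic_comp.
(* Fixed elements of Q need no denominators, and their lifts in e0 R' are fixed as well because phi
   is injective there. *)
have fixedQ x m : (0 < m)%N -> iter m t x = x ->
    (exists g, [/\ phi g = x, e0 * g = g & iter (m * l) sR g = g]) /\
    acl (range (phi \o iota)) x.
  move=> m0 tx; have [tm tmE] := iter_rmorphism t m.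
  have ml0 : (0 < m * l)%N by rewrite muln_gt0 m0.
  have tmphi z : tm (phi z) = phi (iter (m * l) sR z) by rewrite tmE tphi.
  have tmx : tm x = x by rewrite tmE.
  split; last first.
    exact: (fixed_algebraic sR_bij simpleR gP ch0 ml0 residue_prime (Pml m) phiP phiQ tmphi tmx).
  have [r xr] := fixed_in_component sR_bij simpleR ml0 residue_prime (Pml m) phiP phiQ tmphi tmx.
  exists (e0 * r); split; first by rewrite rmorphM phie mul1r.
    by rewrite mulrA ee.
  rewrite iterR iterRe; apply/eqP; rewrite -subr_eq0 -mulrBr; apply/eqP/phiE.
  by rewrite rmorphB -tphi -xr tx subrr.
have phiK a : sK a = a -> constants t (phi (iota a)).
  move=> sa; rewrite /constants /= tE; congr (phi _).
  by elim: (l) => //= k ->; rewrite iotas sa.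
have iotaR m a : iter m sR (iota a) = iota (iter m sK a).
  by elim: m => //= m ->; rewrite iotas.
have [B bound] : exists B, forall r (v : 'I_r -> Q), (forall i, periodic t (v i)) ->
    free_over iQ v -> (r <= B)%N.
  have [x|B bound] := @finite_algebraic_part _ (range (phi \o iota)) [seq phi x | x <- gens].
    have SG := subfield_gen_subfield (range (phi \o iota) `|` [set` [seq phi x | x <- gens]]).
    have pS r : subfield_gen (range (phi \o iota) `|` [set` [seq phi x | x <- gens]]) (phi r).
      apply: subring_subfield_gen; rewrite range_comp_image subring_gen_image.
      by exists r.
    have [a [b [_ ->]]] := phiQ x.
    by apply: (subringM (subfield_subring SG)) => //; apply: (subfieldV SG).
  exists B => r v pv fv; apply: (bound r v) => [i|].
    by have [m m0 e] := pv i; have [_] := fixedQ _ _ m0 e.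
  have [m m0 vm] := common_period pv.
  have [tm tmE] := iter_rmorphism t m; have [sm smE] := iter_rmorphism sK (m * l).
  (* A family free over the constants of Q is free over K: elements of K fixed by sigma^(m l) lie in
     D_K = C_K, so they are constants of Q. The length is then bounded by the finite algebraic part
     of Q over K. *)
  have fK : free_over (phi \o iota : {rmorphism K -> Q}) v.
    apply: (constants_free_over (sS := sm) (sU := tm)) => [x||i|d dc e].
    - by rewrite /= tmE tphi iotaR smE.
    - exact: field_sigma_simple.
    - by rewrite tmE vm.
    - have dC i : sK (d i) = d i.
        have : periodic sK (d i) by exists (m * l)%N; rewrite ?muln_gt0 ?m0 // -smE.
        by rewrite -CK.
      have /choice[b bE] i : exists b, phi (iota (d i)) = iQ b by apply/iQE/phiK.
      have b0 : forall i, b i = 0.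
        by apply: fv; rewrite -[RHS]e; apply: eq_bigr => i _; rewrite /= bE.
      by move=> i; apply/eqP; rewrite -(fmorph_eq0 (phi \o iota)) /= bE b0 rmorph0.
  rewrite subfield_gen_id; last exact: (subfield_range (phi \o iota)).
  move=> c Kc e i; have /choice[b bE] k : exists b, phi (iota b) = c k.
    by have [b _ <-] := Kc k; exists b.
  by rewrite -bE (fK b) ?rmorph0 //; rewrite -[RHS]e; apply: eq_bigr => k _; rewrite /= bE.
have [d [v [Dv fv sv]]] := exists_max_free bound.
have degQ : field_degree (periodic t) (constants t) d.
  apply: (field_degree_basis iQE) => //.
  by move=> x cx; exists 1%N.
(* As D_K = C_K, the image of D_K already consists of constants of Q. *)
have CQ : subfield_gen ((phi \o iota) @` periodic sK `|` constants t) = constants t.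
  apply/seteqP; split; last by move=> x cx; apply: sub_subfield_gen; right.
  apply: subfield_gen_sub; first exact: (constants_subfield (@field_sigma_simple _ t)).
  by move=> x [[a pa <-]|//]; apply: phiK; move: pa; rewrite -CK.
have /choice[g gE] i : exists g, [/\ phi g = v i, e0 * g = g &
    exists2 m, (0 < m)%N & iter m sR g = g].
  have [m m0 e] := Dv i; have [[g [g1 g2 g3]] _] := fixedQ _ _ m0 e.
  by exists g; split=> //; exists (m * l)%N; rewrite ?muln_gt0 ?m0.
pose I := ('I_l * 'I_d)%type.
pose w (p : I) := iter p.1 sR (g p.2).
(* A constant of Q is lifted to h in e0 R' fixed by sigma^l; the sum of h over the l components is
   fixed by sigma, and phi kills all terms but the first. *)
have Cphi x : t x = x -> exists2 c, sR c = c & phi c = x.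
  move=> tx; have [[h [hx eh hl]] _] := fixedQ x 1%N isT tx.
  rewrite mul1n in hl; exists (\sum_(k < l) iter k sR h).
    rewrite rmorph_sum; case: (l) l0 hl => // l' _ hl'.
    by rewrite [LHS]big_ord_recr [RHS]big_ord_recl /= -iterS hl' addrC.
  rewrite rmorph_sum (bigD1 (Ordinal l0)) //= hx big1 ?addr0 // => k k0.
  rewrite -eh iterR rmorphM phie0 ?mul0r //.
  by rewrite lt0n -val_eqE /= in k0 *.
have phiC c : sR c = c -> exists b, phi c = iQ b.
  move=> cc; apply/iQE; rewrite /constants /= tE.
  by rewrite iter_fix.
have itC m c : sR c = c -> iter m sR c = c by move=> cc; rewrite iter_fix.
have spanR a m : (0 < m)%N -> iter m sR a = a -> exists c : I -> R,
    (forall p, sR (c p) = c p) /\ a = \sum_p c p * w p.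
  move=> m0 am.
  (* A preimage of a under sigma^k is obtained from the period m l, so the part of a in component k
     is sigma^k(e0 b_k). *)
  have /choice[b bE] (k : 'I_l) : exists b, iter k sR b = a /\ iter (m * l) sR b = b.
    exists (iter (m * l - k) sR a); rewrite -!iterD.
    have lk : (k <= m * l)%N by rewrite (leq_trans (ltnW (ltn_ord k))) // leq_pmull.
    rewrite subnKC // mulnC periodic_comp //; split=> //.
    by rewrite addnC iterD periodic_comp.
  have /choice[c cE] (k : 'I_l) : exists c : 'I_d -> R, (forall i, sR (c i) = c i) /\
      e0 * b k = \sum_i c i * g i.
    have [|x xE] := sv (phi (b k)).
      by exists m => //; rewrite tphi; case: (bE k) => _ ->.
    have /choice[c cE] i : exists c, sR c = c /\ phi c = iQ (x i).
      by have [|c] := Cphi (iQ (x i)); [apply/iQE; exists (x i)|exists c].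
    exists c; split=> [i|]; first by case: (cE i).
    have -> : \sum_i c i * g i = e0 * (\sum_i c i * g i).
      by rewrite mulr_sumr; apply: eq_bigr => i _; rewrite mulrCA; case: (gE i) => _ ->.
    apply/eqP; rewrite -subr_eq0 -mulrBr; apply/eqP/phiE.
    rewrite rmorphB xE rmorph_sum -sumrB; apply: big1 => i _.
    by rewrite rmorphM; case: (cE i) => _ ->; case: (gE i) => -> _ _; rewrite subrr.
  exists (fun p => c p.1 p.2); split=> [p|]; first by case: (cE p.1).
  rewrite -(pair_bigA _ (fun k i => c k i * iter k sR (g i))) /=.
  have [_ _ [sum1 _] _ _] := dec.
  rewrite -[LHS]mul1r -sum1 mulr_suml; apply: eq_bigr => k _.
  have [{1}<- _] := bE k; rewrite -iterR; have [ck ->] := cE k.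
  have [s sE] := iter_rmorphism sR k.
  rewrite -sE rmorph_sum; apply: eq_bigr => i _.
  by rewrite rmorphM !sE itC.
have freeR (c : I -> R) : (forall p, sR (c p) = c p) -> \sum_p c p * w p = 0 ->
    forall p, c p = 0.
  move=> cc e [k i].
  have ek : \sum_i c (k, i) * g i = 0.
    have [s sE] := iter_rmorphism sR k.
    have sI : injective s.
      by move=> x z; rewrite !sE; elim: (nat_of_ord k) => //= m IH /(bij_inj sR_bij)/IH.
    apply: sI; rewrite rmorph0 rmorph_sum.
    (* Multiplying the relation by the k-th idempotent isolates the terms of component k. *)
    transitivity (iter k sR e0 * \sum_p c p * w p); last by rewrite e mulr0.
    have -> : \sum_p c p * w p = \sum_k \sum_i c (k, i) * iter k sR (g i).
      by rewrite pair_bigA; apply: eq_bigr => -[].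
    rewrite (bigD1 k) //=.
    rewrite mulrDr [X in _ + X](_ : _ = 0) ?addr0.
      rewrite mulr_sumr; apply: eq_bigr => h _; rewrite rmorphM !sE itC //.
      by rewrite mulrCA -iterR; case: (gE h) => _ ->.
    rewrite mulr_sumr; apply: big1 => k' k'k; rewrite mulr_sumr; apply: big1 => h _.
    case: (gE h) => _ <- _; rewrite iterR mulrCA mulrA -/(iter _ _ _).
    have /= o := orth k k'; rewrite eq_sym in o.
    by rewrite -mulrA [iter k sR e0 * _]mulrA o // mul0r mulr0.
  have /choice[b bE] h : exists b, phi (c (k, h)) = iQ b by apply: phiC.
  have bi : b i = 0.
    move: i; apply: fv; rewrite -[RHS](rmorph0 phi) -ek rmorph_sum; apply: eq_bigr => h _.
    by rewrite rmorphM -bE; case: (gE h) => ->.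
  (* A nonzero constant of R' is a unit, so its image under phi cannot vanish. *)
  have [_ Cu] := constants_subfield simpleR.
  apply/eqP; apply: contraT => /(Cu _ (cc (k, i))) u.
  by have := rmorph_unit phi u; rewrite bE bi rmorph0 unitr0.
have wper p : exists2 m, (0 < m)%N & iter m sR (w p) = w p.
  have [_ _ [m m0 gm]] := gE p.2; exists m => //.
  by rewrite /w -iterD addnC iterD gm.
have freeU : free_over iU (fun p : 'I_#|{: I}| => jR (w (enum_val p))).
  apply: (@free_over_constants _ _ _ _ jR jRs simpleR _ _ iR iU _ (fun p => w (enum_val p))).
  - exact: iRE.
  - by move=> a; have /iUE : exists b, iU a = iU b by exists a.
  move=> c e p; apply/eqP; rewrite -(fmorph_eq0 iR) -[p]enum_valK; apply/eqP.
  move: (enum_val p); apply: (freeR (fun q => iR (c (enum_rank q)))) => [q|].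
    by have /iRE : exists b, iR (c (enum_rank q)) = iR b by exists (c (enum_rank q)).
  rewrite -[RHS]e (reindex_onto enum_rank enum_val) => [|q _]; last exact: enum_valK.
  rewrite (eq_bigl xpredT) => [|q]; last by rewrite enum_rankK eqxx.
  by apply: eq_bigr => q _; rewrite enum_rankK.
have spanU u m : (0 < m)%N -> iter m sU u = u -> exists c : I -> kU,
    u = \sum_p iU (c p) * jR (w p).
  move=> m0 um; have [r [a [c [am Cc ->]]]] := periodic_U_span_R m0 um.
  apply: (constant_span jRs _ Cc) => [x /iUE//|i].
  exact: spanR m0 (am i).
have jL_iter m x : iter m sU (jL x) = jL (iter m sL x).
  by elim: m => //= m ->; rewrite jLs.
have boundL r (v' : 'I_r -> L) : (forall i, periodic sL (v' i)) -> free_over iL v' ->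
    (r <= #|{: I}|)%N.
  move=> pv fv'.
  have fU : free_over iU (jL \o v').
    apply: (free_over_constants jLs (@field_sigma_simple _ sL) (iS := iL)) => //.
    by move=> a; have /iUE : exists b, iU a = iU b by exists a.
  apply: (free_span_le fU) => i /=; have [m m0 vm] := pv i.
  by apply: (spanU _ m) => //; rewrite jL_iter vm.
have [m [v' [Dv' fv' sv']]] := exists_max_free boundL.
have degL : field_degree (periodic sL) CL m.
  apply: (field_degree_basis iLE) => //.
  by move=> x cx; exists 1%N.
exists m; split=> //.
exists l, e0, Q, phi, t, d; split=> //.
- split=> // [x|x]; first by rewrite phiP -eE.
  by have [a [b [b0 ->]]] := phiQ x; exists (phi a), (phi b).
- by rewrite CQ.
(* Each of the two families is free over C_U and spanned by the other, which gives m <= l d and l d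
   <= m. *)
apply/eqP; rewrite eqn_leq; apply/andP; split.
  by have := boundL _ _ Dv' fv'; rewrite card_prod !card_ord.
have : (#|{: I}| <= #|'I_m|)%N; last by rewrite card_prod !card_ord.
apply: (free_span_le freeU (w := jL \o v')) => p.
have [k k0 wk] := wper (enum_val p).
have uk : iter k sU (jR (w (enum_val p))) = jR (w (enum_val p)) by rewrite -jR_iter wk.
have [r [a [c [ak Cc ->]]]] := periodic_U_span_L uk.
apply: (constant_span jLs _ Cc) => [x /iUE//|i].
have [|b ->] := sv' (a i); first by exists k.
exists (fun q => iL (b q)); split=> // q.
by have /iLE : exists b', iL (b q) = iL b' by exists (b q).
Qed.

End Residue.

End Setting.

(** If det Y were 0, independence of the entries would make the determinant the zero polynomial, but
    its value at the identity matrix is 1. *)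
Lemma algebraically_independent_unitmx (K L : fieldType) (j : {rmorphism K -> L}) n
    (Y : 'M[L]_n) :
  algebraically_independent (range j) (fun k => mxvec Y 0 k) -> Y \in unitmx.
Proof.
move=> ind; rewrite unitmxE unitfE.
pose X : 'M[{mpoly K[n * n]}]_n := \matrix_(i, k) 'X_(mxvec_index i k).
have ev (Z : 'M[L]_n) : (map_mpoly j (\det X)).@[fun k => mxvec Z 0 k] = \det Z.
  rewrite -[map_mpoly j _]/((map_mpoly j : {rmorphism _ -> _}) _) -det_map_mx.
  rewrite -[meval _ _]/((meval _ : {rmorphism _ -> _}) _) -det_map_mx; congr (\det _).
  apply/matrixP => i k; rewrite !mxE.
  by rewrite /= map_mpolyX mevalXU mxvecE.
apply/eqP => d0; have p0 : map_mpoly j (\det X) = 0.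
  apply: ind; last by rewrite ev.
  apply/mpoly_overE; first by exists 0; rewrite ?rmorph0.
  by move=> m; rewrite mcoeff_map_mpoly; exists (\det X)@_m.
by have := ev 1%:M; rewrite p0 meval0 det1 => /eqP; rewrite eq_sym oner_eq0.
Qed.

Theorem proposition4p11
  (* the difference field K and the equation sigma(X) = A X *)
  (K : fieldType) (sigmaK : {rmorphism K -> K}) (sigmaK_bij : bijective sigmaK)
  (charK0 : [pchar K] =i pred0)
  (CK_DK : constants sigmaK = periodic sigmaK)
  (n : nat) (A : 'M[K]_n) (A_unit : A \in unitmx)
  (* L is the field of fractions of R = K[Y, det(Y)^-1], sigma(Y) = A Y *)
  (L : fieldType) (sigmaL : {rmorphism L -> L}) (sigmaL_bij : bijective sigmaL)
  (iotaL : {rmorphism K -> L})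
  (iotaL_sigma : forall x, sigmaL (iotaL x) = iotaL (sigmaK x))
  (Y : 'M[L]_n)
  (Y_indep : algebraically_independent (range iotaL) (fun k => mxvec Y 0 k))
  (Y_eq : map_mx sigmaL Y = map_mx iotaL A *m Y)
  (R : set L) (R_def : R = adjoin_GL (range iotaL) Y)
  (L_frac : is_fraction_field_of R)
  (* R' is a Picard-Vessiot ring for sigma(X) = A X over K *)
  (R' : comUnitRingType) (sigmaR' : {rmorphism R' -> R'})
  (sigmaR'_bij : bijective sigmaR')
  (iotaR' : {rmorphism K -> R'})
  (iotaR'_sigma : forall x, sigmaR' (iotaR' x) = iotaR' (sigmaK x))
  (R'_PV : Picard_Vessiot sigmaR' (range iotaR') (map_mx iotaR' A) setT) :
  let KCL := subfield_gen (range iotaL `|` constants sigmaL) in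
  [/\ Picard_Vessiot sigmaL KCL (map_mx iotaL A) (subring_gen (KCL `|` R)),
      exists d, Krull_dim R' d /\ tr_deg KCL d
    & exists m, m_invariant sigmaK iotaR' sigmaR' m /\
        field_degree (periodic sigmaL) (constants sigmaL) m].
Proof.
move=> KCL; subst R.
have Yu := algebraically_independent_unitmx Y_indep.
have ch0 : char0 K by move=> k; rewrite (pcharf0P K).1.
have [_ [_ _] [y [yu ys R'E]] R'simple] := R'_PV.
have simpleR : sigma_simple sigmaR'.
  move=> I [I0 ID IM Is] x Ix x0.
  have Ii : ideal_in [set: R'] I by split=> // a z _; apply: IM.
  have Is' : sigmaR' @` I `<=` I by move=> _ [z Iz <-]; apply: Is.
  have [I0'|-> //] := R'simple I Ii Is'.
  by move: Ix x0; rewrite I0' => ->; rewrite eqxx.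
have [gens gensE] := adjoin_GL_generators (range iotaR') y.
have gensP x : subring_gen (range iotaR' `|` [set` gens]) x by rewrite -gensE -R'E.
have [U [sU [jL [jR [[sU_bij simpleU] jLs jRs jLR Ug]]]]] :=
  difference_compositum sigmaK_bij sigmaL_bij sigmaR'_bij iotaL_sigma iotaR'_sigma gensP.
have [N [M [jM [tM [N0 jMN tME CUa]]]]] :=
  U_residue sU_bij jLs jRs jLR Yu Y_eq yu ys R'E simpleU Ug ch0.
(* The prime P of R' is the contraction of the maximal ideal of U with residue field M; the same P,
   Q and phi serve for the dimension and for the m-invariant. *)
have [Q [phi [phiP phiQ]]] := residue_field (ker_prime (jM \o jR)).
split; last 2 first.
- exact: (Krull_dim_tr_deg sigmaK_bij sigmaR'_bij iotaR'_sigma jLs jRs jLR Yu Y_eq yu ys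
    L_frac R'E simpleR simpleU Ug ch0 N0 jMN tME CUa phiP phiQ).
- exact: (m_invariant_degree sigmaR'_bij iotaR'_sigma jLs jRs jLR Yu Y_eq yu ys
    L_frac R'E simpleR simpleU Ug ch0 CK_DK N0 jMN phiP phiQ).
have sub : range iotaL `|` constants sigmaL `<=` KCL by exact: sub_subfield_gen.
split.
- split; first exact: subfield_gen_subfield.
  rewrite -subfield_gen_image; congr subfield_gen; apply/seteqP; split=> x.
    move=> [z [[a _ <-]|cz] <-].
      by left; rewrite iotaL_sigma; exists (sigmaK a).
    by right; rewrite cz.
  case=> [[a _ <-]|cx]; last by exists x; [right|].
  have [sK' _ sKK'] := sigmaK_bij; exists (iotaL (sK' a)); last by rewrite iotaL_sigma sKK'.
  by left; exists (sK' a).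
- split; last by rewrite map_unitmx.
  by move=> _ [i [k ->]]; apply: sub; left; rewrite mxE; exists (A i k).
- exists Y; split=> //; apply/seteqP; split.
    apply: subring_gen_trans => x [Kx|].
      by apply: sub_subring_gen; left; left.
    apply: subring_genS; apply: setSU; apply: setSU => z Kz.
    by apply: sub; left.
  apply: subring_gen_trans => x [[Kx|Yx]|dx].
  + by apply: sub_subring_gen; left.
  + by apply: sub_subring_gen; right; apply: sub_subring_gen; left; right.
  + by apply: sub_subring_gen; right; apply: sub_subring_gen; right.
- exact: (extension_simple jLs jRs jLR Yu Y_eq yu ys R'E simpleR simpleU).
Qed.
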